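(* Let $\mathcal{O}_q(G/L_S)$ be an irreducible quantum flag manifold, $P=\mathcal{O}_q(G/L_S^{\mathrm{s}})$ with its right $\mathcal{O}(U_1)$-coaction $\Delta_{R,\mathcal{O}(U_1)}$, and $\Omega^{(0,1)}_q(G/L_S^{\mathrm{s}})$ the $(0,1)$-Heckenberger--Kolb first-order differential calculus over $P$. Then the pair consisting of the comodule algebra $(P,\Delta_{R,\mathcal{O}(U_1)})$ and the calculus $\Omega^{(0,1)}_q(G/L_S^{\mathrm{s}})$ is a quantum principal $\mathcal{O}(U_1)$-bundle.
   Context: Quantum groups. Let $\mathfrak{g}$ be a finite-dimensional complex simple Lie algebra of rank $l$ with Cartan subalgebra $\mathfrak{h}$, simple roots $\Pi=\{\alpha_1,\dots,\alpha_l\}$, positive roots $R^+$, Weyl group with longest element $w_0$, and form $(\cdot,\cdot)$ on $\mathfrak{h}^*$ normalised so that shortest simple roots satisfy $(\alpha_i,\alpha_i)=2$. Put $\alpha_i^\vee=2\alpha_i/(\alpha_i,\alpha_i)$, $a_{ij}=(\alpha_i^\vee,\alpha_j)$; let $\varpi_1,\dots,\varpi_l$ be the fundamental weights and $\mathcal{P}^+$ the dominant integral weights. Fix $q\in\mathbb{R}\setminus\{-1,0,1\}$ and $q_i=q^{(\alpha_i,\alpha_i)/2}$. $U_q(\mathfrak{g})$ is the Hopf algebra generated by $E_i,F_i,K_i^{\pm1}$ with $K_iK_j=K_jK_i$, $K_iE_j=q_i^{a_{ij}}E_jK_i$, $K_iF_j=q_i^{-a_{ij}}F_jK_i$, $E_iF_j-F_jE_i=\delta_{ij}(K_i-K_i^{-1})/(q_i-q_i^{-1})$,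 the quantum Serre relations, $\Delta(K_i)=K_i\otimes K_i$, $\Delta(E_i)=E_i\otimes K_i+1\otimes E_i$, $\Delta(F_i)=F_i\otimes1+K_i^{-1}\otimes F_i$, $\varepsilon(E_i)=\varepsilon(F_i)=0$, $\varepsilon(K_i)=1$. For $\lambda\in\mathcal{P}^+$, $V_\lambda$ is the finite-dimensional irreducible (type-1) left module generated by a vector $v$ with $E_iv=0$ and $K_iv=q^{(\alpha_i,\lambda)}v$ for all $i$. For $v\in V_\lambda$, $f\in V_\lambda^*$ set $c^{\lambda}_{f,v}(X)=f(Xv)$, $X\in U_q(\mathfrak{g})$. $\mathcal{O}_q(G)\subseteq U_q(\mathfrak{g})^\circ$ is the Hopf subalgebra spanned by all $c^{\lambda}_{f,v}$, $\lambda\in\mathcal{P}^+$. It carries the left action $X\triangleright a=a_{(1)}a_{(2)}(X)$ and the right action $a\triangleleft X=a_{(1)}(X)a_{(2)}$ of $U_q(\mathfrak{g})$. Irreducible quantum flag manifolds. For $S\subseteq\Pi$, $U_q(\mathfrak{l}_S)$ is the subalgebra generated by all $K_i^{\pm1}$ and by $E_j,F_j$ for $\alpha_j\in S$; $U_q(\mathfrak{l}_S^{\mathrm{s}})$ is the subalgebra generated by $K_j^{\pm1},E_j,F_j$ for $\alpha_j\in S$. Set $\mathcal{O}_q(G/L_S)=\{b\in\mathcal{O}_q(G): X\triangleright b=\varepsilon(X)b\ \forall X\in U_q(\mathfrak{l}_S)\}$ and $\mathcal{O}_q(G/L_S^{\mathrm{s}})=\{b: X\triangleright b=\varepsilon(X)b\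 \forall X\in U_q(\mathfrak{l}_S^{\mathrm{s}})\}$. The quantum flag manifold is irreducible when $S=\Pi\setminus\{\alpha_x\}$ with $\alpha_x$ of coefficient $1$ in the highest root (up to diagram automorphism: any node of $A_n$; the first node of $B_n$; the last node of $C_n$; the first node or a spin node of $D_n$; an end node of a long leg of $E_6$; the end node $7$ of $E_7$). Generators and $\mathcal{O}(U_1)$-coaction. Let $N=\dim V_{\varpi_x}$, let $v_1,\dots,v_N$ be a weight basis of $V_{\varpi_x}$ with $v_N$ a highest weight vector, and $f_1,\dots,f_N$ the dual basis of $V_{\varpi_x}^*\cong V_{-w_0(\varpi_x)}$ (left action $(Xf)(v)=f(S(X)v)$). Then $z_i=c^{\varpi_x}_{f_i,v_N}$ and $\overline{z}_j=c^{-w_0(\varpi_x)}_{v_j,f_N}$ generate $P=\mathcal{O}_q(G/L_S^{\mathrm{s}})$, which has a $\mathbb{Z}$-algebra grading with $\deg z_i=1$, $\deg\overline{z}_j=-1$ and degree zero part $\mathcal{O}_q(G/L_S)$. Equivalently $P$ is a right comodule algebra over the Hopf algebra $\mathcal{O}(U_1)=\mathbb{C}[t,t^{-1}]$ ($t$ grouplike) via $p\mapsto p\otimes t^{k}$ for $p$ of degree $k$; its coinvariants are $\mathcal{O}_q(G/L_S)$. Let $S_q[G/L_S]\subseteq P$ be the subalgebra generated by the $z_i$. Calculi. A first-order differential calculus (fodc) over an algebra $B$ is a $B$-bimodule $\Omega^1$ with a derivation $\mathrm{d}:B\to\Omega^1$ such that $\Omega^1$ is generated as a left module by $\mathrm{d}B$.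 Its restriction to a subalgebra $B'$ is the fodc over $B'$ generated inside $\Omega^1$ by the $\mathrm{d}b$, $b\in B'$. The universal fodc is $\Omega^1_u(B)=\ker(m:B\otimes B\to B)$ with $\mathrm{d}_ub=1\otimes b-b\otimes1$, and every fodc is $\Omega^1_u(B)/N$ for a unique sub-bimodule $N$. A fodc over a right $H$-comodule algebra $P$ is right $H$-covariant if $p\,\mathrm{d}p'\mapsto p_{(0)}\mathrm{d}p'_{(0)}\otimes p_{(1)}p'_{(1)}$ is well defined; left covariance is analogous. The $(0,1)$-calculus over $B=\mathcal{O}_q(G/L_S)$. Let $B^+=\ker(\varepsilon|_B)$, $K=U_q(\mathfrak{l}_S)$. Let $T^{(0,1)}$ be the span of the functionals on $B$ given by the Lusztig quantum root vectors $E_\beta$, $\beta\in R^+\setminus\mathbb{Z}S$, the underlying reduced decomposition of $w_0$ being such that $T^{(0,1)}$ is stable under left multiplication by $K$; explicitly, $T^{(0,1)}$ is the space of functionals induced by $U_q(\mathfrak{l}_S)E_x$. Put $I=\{b\in B^+: X(b)=0\ \forall X\in T^{(0,1)}\}$ and $V=B^+/I$, a right $B$-module and a right $K$-module via $\triangleleft$. Then $\Omega^{(0,1)}_q(G/L_S)$ consists of the $\sum_i a_i\otimes v_i\in\mathcal{O}_q(G)\otimes V$ with $\sum_i(Y\triangleright a_i)\otimes v_i=\sum_i a_i\otimes(v_i\triangleleft Y)$ for all $Y\in K$, with left $B$-action on the first factor, right action $(a\otimes v)b=ab_{(1)}\otimes vb_{(2)}$, left $\mathcal{O}_q(G)$-coaction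 on the first factor, and $\overline{\partial}b=b_{(1)}\otimes[b_{(2)}-\varepsilon(b_{(2)})1]$. The $(0,1)$-calculus over $P$. $(\Omega^{(0,1)}_q(G/L_S^{\mathrm{s}}),\overline{\partial})$ is the fodc over $P$ constructed by Heckenberger and Kolb; it is the unique left $\mathcal{O}_q(G)$-covariant fodc over $P$ such that $\overline{\partial}f=0$ for all $f\in S_q[G/L_S]$ and whose restriction to $\mathcal{O}_q(G/L_S)$ is $\Omega^{(0,1)}_q(G/L_S)$. Quantum principal bundles. For a Hopf algebra $H$, a quantum principal $H$-bundle is a pair $(P,\Omega^1(P))$ of a right $H$-comodule algebra $(P,\Delta_R)$ and a right $H$-covariant fodc $\Omega^1(P)=\Omega^1_u(P)/N$ such that: (1) $P$ is a Hopf--Galois extension of $B=P^{\mathrm{co}(H)}$, i.e. $\mathrm{can}=(m_P\otimes\mathrm{id})(\mathrm{id}\otimes\Delta_R):P\otimes_BP\to P\otimes H$ is bijective; (2) $\mathrm{ver}(N)=P\otimes I$ for some right ideal $I\subseteq H^+=\ker(\varepsilon)$ which is a subcomodule for $\mathrm{Ad}(h)=h_{(2)}\otimes S(h_{(1)})h_{(3)}$, where $\mathrm{ver}:\Omega^1_u(P)\to P\otimes H^+$ is the composition of the projection $P\otimes P\to P\otimes_BP$, restricted to $\Omega^1_u(P)$, with $\mathrm{can}$. *)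

(* Defs.v *)
From HB Require Import structures.
From mathcomp Require Import all_boot all_order all_algebra.
From mathcomp Require Import boolp.

Set Implicit Arguments.
Unset Strict Implicit.
Unset Printing Implicit Defensive.

Import Order.TTheory GRing.Theory Num.Theory.
Local Open Scope ring_scope.
Local Open Scope quotient_scope.

Reserved Notation "m ⊗ n" (at level 40, left associativity).
Reserved Notation "\tsum_ ( x , y <- t ) F"
  (at level 41, F at level 41, t at level 99, x name, y name,
   format "'[' \tsum_ ( x ,  y  <-  t ) '/  '  F ']'").

Section Tensor.
Variables (k : fieldType) (M N : lmodType k).

Definition bilinear_map (L : lmodType k) (f : M -> N -> L) : Prop :=
  (forall n, linear (fun m => f m n)) /\ (forall m, linear (f m)).

Definition pair_sum (L : lmodType k) (f : M -> N -> L) (s : seq (M * N)) : L :=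
  \sum_(x <- s) f x.1 x.2.

Variable I : M * N -> M * N -> Prop.

Definition respects (L : lmodType k) (f : M -> N -> L) : Prop :=
  forall x y, I x y -> f x.1 x.2 = f y.1 y.2.

(* Formal sums of pairs are identified when every bilinear map respecting the
   identifications I takes the same value on them: this is the universal
   property of M (x) N modulo the relations x.1 (x) x.2 = y.1 (x) y.2, I x y. *)
Definition tensor_eq (s t : seq (M * N)) : bool :=
  `[< forall (L : lmodType k) (f : M -> N -> L),
        bilinear_map f -> respects f -> pair_sum f s = pair_sum f t >].

Lemma tensor_eq_refl : reflexive tensor_eq.
Proof. by move=> s; apply/asboolP. Qed.

Lemma tensor_eq_sym : symmetric tensor_eq.
Proof.
by move=> s t; apply/asboolP/asboolP => h L f bf rf; rewrite (h L f bf rf).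
Qed.

Lemma tensor_eq_trans : transitive tensor_eq.
Proof.
move=> t s u /asboolP st /asboolP tu; apply/asboolP => L f bf rf.
by rewrite (st L f bf rf) (tu L f bf rf).
Qed.

Canonical tensor_equiv :=
  EquivRel tensor_eq tensor_eq_refl tensor_eq_sym tensor_eq_trans.

Definition gtensor := {eq_quot tensor_equiv}.
HB.instance Definition _ := Choice.on gtensor.
HB.instance Definition _ := EqQuotient.on gtensor.

Definition tens (m : M) (n : N) : gtensor := \pi_gtensor [:: (m, n)].

(* The value at t of the linear map sending m (x) n to f m n; it is meaningful
   when f is bilinear and respects I, see tfold_tens and tfold_is_linear. *)
Definition tfold (L : lmodType k) (t : gtensor) (f : M -> N -> L) : L :=
  pair_sum f (repr t).

Lemma tfold_pi (L : lmodType k) (f : M -> N -> L) s :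
  bilinear_map f -> respects f -> tfold (\pi_gtensor s) f = pair_sum f s.
Proof.
move=> bf rf; rewrite /tfold.
have /eqmodP/asboolP/(_ L f bf rf) // : repr (\pi_gtensor s) = s %[mod gtensor].
by rewrite reprK.
Qed.

Lemma gtensor_pi_eq s t :
  (forall (L : lmodType k) (f : M -> N -> L),
     bilinear_map f -> respects f -> pair_sum f s = pair_sum f t) ->
  \pi_gtensor s = \pi_gtensor t.
Proof. by move=> h; apply/eqmodP/asboolP. Qed.

Lemma gtensor_eqP (u v : gtensor) :
  (forall (L : lmodType k) (f : M -> N -> L),
     bilinear_map f -> respects f -> tfold u f = tfold v f) -> u = v.
Proof. by rewrite -[u]reprK -[v]reprK => h; apply: gtensor_pi_eq => L f bf rf;
  rewrite -(tfold_pi _ bf rf) -[RHS](tfold_pi _ bf rf); apply: h. Qed.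

Let scale_pair (c : k) (x : M * N) := (c *: x.1, x.2).

Definition gt_zero : gtensor := \pi_gtensor [::].
Definition gt_add (u v : gtensor) : gtensor := \pi_gtensor (repr u ++ repr v).
Definition gt_scale (c : k) (u : gtensor) : gtensor :=
  \pi_gtensor (map (scale_pair c) (repr u)).
Definition gt_opp (u : gtensor) : gtensor := gt_scale (-1) u.

Section Fold.
Variables (L : lmodType k) (f : M -> N -> L).
Hypotheses (bf : bilinear_map f) (rf : respects f).

Lemma tfold0 : tfold gt_zero f = 0.
Proof. by rewrite tfold_pi // /pair_sum big_nil. Qed.

Lemma tfoldD u v : tfold (gt_add u v) f = tfold u f + tfold v f.
Proof. by rewrite tfold_pi // /pair_sum big_cat. Qed.

Lemma tfoldZ c u : tfold (gt_scale c u) f = c *: tfold u f.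
Proof.
rewrite tfold_pi // /tfold /pair_sum big_map scaler_sumr.
apply: eq_bigr => x _ /=.
have := bf.1 x.2 c x.1 0; have := bf.1 x.2 1 0 0.
rewrite !scale1r !addr0 => h ->.
by move: h; rewrite -[LHS]addr0 => /addrI <-; rewrite addr0.
Qed.
End Fold.

Lemma gt_addA : associative gt_add.
Proof. by move=> u v w; apply: gtensor_eqP => L f bf rf; rewrite !tfoldD // addrA. Qed.
Lemma gt_addC : commutative gt_add.
Proof. by move=> u v; apply: gtensor_eqP => L f bf rf; rewrite !tfoldD // addrC. Qed.
Lemma gt_add0 : left_id gt_zero gt_add.
Proof. by move=> u; apply: gtensor_eqP => L f bf rf; rewrite tfoldD // tfold0 // add0r. Qed.
Lemma gt_addN : left_inverse gt_zero gt_opp gt_add.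
Proof.
move=> u; apply: gtensor_eqP => L f bf rf.
by rewrite tfoldD // tfold0 // tfoldZ // scaleN1r addNr.
Qed.
HB.instance Definition _ := GRing.isZmodule.Build gtensor gt_addA gt_addC gt_add0 gt_addN.

Lemma gt_scaleA a b u : gt_scale a (gt_scale b u) = gt_scale (a * b) u.
Proof. by apply: gtensor_eqP => L f bf rf; rewrite !tfoldZ // scalerA. Qed.
Lemma gt_scale1 : left_id 1 gt_scale.
Proof. by move=> u; apply: gtensor_eqP => L f bf rf; rewrite tfoldZ // scale1r. Qed.
Lemma gt_scaleDr : right_distributive gt_scale +%R.
Proof.
by move=> c u v; apply: gtensor_eqP => L f bf rf;
  rewrite tfoldZ // !tfoldD // !tfoldZ // scalerDr.
Qed.
Lemma gt_scaleDl u : {morph gt_scale^~ u : a b / a + b}.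
Proof.
by move=> a b; apply: gtensor_eqP => L f bf rf;
  rewrite tfoldD // !tfoldZ // scalerDl.
Qed.
HB.instance Definition _ :=
  GRing.Zmodule_isLmodule.Build k gtensor gt_scaleA gt_scale1 gt_scaleDr gt_scaleDl.

Lemma tfold_is_linear (L : lmodType k) (f : M -> N -> L) :
  bilinear_map f -> respects f -> linear (fun t : gtensor => tfold t f).
Proof. by move=> bf rf c u v; rewrite [LHS]tfoldD // tfoldZ. Qed.

Lemma tfold_tens (L : lmodType k) (f : M -> N -> L) m n :
  bilinear_map f -> respects f -> tfold (tens m n) f = f m n.
Proof. by move=> bf rf; rewrite tfold_pi // /pair_sum big_seq1. Qed.

Lemma tens_bilinear : bilinear_map tens.
Proof.
split=> [n c m m' | m c n n']; apply: gtensor_eqP => L f bf rf;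
  rewrite tfold_is_linear // !tfold_tens //; [exact: bf.1 | exact: bf.2].
Qed.

Lemma tens_respects : respects tens.
Proof.
by move=> x y Ixy; apply: gtensor_eqP => L f bf rf; rewrite !tfold_tens //; apply: rf.
Qed.

Lemma gtensor_sum (t : gtensor) : t = \sum_(x <- repr t) tens x.1 x.2.
Proof.
apply: gtensor_eqP => L f bf rf; rewrite {1}/tfold /pair_sum.
elim: (repr t) => [|x s IH]; first by rewrite !big_nil tfold0.
by rewrite !big_cons [RHS]tfoldD // -IH tfold_tens.
Qed.

End Tensor.

Definition no_relation (T : Type) : T -> T -> Prop := fun _ _ => False.
Definition tensor (k : fieldType) (M N : lmodType k) := gtensor (@no_relation (M * N)).

Notation "M ⊗ N" := (tensor M N) : type_scope.
Notation "m ⊗ n" := (tens (@no_relation _) m n) : ring_scope.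
(* Sweedler-style sums: t is written as a sum of pure tensors x (x) y. *)
Notation "\tsum_ ( x , y <- t ) F" := (tfold t (fun x y => F)) : ring_scope.

Definition tensor_mul (k : fieldType) (A B : algType k) (s t : A ⊗ B) : A ⊗ B :=
  \tsum_(a, b <- s) \tsum_(a', b' <- t) ((a * a') ⊗ (b * b')).

Section Algebra.
Variable k : fieldType.

Definition is_subspace (V : lmodType k) (W : V -> Prop) : Prop :=
  W 0 /\ forall c v w, W v -> W w -> W (c *: v + w).

Definition is_subalgebra (A : algType k) (W : A -> Prop) : Prop :=
  [/\ is_subspace W, W 1 & forall a b, W a -> W b -> W (a * b)].

Definition generated_subalgebra (A : algType k) (X : A -> Prop) (a : A) : Prop :=
  forall W : A -> Prop, is_subalgebra W -> (forall x, X x -> W x) -> W a.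

Record hopf := Hopf {
  hopf_alg :> algType k;
  comul : {linear hopf_alg -> (hopf_alg ⊗ hopf_alg)%type};
  counit : {linear hopf_alg -> k^o};
  antipode : {linear hopf_alg -> hopf_alg};
  comul1 : comul 1 = 1 ⊗ 1;
  comulM : forall a b, comul (a * b) = tensor_mul (comul a) (comul b);
  counit1 : counit 1 = 1;
  counitM : forall a b, counit (a * b) = counit a * counit b;
  comulA : forall a,
    \tsum_(b, c <- comul a) \tsum_(b1, b2 <- comul b) (b1 ⊗ (b2 ⊗ c)) =
    \tsum_(b, c <- comul a) (b ⊗ comul c);
  counit_left : forall a, \tsum_(b, c <- comul a) (counit b *: c) = a;
  counit_right : forall a, \tsum_(b, c <- comul a) (counit c *: b) = a;
  antipode_left : forall a, \tsum_(b, c <- comul a) (antipode b * c) = counit a *: 1;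
  antipode_right : forall a, \tsum_(b, c <- comul a) (b * antipode c) = counit a *: 1
}.
Arguments comul {h}.
Arguments counit {h}.
Arguments antipode {h}.

Record right_comodule_algebra (H : hopf) (P : algType k) (rho : P -> P ⊗ H) : Prop := {
  rca_linear : linear rho;
  rca_coassoc : forall p,
    \tsum_(p0, h <- rho p) \tsum_(p00, p01 <- rho p0) (p00 ⊗ (p01 ⊗ h)) =
    \tsum_(p0, h <- rho p) (p0 ⊗ comul h);
  rca_counit : forall p, \tsum_(p0, h <- rho p) (counit h *: p0) = p;
  rca_one : rho 1 = 1 ⊗ 1;
  rca_mul : forall p p', rho (p * p') = tensor_mul (rho p) (rho p')
}.

(* A subalgebra, given by its embedding, that the comultiplication maps into
   O (x) lcs_alg. *)
Record left_coideal_subalgebra (O : hopf) := LeftCoidealSubalgebra {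
  lcs_alg :> algType k;
  incl : {lrmorphism lcs_alg -> O};
  incl_inj : injective incl;
  lcoact : {linear lcs_alg -> (O ⊗ lcs_alg)%type};
  lcoactE : forall p, \tsum_(a, p' <- lcoact p) (a ⊗ incl p') = comul (incl p)
}.
Arguments incl {O l}.
Arguments lcoact {O l}.

Record bimodule (A : algType k) := Bimodule {
  bimod :> lmodType k;
  lact : A -> bimod -> bimod;
  ract : bimod -> A -> bimod;
  lact_bilinear : bilinear_map lact;
  ract_bilinear : bilinear_map ract;
  lact1 : forall w, lact 1 w = w;
  ract1 : forall w, ract w 1 = w;
  lactM : forall a b w, lact (a * b) w = lact a (lact b w);
  ractM : forall a b w, ract w (a * b) = ract (ract w a) b;
  lract : forall a b w, ract (lact a w) b = lact a (ract w b)
}.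

Record fodc (A : algType k) := Fodc {
  forms :> bimodule A;
  diff : {linear A -> forms};
  diffM : forall a b, diff (a * b) = ract (diff a) b + lact a (diff b);
  forms_gen : forall w : forms, exists s : seq (A * A),
    w = \sum_(x <- s) lact x.1 (diff x.2)
}.

(* N in the presentation Omega_u(A) / N of the calculus: in ker m one has
   sum a (x) b = sum a d_u b, which is sent to sum a d b. *)
Definition fodc_kernel (A : algType k) (W : fodc A) (t : A ⊗ A) : Prop :=
  \tsum_(a, b <- t) (a * b) = 0 /\ \tsum_(a, b <- t) lact a (diff W b) = 0.

Definition right_covariant (H : hopf) (P : algType k) (rho : P -> P ⊗ H)
    (W : fodc P) : Prop :=
  exists D : {linear W -> (W ⊗ H)%type}, forall p p',
    D (lact p (diff W p')) =
    \tsum_(p0, p1 <- rho p) \tsum_(p0', p1' <- rho p')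
      (lact p0 (diff W p0') ⊗ (p1 * p1')).

Definition left_covariant (O : hopf) (P : left_coideal_subalgebra O)
    (W : fodc P) : Prop :=
  exists D : {linear W -> (O ⊗ W)%type}, forall p p',
    D (lact p (diff W p')) =
    \tsum_(a, p0 <- lcoact p) \tsum_(a', p0' <- lcoact p')
      ((a * a') ⊗ lact p0 (diff W p0')).

Section Bundle.
Variables (H : hopf) (P : algType k) (rho : P -> P ⊗ H).

Definition coinvariant (p : P) : Prop := rho p = p ⊗ 1.

Definition coinvariant_balance (x y : P * P) : Prop :=
  exists p b p', [/\ coinvariant b, x = (p * b, p') & y = (p, b * p')].

(* P (x)_B P for B the coinvariants. *)
Definition tensor_over_coinv := gtensor coinvariant_balance.

Definition to_tensor_over_coinv (t : P ⊗ P) : tensor_over_coinv :=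
  \tsum_(p, p' <- t) tens coinvariant_balance p p'.

Definition can (t : tensor_over_coinv) : P ⊗ H :=
  \tsum_(p, p' <- t) \tsum_(p0, p1 <- rho p') ((p * p0) ⊗ p1).

Definition ver (t : P ⊗ P) : P ⊗ H := can (to_tensor_over_coinv t).

Definition tensor_subspace (V : lmodType k) (I : H -> Prop) (w : V ⊗ H) : Prop :=
  exists2 s : seq (V * H), (forall x, x \in s -> I x.2) &
    w = \sum_(x <- s) (x.1 ⊗ x.2).

Definition flip_tensor_subspace (V : lmodType k) (I : H -> Prop) (w : H ⊗ V) : Prop :=
  exists2 s : seq (H * V), (forall x, x \in s -> I x.1) &
    w = \sum_(x <- s) (x.1 ⊗ x.2).

Definition Ad (h : H) : H ⊗ H :=
  \tsum_(h1, h' <- comul h) \tsum_(h2, h3 <- comul h') (h2 ⊗ (antipode h1 * h3)).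

Definition quantum_principal_bundle (W : fodc P) : Prop :=
  [/\ right_comodule_algebra rho,
      right_covariant rho W,
      bijective can &
      exists I : H -> Prop,
        [/\ is_subspace I /\ (forall h h', I h -> I (h * h')),
            (forall h, I h -> counit h = 0),
            (forall h, I h -> flip_tensor_subspace I (Ad h)) &
            forall w : P ⊗ H,
              (exists2 t, fodc_kernel W t & ver t = w) <-> tensor_subspace I w]].

End Bundle.

(* O(U_1) = k[t, t^-1] with t grouplike. *)
Record laurent_hopf := LaurentHopf {
  laurent :> hopf;
  lt : laurent;
  ltV : laurent;
  lt_ltV : lt * ltV = 1;
  ltV_lt : ltV * lt = 1;
  lt_pow := fun n : int => match n with Posz m => lt ^+ m | Negz m => ltV ^+ m.+1 end;
  lt_span : forall h : laurent, exists s : seq (k * int),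
    h = \sum_(x <- s) x.1 *: lt_pow x.2;
  lt_free : forall (s : seq int) (c : int -> k), uniq s ->
    \sum_(n <- s) c n *: lt_pow n = 0 -> forall n, n \in s -> c n = 0;
  lt_comul : comul lt = lt ⊗ lt;
  lt_counit : counit lt = 1
}.

Record Z_grading (P : algType k) (gr : int -> P -> Prop) : Prop := {
  gr_subspace : forall n, is_subspace (gr n);
  gr_one : gr 0 1;
  gr_mul : forall m n a b, gr m a -> gr n b -> gr (m + n) (a * b);
  gr_sum : forall p, exists (s : seq int) (f : int -> P),
    (forall n, gr n (f n)) /\ p = \sum_(n <- s) f n;
  gr_direct : forall (s : seq int) (f : int -> P), uniq s -> (forall n, gr n (f n)) ->
    \sum_(n <- s) f n = 0 -> forall n, n \in s -> f n = 0
}.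

End Algebra.
Arguments comul {k h}.
Arguments counit {k h}.
Arguments antipode {k h}.
Arguments incl {k O l}.
Arguments lcoact {k O l}.

(* A finite-dimensional complex simple Lie algebra enters through its Cartan
   matrix a i j = (alpha_i^vee, alpha_j) and the half square lengths
   d i = (alpha_i, alpha_i) / 2 of its simple roots, so that
   (alpha_i, alpha_j) = d i * a i j. *)
Record simple_type (l : nat) := SimpleType {
  cartan : 'I_l -> 'I_l -> int;
  half_len : 'I_l -> nat;
  cartan_diag : forall i, cartan i i = 2;
  cartan_offdiag : forall i j, i != j -> cartan i j <= 0;
  cartan_sym : forall i j,
    (half_len i)%:Z * cartan i j = (half_len j)%:Z * cartan j i;
  cartan_posdef : forall v : 'I_l -> rat, (exists i, v i != 0) ->
    0 < \sum_i \sum_j (half_len i)%:R * (cartan i j)%:~R * v i * v j;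
  cartan_indecomposable : forall J : {set 'I_l}, J != set0 -> J != setT ->
    exists i j, [/\ i \in J, j \notin J & cartan i j != 0];
  half_len_gt0 : forall i, (0 < half_len i)%N;
  half_len_short : exists i, half_len i = 1%N
}.

(* Roots are written in the basis of simple roots and obtained from the simple
   roots by simple reflections. *)
Inductive is_root l (g : simple_type l) : 'rV[int]_l -> Prop :=
| RootSimple i : is_root g (delta_mx 0 i)
| RootReflect i b : is_root g b ->
    is_root g (b - (\sum_j b 0 j * cartan g i j) *: delta_mx 0 i).

Definition is_highest_root l (g : simple_type l) (b : 'rV[int]_l) : Prop :=
  is_root g b /\ forall b', is_root g b' -> forall i, b' 0 i <= b 0 i.

(* The condition on alpha_x for S = Pi \ {alpha_x} to define an irreducible
   flag manifold. *)
Definition irreducible_node l (g : simple_type l) (x : 'I_l) : Prop :=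
  exists2 b, is_highest_root g b & b 0 x = 1.

Section QuantumGroup.
Variables (k : fieldType) (q : k) (l : nat) (g : simple_type l).

Definition q_int (p : k) (n : nat) : k := (p ^+ n - p ^- n) / (p - p^-1).
Definition q_fact (p : k) (n : nat) : k := \prod_(1 <= m < n.+1) q_int p m.
Definition q_binom (p : k) (n m : nat) : k :=
  q_fact p n / (q_fact p m * q_fact p (n - m)).

Definition q_ (i : 'I_l) : k := q ^+ half_len g i.

Definition q_serre (A : algType k) (X : 'I_l -> A) : Prop :=
  forall i j, i != j -> let n := `|1 - cartan g i j|%N in
    \sum_(r < n.+1) ((-1) ^+ r * q_binom (q_ i) n r) *:
      (X i ^+ (n - r) * X j * X i ^+ r) = 0.

Record uq_relations (A : algType k) (E F K KV : 'I_l -> A) : Prop := {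
  rel_KKV : forall i, K i * KV i = 1;
  rel_KVK : forall i, KV i * K i = 1;
  rel_KK : forall i j, K i * K j = K j * K i;
  rel_KE : forall i j, K i * E j = q_ i ^ (cartan g i j) *: (E j * K i);
  rel_KF : forall i j, K i * F j = q_ i ^ (- cartan g i j) *: (F j * K i);
  rel_EF : forall i j, E i * F j - F j * E i =
    (i == j)%:R *: ((q_ i - (q_ i)^-1)^-1 *: (K i - KV i));
  rel_serreE : q_serre E;
  rel_serreF : q_serre F
}.

(* The Hopf algebra presented by the above generators and relations: uq_lift
   and uq_uniq are the universal property of the presentation. *)
Record quantum_group := QuantumGroup {
  uq :> hopf k;
  uE : 'I_l -> uq;
  uF : 'I_l -> uq;
  uK : 'I_l -> uq;
  uKV : 'I_l -> uq;
  uq_rel : uq_relations uE uF uK uKV;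
  uq_lift : forall (A : algType k) (E F K KV : 'I_l -> A), uq_relations E F K KV ->
    exists f : {lrmorphism uq -> A}, forall i,
      [/\ f (uE i) = E i, f (uF i) = F i, f (uK i) = K i & f (uKV i) = KV i];
  uq_uniq : forall (A : algType k) (f f' : {lrmorphism uq -> A}),
    (forall i, [/\ f (uE i) = f' (uE i), f (uF i) = f' (uF i),
                   f (uK i) = f' (uK i) & f (uKV i) = f' (uKV i)]) -> f =1 f';
  comul_K : forall i, comul (uK i) = uK i ⊗ uK i;
  comul_E : forall i, comul (uE i) = uE i ⊗ uK i + 1 ⊗ uE i;
  comul_F : forall i, comul (uF i) = uF i ⊗ 1 + uKV i ⊗ uF i;
  counit_K : forall i, counit (uK i) = 1;
  counit_E : forall i, counit (uE i) = 0;
  counit_F : forall i, counit (uF i) = 0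
}.

Variable U : quantum_group.

Definition irreducible_rep n (r : U -> 'M[k]_n.+1) : Prop :=
  forall W : {vspace 'cV[k]_n.+1},
    (forall X w, w \in W -> r X *m w \in W) -> W = 0%VS \/ W = fullv.

(* r is V_lambda with highest weight vector v, where lambda is the sum of the
   lam i * varpi_i, so that (alpha_i, lambda) = half_len g i * lam i. *)
Definition is_V (lam : 'I_l -> nat) n (r : U -> 'M[k]_n.+1) (v : 'cV[k]_n.+1) : Prop :=
  [/\ irreducible_rep r,
      forall w, exists X, w = r X *m v,
      forall i, r (uE U i) *m v = 0 &
      forall i, r (uK U i) *m v = q ^+ (half_len g i * lam i) *: v].

Definition fundamental_weight (x : 'I_l) : 'I_l -> nat := fun i => (i == x).

Definition matrix_coefficient (c : U -> k) : Prop :=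
  exists (lam : 'I_l -> nat) n (r : {lrmorphism U -> 'M[k]_n.+1}) v,
    is_V lam r v /\
    exists (f : 'rV[k]_n.+1) (w : 'cV[k]_n.+1), forall X, c X = (f *m r X *m w) 0 0.

Definition in_span_of_coefficients (c : U -> k) : Prop :=
  exists n (a : 'I_n -> k) (c_ : 'I_n -> U -> k),
    (forall i, matrix_coefficient (c_ i)) /\ forall X, c X = \sum_i a i * c_ i X.

(* O_q(G), the Hopf subalgebra of the Hopf dual of U spanned by the matrix
   coefficients; ev is the evaluation pairing. *)
Record coordinate_algebra := CoordinateAlgebra {
  oq :> hopf k;
  ev : oq -> U -> k;
  ev_inj : forall a b, ev a =1 ev b -> a = b;
  ev_image : forall c, (exists a, ev a =1 c) <-> in_span_of_coefficients c;
  ev_linear : forall c a b X, ev (c *: a + b) X = c * ev a X + ev b X;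
  ev_one : forall X, ev 1 X = counit X;
  ev_mul : forall a b X,
    ev (a * b) X = \tsum_(X1, X2 <- comul X) (ev a X1 * ev b X2 : k^o);
  ev_counit : forall a, counit a = ev a 1;
  ev_comul : forall a X Y,
    ev a (X * Y) = \tsum_(a1, a2 <- comul a) (ev a1 X * ev a2 Y : k^o);
  ev_antipode : forall a X, ev (antipode a) X = ev a (antipode X)
}.

Variable O : coordinate_algebra.

Definition left_action (X : U) (a : O) : O := \tsum_(a1, a2 <- comul a) (ev a2 X *: a1).

(* The right action restricts to left coideal subalgebras. *)
Definition right_action (B : left_coideal_subalgebra O) (b : B) (X : U) : B :=
  \tsum_(a, b' <- lcoact b) (ev a X *: b').

(* The subalgebra of the elements of O invariant under X in K. *)
Record invariant_algebra (K : U -> Prop) := InvariantAlgebra {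
  inv_alg :> left_coideal_subalgebra O;
  inv_algP : forall a,
    (exists p : inv_alg, incl p = a) <->
    (forall X, K X -> left_action X a = counit X *: a)
}.

Variable x : 'I_l.

(* U_q(l_S) and U_q(l_S^s). *)
Definition levi : U -> Prop := generated_subalgebra (fun X =>
  (exists i, X = uK U i \/ X = uKV U i) \/
  (exists2 j, j != x & X = uE U j \/ X = uF U j)).

Definition levi_ss : U -> Prop := generated_subalgebra (fun X =>
  exists2 j, j != x & [\/ X = uK U j, X = uKV U j, X = uE U j | X = uF U j]).

(* O_q(G/L_S) and O_q(G/L_S^s). *)
Definition flag_algebra := invariant_algebra levi.
Definition sphere_algebra := invariant_algebra levi_ss.

Section FlagCalculus.
Variable B : flag_algebra.

(* T^(0,1) consists of the functionals b |-> ev (incl b) (Y * E_x), Y in levi. *)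
Definition flag_ideal (b : B) : Prop :=
  counit (incl b) = 0 /\ forall Y, levi Y -> ev (incl b) (Y * uE U x) = 0.

Definition flag_relation (y z : O * B) : Prop :=
  y.1 = z.1 /\ flag_ideal (y.2 - z.2).

(* O (x) (B / I); as V = B^+ / I is a subspace of B / I, the space O (x) V is
   the span of the a (x) [b] with b in B^+. *)
Definition flag_forms := gtensor flag_relation.
Notation "a ⊠ b" := (tens flag_relation a b) (at level 40).

Definition in_OV (w : flag_forms) : Prop :=
  exists2 s : seq (O * B), (forall y, y \in s -> counit (incl y.2) = 0) &
    w = \sum_(y <- s) (y.1 ⊠ y.2).

(* The elements of Omega^(0,1)_q(G/L_S). *)
Definition flag_Omega (w : flag_forms) : Prop :=
  in_OV w /\ forall Y, levi Y ->
    \tsum_(a, b <- w) (left_action Y a ⊠ b) =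
    \tsum_(a, b <- w) (a ⊠ right_action b Y).

Definition flag_lact (b : B) (w : flag_forms) : flag_forms :=
  \tsum_(a, b' <- w) ((incl b * a) ⊠ b').

Definition flag_ract (w : flag_forms) (b : B) : flag_forms :=
  \tsum_(a, b' <- w) \tsum_(b1, b2 <- lcoact b) ((a * b1) ⊠ (b' * b2)).

Definition flag_dbar (b : B) : flag_forms :=
  \tsum_(b1, b2 <- lcoact b) (b1 ⊠ (b2 - counit (incl b2) *: 1)).

Section Restriction.
Variables (P : sphere_algebra) (W : fodc P).

(* By the Leibniz rule the left B-span of dB is already a sub-bimodule. *)
Definition restricted_form (w : W) : Prop :=
  exists2 s : seq (P * P),
    forall y, y \in s -> (exists b : B, incl b = incl y.1) /\
                         (exists b : B, incl b = incl y.2) &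
    w = \sum_(y <- s) lact y.1 (diff W y.2).

(* The restriction of W to B is isomorphic, as a fodc over B, to
   Omega^(0,1)_q(G/L_S); p below denotes b viewed in P. *)
Definition restricts_to_flag_calculus : Prop :=
  exists phi : W -> flag_forms,
    [/\ forall c w w', restricted_form w -> restricted_form w' ->
          phi (c *: w + w') = c *: phi w + phi w',
        forall w w', restricted_form w -> restricted_form w' ->
          phi w = phi w' -> w = w',
        forall u, flag_Omega u <-> (exists2 w, restricted_form w & phi w = u),
        forall (b : B) (p : P) w, incl b = incl p -> restricted_form w ->
          phi (lact p w) = flag_lact b (phi w) /\
          phi (ract w p) = flag_ract (phi w) b &
        forall (b : B) (p : P), incl b = incl p -> phi (diff W p) = flag_dbar b].

End Restriction.
End FlagCalculus.

(* The data of a weight basis v_1, ..., v_N of V_{varpi_x} with v_N a highest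
   weight vector: V_{varpi_x} is realized on column vectors with basis
   delta_mx i 0, v_N = delta_mx ord_max 0, and N = (fund_dim).+1. *)
Record fundamental_basis := FundamentalBasis {
  fund_dim : nat;
  fund_rep : {lrmorphism U -> 'M[k]_fund_dim.+1};
  fund_is_V : is_V (fundamental_weight x) fund_rep (delta_mx ord_max 0);
  fund_weight : forall i, is_diag_mx (fund_rep (uK U i))
}.

Variables (V : fundamental_basis) (P : sphere_algebra).

(* z_i(X) = f_i (X v_N). *)
Definition is_z (i : 'I_(fund_dim V).+1) (p : P) : Prop :=
  forall X, ev (incl p) X = fund_rep V X i ord_max.

(* zbar_j(X) = v_j (X f_N) = f_N (S(X) v_j); the module V_{- w_0 varpi_x} is the
   dual of V_{varpi_x}. *)
Definition is_zbar (j : 'I_(fund_dim V).+1) (p : P) : Prop :=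
  forall X, ev (incl p) X = fund_rep V (antipode X) ord_max j.

(* S_q[G/L_S]. *)
Definition holomorphic_part : P -> Prop :=
  generated_subalgebra (fun p => exists i, is_z i p).

Record sphere_grading (B : flag_algebra) (gr : int -> P -> Prop) : Prop := {
  sg_grading : Z_grading gr;
  sg_z : forall i p, is_z i p -> gr 1 p;
  sg_zbar : forall j p, is_zbar j p -> gr (-1) p;
  sg_zero : forall p, gr 0 p <-> exists b : B, incl b = incl p
}.

(* The coaction p |-> p (x) t^n for p of degree n. *)
Definition grading_coaction (H : laurent_hopf k) (gr : int -> P -> Prop)
    (rho : P -> P ⊗ H) : Prop :=
  linear rho /\ forall n p, gr n p -> rho p = p ⊗ lt_pow H n.

(* The properties characterizing the (0,1)-Heckenberger-Kolb calculus over P. *)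
Definition HK_calculus (B : flag_algebra) (W : fodc P) : Prop :=
  [/\ left_covariant W,
      forall p, holomorphic_part p -> diff W p = 0 &
      restricts_to_flag_calculus B W].

End QuantumGroup.

(* Main.v *)
From HB Require Import structures.
Require Import Defs.
From mathcomp Require Import all_boot all_order all_algebra.
From mathcomp Require Import reals complex boolp ring.

(* Put d f = E_x |> f. By assumption d f vanishes on the holomorphic generators z_i, and a sum
   of a db over B vanishes in the calculus iff the sum of the a (E_x |> b) vanishes in O_q(G).
   Since sum_i zbar_i z_i = 1 and sum_i z'_i zbar_i = 1 with z'_i in the span of the z_j (the
   square of the antipode fixes the annihilator of the highest weight vector), the grading of
   P is strong. This gives the Hopf-Galois property, extends the above criterion to forms of
   any fixed degree, and shows that ver(N) = P (x) H^+, because dz_i = 0.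

   What remains is right covariance, i.e. that a relation sum_n w_n = 0 between homogeneous
   forms is trivial. By left covariance such relations are stable under the right action of
   U_q(g), which is locally finite, so in a shortest nontrivial one the images a_n of the w_n
   in O_q(G) may be taken to be common weight vectors killed by all F_i. Then z_N q-commutes
   with each a_n, the exponent being d_x times the multiplicity of alpha_x in the difference
   of the right and the left weight of a_n; as the Cartan form is positive definite, it
   determines n. Hence a suitable combination of the left and the right multiple of the
   relation by z_N is a shorter nontrivial relation. No complete reducibility is needed. *)

Set Implicit Arguments.
Unset Strict Implicit.
Unset Printing Implicit Defensive.

Import Order.TTheory GRing.Theory Num.Theory.
Local Open Scope ring_scope.

(** * Tensors and Hopf algebras *)

(** The data of the calculus concern B only, so every statement about forms is moved to degree 0 by
    multiplying with generators, and the form is recovered from sum_i zbar_i z_i = 1 or sum_i z'_i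
    zbar_i = 1. The antipode axiom yields the second relation only up to the square of the antipode,
    which is why the z'_i appear.

    The map p dp' |-> p (E_x |> p') tests vanishing in one degree only: as E_x is skew primitive,
    the image of w p differs from that of w by the factor K_x |> p on the right, up to the term from
    dp. Nothing in the characterization of the calculus says directly that forms of different
    degrees are independent. But the image of a form of degree n has left weight alpha_x + n
    varpi_x, and z_N makes this weight visible in W: on a word e in the E_i, an extremal a satisfies
    (a z_N)(e) = q^(d_x c) a(e) and (z_N a)(e) = a(e), where c counts the E_x in e. Such words
    determine an extremal element because U_q(g) is spanned by the products of an F-word, a torus
    element and an E-word. *)

Section LinearMaps.
Variables (k : fieldType) (M L : lmodType k) (f : M -> L).
Hypothesis lf : linear f.

Lemma linear_for0 : f 0 = 0.
Proof. by have := lf (-1) 0 0; rewrite scaleN1r addNr scaleN1r addNr. Qed.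

Lemma linear_forD : {morph f : u v / u + v}.
Proof. by move=> u v; have := lf 1 u v; rewrite !scale1r. Qed.

Lemma linear_forZ c : {morph f : u / c *: u}.
Proof. by move=> u; have := lf c u 0; rewrite linear_for0 !addr0. Qed.

Lemma linear_forN : {morph f : u / - u}.
Proof. by move=> u; rewrite -scaleN1r linear_forZ scaleN1r. Qed.

Lemma linear_forB : {morph f : u v / u - v}.
Proof. by move=> u v; rewrite linear_forD linear_forN. Qed.

Lemma linear_for_sum (I : Type) (r : seq I) (P : pred I) (F : I -> M) :
  f (\sum_(i <- r | P i) F i) = \sum_(i <- r | P i) f (F i).
Proof. exact: (big_morph f linear_forD linear_for0). Qed.
End LinearMaps.

Section TensorTools.
Variables (k : fieldType) (M N : lmodType k).

Section Fold.
Variables (L : lmodType k) (f : M -> N -> L).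
Hypothesis bf : bilinear_map f.

Lemma bilinear_suml (I : Type) (r : seq I) (P : pred I) (F : I -> M) n :
  f (\sum_(i <- r | P i) F i) n = \sum_(i <- r | P i) f (F i) n.
Proof. exact: (linear_for_sum (bf.1 n)). Qed.

Lemma bilinear_sumr (I : Type) (r : seq I) (P : pred I) (F : I -> N) m :
  f m (\sum_(i <- r | P i) F i) = \sum_(i <- r | P i) f m (F i).
Proof. exact: (linear_for_sum (bf.2 m)). Qed.

Lemma tfold_linear : linear (fun t : M ⊗ N => tfold t f).
Proof. exact: tfold_is_linear. Qed.

Lemma tfold_pure m n : tfold (m ⊗ n) f = f m n.
Proof. exact: tfold_tens. Qed.

Lemma tfold_sum (I : Type) (r : seq I) (P : pred I) (F : I -> M ⊗ N) :
  tfold (\sum_(i <- r | P i) F i) f = \sum_(i <- r | P i) tfold (F i) f.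
Proof. exact: (linear_for_sum tfold_linear). Qed.

Lemma tfold_sum_pure (I : Type) (r : seq I) (F : I -> M) (G : I -> N) :
  tfold (\sum_(i <- r) (F i ⊗ G i)) f = \sum_(i <- r) f (F i) (G i).
Proof. by rewrite tfold_sum; apply: eq_bigr => i _; rewrite tfold_pure. Qed.
End Fold.

Lemma tfoldE (J : M * N -> M * N -> Prop) (L : lmodType k) (t : gtensor J)
    (f : M -> N -> L) :
  tfold t f = \sum_(x <- repr t) f x.1 x.2.
Proof. by []. Qed.

Lemma tensZl c (m : M) (n : N) : (c *: m) ⊗ n = c *: (m ⊗ n).
Proof. exact: (linear_forZ ((tens_bilinear _).1 n)). Qed.
Lemma tens_suml (I : Type) (r : seq I) (P : pred I) (F : I -> M) (n : N) :
  (\sum_(i <- r | P i) F i) ⊗ n = \sum_(i <- r | P i) (F i ⊗ n).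
Proof. exact: (bilinear_suml (tens_bilinear _)). Qed.
Lemma tensor_repr (t : M ⊗ N) : t = \sum_(x <- repr t) (x.1 ⊗ x.2).
Proof. exact: gtensor_sum. Qed.

(** The fold over a fixed tensor is a finite sum over its chosen representative, so linearity in a
    parameter passes through it even when the folded map is not known to be bilinear. *)
Lemma linear_tfold_param (J : M * N -> M * N -> Prop) (L V : lmodType k)
    (t : gtensor J) (f : V -> M -> N -> L) :
  (forall m n, linear (fun v => f v m n)) -> linear (fun v => tfold t (f v)).
Proof.
move=> lf c u v; rewrite !tfoldE scaler_sumr -big_split /=.
by apply: eq_bigr => x _; apply: lf.
Qed.
End TensorTools.

Section HopfTools.
Variables (k : fieldType) (H : hopf k).
Implicit Types a b : H.

Definition trilinear (L : lmodType k) (h : H -> H -> H -> L) : Prop :=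
  [/\ forall b c, linear (fun a => h a b c), forall a c, linear (fun b => h a b c) &
      forall a b, linear (h a b)].

(** Coassociativity is an equation in H ⊗ (H ⊗ H); folding both sides with [T], itself a fold over
    the last two legs, turns it into a rule for arbitrary trilinear maps. *)
Lemma sweedler3 (L : lmodType k) (h : H -> H -> H -> L) a : trilinear h ->
  \tsum_(b, c <- comul a) \tsum_(b1, b2 <- comul b) h b1 b2 c =
  \tsum_(b, c <- comul a) \tsum_(c1, c2 <- comul c) h b c1 c2.
Proof.
case=> h1 h2 h3.
pose T (b : H) (t : H ⊗ H) : L := tfold t (h b).
have bh b : bilinear_map (h b) by split.
have bT : bilinear_map T.
  split=> [t | b]; first by apply: linear_tfold_param => m n; apply: h1.
  exact: tfold_linear.
have /= := congr1 (fun t => tfold t T) (comulA a).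
have E1 : tfold (\tsum_(b, c <- comul a) \tsum_(b1, b2 <- comul b) (b1 ⊗ (b2 ⊗ c))) T
  = \tsum_(b, c <- comul a) \tsum_(b1, b2 <- comul b) h b1 b2 c.
  rewrite [X in tfold X]tfoldE tfold_sum // [RHS]tfoldE; apply: eq_bigr => x _.
  rewrite [X in tfold X]tfoldE tfold_sum // [RHS]tfoldE; apply: eq_bigr => y _.
  by rewrite tfold_pure // /T tfold_pure.
have E2 : tfold (\tsum_(b, c <- comul a) (b ⊗ comul c)) T
  = \tsum_(b, c <- comul a) \tsum_(c1, c2 <- comul c) h b c1 c2.
  rewrite [X in tfold X]tfoldE tfold_sum // [RHS]tfoldE; apply: eq_bigr => x _.
  by rewrite tfold_pure.
by rewrite E1 E2.
Qed.

Lemma comul_sweedlerM (L : lmodType k) (f : H -> H -> L) a b : bilinear_map f ->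
  \tsum_(c1, c2 <- comul (a * b)) f c1 c2 =
  \tsum_(a1, a2 <- comul a) \tsum_(b1, b2 <- comul b) f (a1 * b1) (a2 * b2).
Proof.
move=> bf; rewrite comulM /tensor_mul [X in tfold X]tfoldE tfold_sum //.
rewrite [RHS]tfoldE; apply: eq_bigr => x _.
by rewrite [X in tfold X]tfoldE tfold_sum_pure.
Qed.

Ltac linear_expr := repeat first [rewrite linearP | rewrite mulrDl | rewrite mulrDr
  | rewrite -scalerAl | rewrite -scalerAr ]; by [].
Ltac linear_sum_step := rewrite ?tfoldE scaler_sumr -big_split /=; apply: eq_bigr => ? _.

(** [antipode] is only given as a linear convolution inverse of the identity. The product S(a1 b1)
    a2 b2 S(b3) S(a3) is evaluated in two ways: collapsing the last four factors leaves S(ab),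
    collapsing the first three leaves S(b) S(a). *)
Lemma antipodeM a b : antipode (a * b) = antipode b * antipode a.
Proof.
pose S := @antipode k H.
pose h (x y z : H) := \tsum_(b1, b2 <- comul b) \tsum_(b21, b22 <- comul b2)
  (S (x * b1) * (y * b21 * (S b22 * S z))).
have hl : trilinear h.
  by split=> [y z|x z|x y] c u v; rewrite /h; do 2!linear_sum_step; linear_expr.
have inv1 p r : \sum_(y <- repr (comul p)) \sum_(w <- repr (comul r))
    (y.1 * w.1 * (S w.2 * S y.2)) = (counit p * counit r) *: 1.
  rewrite mulrC -scalerA -(antipode_right p) tfoldE scaler_sumr.
  apply: eq_bigr => y _.
  transitivity (y.1 * (\tsum_(w1, w2 <- comul r) (w1 * S w2)) * S y.2).
    by rewrite tfoldE mulr_sumr mulr_suml; apply: eq_bigr => w _; rewrite !mulrA.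
  by rewrite antipode_right -scalerAr -scalerAl mulr1.
have inv2 p r : \sum_(y <- repr (comul p)) \sum_(w <- repr (comul r))
    (S (y.1 * w.1) * (y.2 * w.2)) = (counit p * counit r) *: 1.
  rewrite -counitM -(antipode_left (p * r)) (comul_sweedlerM (f := fun c d => S c * d)) //.
  by split=> [d|c] e u v; linear_expr.
(* The second evaluation needs the legs of b bracketed the other way; [sb] identifies the two by
   coassociativity in b. *)
pose h' (x y z : H) := \tsum_(b1, b2 <- comul b) \tsum_(b11, b12 <- comul b1)
  (S (x * b11) * (y * b12 * (S b2 * S z))).
have sb x y z : h x y z = h' x y z.
  rewrite /h /h' (sweedler3 (h := fun u v w => S (x * u) * (y * v * (S w * S z)))) //.
  by split=> [v w|u w|u v] c m n; linear_expr.
have El : \tsum_(x, y <- comul a) \tsum_(y1, y2 <- comul y) h x y1 y2 = S (a * b).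
  rewrite tfoldE -[in RHS](counit_right a) tfoldE mulr_suml linear_sum.
  apply: eq_bigr => x _; rewrite /h tfoldE.
  rewrite exchange_big /= -[in RHS](counit_right b) tfoldE mulr_sumr linear_sum.
  apply: eq_bigr => y _; under eq_bigr do rewrite tfoldE -mulr_sumr.
  rewrite -mulr_sumr inv1 -!scalerAr -scalerAl mulr1 scalerA linearZ /=.
  by rewrite mulrC.
have Er : \tsum_(x, y <- comul a) \tsum_(x1, x2 <- comul x) h x1 x2 y = S b * S a.
  rewrite tfoldE -[in RHS](counit_left a) tfoldE linear_sum mulr_sumr.
  apply: eq_bigr => x _; rewrite tfoldE; under eq_bigr do rewrite sb /h' tfoldE.
  rewrite exchange_big /= -[in RHS](counit_left b) tfoldE linear_sum mulr_suml.
  apply: eq_bigr => y _.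
  transitivity (\sum_(i <- repr (comul x.1)) \sum_(w <- repr (comul y.1))
      (S (i.1 * w.1) * (i.2 * w.2)) * (S y.2 * S x.2)).
    by apply: eq_bigr => i _; rewrite tfoldE; apply: eq_bigr => w _; rewrite !mulrA.
  under eq_bigr do rewrite -mulr_suml.
  rewrite -mulr_suml inv2 -scalerAl mul1r !linearZ /= -scalerAl -scalerAr scalerA.
  by rewrite mulrC.
by rewrite -El -(sweedler3 _ hl) Er.
Qed.
End HopfTools.

(** * The quantized enveloping algebra *)

Section Subalgebra.
Variables (k : fieldType) (A : algType k) (W : A -> Prop) (sW : is_subalgebra W).

Definition subalgebra_pred of is_subalgebra W : {pred A} := fun a => `[<W a>].

Fact subalgebra_pred_closed : GRing.subalg_closed (subalgebra_pred sW).
Proof.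
case: sW => -[W0 WD] W1 WM; split=> [|c a b|a b]; rewrite ?unfold_in /=.
- exact/asboolP.
- by move=> /asboolP Wa /asboolP Wb; apply/asboolP/WD.
- by move=> /asboolP Wa /asboolP Wb; apply/asboolP/WM.
Qed.
HB.instance Definition _ :=
  GRing.isSubalgClosed.Build k A (subalgebra_pred sW) subalgebra_pred_closed.

(** Making the predicate an algebra in its own right allows it as a target of the universal property
    of U. *)
Record subalgebra := Subalgebra { subalgebra_val : A; _ : subalgebra_val \in subalgebra_pred sW }.
HB.instance Definition _ := [isSub for subalgebra_val].
HB.instance Definition _ := [Choice of subalgebra by <:].
HB.instance Definition _ := [SubChoice_isSubAlgebra of subalgebra by <:].

Fact subalgebra_val_linear : linear subalgebra_val. Proof. by []. Qed.
Fact subalgebra_val_monoid : monoid_morphism subalgebra_val. Proof. by []. Qed.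
HB.instance Definition _ :=
  GRing.isLinear.Build k subalgebra A *:%R subalgebra_val subalgebra_val_linear.
HB.instance Definition _ :=
  GRing.isMonoidMorphism.Build subalgebra A subalgebra_val subalgebra_val_monoid.
Definition subalgebra_incl : {lrmorphism subalgebra -> A} := subalgebra_val.

Lemma subalgebraP a : W a -> exists b : subalgebra, subalgebra_incl b = a.
Proof.
move=> Wa; have Pa : a \in subalgebra_pred sW by apply/asboolP.
by exists (Subalgebra Pa).
Qed.

Lemma subalgebra_inclP b : W (subalgebra_incl b).
Proof. by case: b => a /= /asboolP. Qed.

Lemma subalgebra_incl_inj : injective subalgebra_incl.
Proof. exact: val_inj. Qed.
End Subalgebra.

Section QuantumGroupTools.
Variables (k : fieldType) (q : k) (l : nat) (g : simple_type l).
Variable U : quantum_group q g.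

Lemma q_serre_reflect (A B : algType k) (f : {lrmorphism A -> B}) (X : 'I_l -> A) :
  injective f -> q_serre q g (fun i => f (X i)) -> q_serre q g X.
Proof.
move=> fI sX i j ij; apply: fI; rewrite rmorph0 -[RHS](sX i j ij) linear_sum.
by apply: eq_bigr => r _; rewrite linearZ /= !rmorphM !rmorphXn.
Qed.

Lemma uq_relations_reflect (A B : algType k) (f : {lrmorphism A -> B})
    (E F K KV : 'I_l -> A) : injective f ->
  uq_relations q g (fun i => f (E i)) (fun i => f (F i)) (fun i => f (K i))
    (fun i => f (KV i)) -> uq_relations q g E F K KV.
Proof.
move=> fI [r1 r2 r3 r4 r5 r6 r7 r8]; split.
- by move=> i; apply: fI; rewrite rmorphM rmorph1; apply: r1.
- by move=> i; apply: fI; rewrite rmorphM rmorph1; apply: r2.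
- by move=> i j; apply: fI; rewrite !rmorphM; apply: r3.
- by move=> i j; apply: fI; rewrite linearZ /= !rmorphM; apply: r4.
- by move=> i j; apply: fI; rewrite linearZ /= !rmorphM; apply: r5.
- move=> i j; apply: fI; rewrite !linearZ /= !linearB /= !rmorphM. by rewrite r6 !scalerBr.
- exact: q_serre_reflect fI r7.
- exact: q_serre_reflect fI r8.
Qed.

(** U is given by a universal property, not as a span of words. The universal map into the
    subalgebra W, followed by the inclusion, fixes the generators and is therefore the identity. *)
Lemma uq_generated (W : U -> Prop) : is_subalgebra W ->
  (forall i, [/\ W (uE U i), W (uF U i), W (uK U i) & W (uKV U i)]) ->
  forall X, W X.
Proof.
move=> sW WG.
have /choice [E hE] : forall i, exists b : subalgebra sW, subalgebra_incl sW b = uE U i.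
  by move=> i; case: (WG i) => h _ _ _; apply: subalgebraP.
have /choice [F hF] : forall i, exists b : subalgebra sW, subalgebra_incl sW b = uF U i.
  by move=> i; case: (WG i) => _ h _ _; apply: subalgebraP.
have /choice [K hK] : forall i, exists b : subalgebra sW, subalgebra_incl sW b = uK U i.
  by move=> i; case: (WG i) => _ _ h _; apply: subalgebraP.
have /choice [KV hKV] : forall i, exists b : subalgebra sW, subalgebra_incl sW b = uKV U i.
  by move=> i; case: (WG i) => _ _ _ h; apply: subalgebraP.
have R : uq_relations q g E F K KV.
  apply: (uq_relations_reflect (@subalgebra_incl_inj _ _ _ sW)).
  have -> : (fun i => subalgebra_incl sW (E i)) = uE U by apply/funext.
  have -> : (fun i => subalgebra_incl sW (F i)) = uF U by apply/funext.
  have -> : (fun i => subalgebra_incl sW (K i)) = uK U by apply/funext.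
  have -> : (fun i => subalgebra_incl sW (KV i)) = uKV U by apply/funext.
  exact: uq_rel.
have [f hf] := @uq_lift _ _ _ _ U _ _ _ _ _ R.
move=> X.
have -> : X = subalgebra_incl sW (f X).
  apply: (uq_uniq (f := idfun) (f' := subalgebra_incl sW \o f)) => i /=.
  by case: (hf i) => -> -> -> ->; split; symmetry; [exact: hE|exact: hF|exact: hK|exact: hKV].
exact: subalgebra_inclP.
Qed.
End QuantumGroupTools.

Section CartanMatrix.
Variables (l : nat) (g : simple_type l).

Lemma cartan_form_eq0 (v : 'I_l -> rat) :
  \sum_i \sum_j (half_len g i)%:R * (cartan g i j)%:~R * v i * v j <= 0 ->
  forall i, v i = 0.
Proof.
move=> le0 i; apply/eqP/negPn/negP => vi0.
by have := @cartan_posdef _ g v (ex_intro _ i vi0); rewrite ltNge le0.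
Qed.

(** Inverting the symmetrized Cartan matrix, which is nonsingular by positive definiteness, gives
    rational w_j with sum_j w_j (alpha_j, alpha_i) = 1 for all i; N clears the denominators. *)
Lemma cartan_height : exists (m : 'I_l -> int) (N : nat), (0 < N)%N /\
  forall i, \sum_j m j * ((half_len g j)%:Z * cartan g j i) = N%:Z.
Proof.
pose A : 'M[rat]_l := \matrix_(i, j) ((half_len g i)%:R * (cartan g i j)%:~R).
have uA : A \in unitmx.
  rewrite -row_free_unit -kermx_eq0; apply/eqP/row_matrixP => i; rewrite row0.
  set v := row i _.
  have vA : v *m A = 0 by rewrite /v -row_mul mulmx_ker row0.
  apply/rowP => j; rewrite [RHS]mxE.
  apply: (cartan_form_eq0 (v := fun j => v 0 j)).
  rewrite exchange_big /= big1 // => j' _.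
  have /rowP/(_ j') := vA; rewrite !mxE => e.
  transitivity ((\sum_i0 v 0 i0 * A i0 j') * v 0 j'); last by rewrite e mul0r.
  by rewrite mulr_suml; apply: eq_bigr => i' _; rewrite !mxE; ring.
pose w : 'rV[rat]_l := const_mx 1 *m invmx A.
have wA i : \sum_j w 0 j * A j i = 1.
  have /rowP/(_ i) : w *m A = const_mx 1 by rewrite mulmxKV.
  by rewrite !mxE.
pose N : int := \prod_j denq (w 0 j).
have N0 : 0 < N by apply: prodr_gt0 => j _; rewrite denq_gt0.
have /choice [m hm] : forall j, exists m : int, m%:~R = N%:~R * w 0 j.
  move=> j; exists (numq (w 0 j) * \prod_(i | i != j) denq (w 0 i)).
  have -> : N = denq (w 0 j) * \prod_(i | i != j) denq (w 0 i) by rewrite /N (bigD1 j).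
  by rewrite !intrM numqE; ring.
exists m, `|N|%N; split; first by rewrite absz_gt0 gt_eqF.
move=> i; apply: (@intr_inj rat).
rewrite gtz0_abs //; transitivity (N%:~R * \sum_j w 0 j * A j i); last by rewrite wA mulr1.
rewrite rmorph_sum mulr_sumr /=.
by apply: eq_bigr => j _; rewrite !intrM hm [A _ _]mxE -pmulrn; ring.
Qed.
End CartanMatrix.

(** * Triangular decomposition and the height element *)

Section QuantumGroupElements.
Variables (k : fieldType) (q : k) (l : nat) (g : simple_type l).
Hypothesis q0 : q != 0.
Variable U : quantum_group q g.
Implicit Types (X Y : U) (i j : 'I_l).
Local Notation E := (uE U).
Local Notation F := (uF U).
Local Notation K := (uK U).
Local Notation KV := (uKV U).
Local Notation qa i j := (q_ q g i ^ cartan g i j).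

Lemma KKV i : K i * KV i = 1. Proof. exact: rel_KKV (uq_rel U) i. Qed.
Lemma KVK i : KV i * K i = 1. Proof. exact: rel_KVK (uq_rel U) i. Qed.
Lemma KE i j : K i * E j = qa i j *: (E j * K i).
Proof. exact: rel_KE (uq_rel U) i j. Qed.
Lemma KF i j : K i * F j = (qa i j)^-1 *: (F j * K i).
Proof. by rewrite invr_expz; apply: rel_KF (uq_rel U) i j. Qed.
Lemma EF i j : E i * F j = F j * E i +
    (i == j)%:R *: ((q_ q g i - (q_ q g i)^-1)^-1 *: (K i - KV i)).
Proof. by rewrite -(rel_EF (uq_rel U) i j) addrC subrK. Qed.

Lemma qa_neq0 i j : qa i j != 0.
Proof. by rewrite expfz_neq0 // expf_neq0. Qed.

Lemma inv_scale_comm (A : algType k) (x x' y : A) (c : k) : c != 0 ->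
  x * x' = 1 -> x' * x = 1 -> x * y = c *: (y * x) -> x' * y = c^-1 *: (y * x').
Proof.
move=> c0 xx' x'x xy.
have := congr1 (fun z => c^-1 *: (x' * z * x')) xy.
rewrite /= -scalerAr -scalerAl scalerA mulVf // scale1r.
by rewrite !mulrA x'x mul1r -(mulrA (x' * y)) xx' mulr1 => <-.
Qed.

Lemma KVE i j : KV i * E j = (qa i j)^-1 *: (E j * KV i).
Proof. exact: inv_scale_comm (qa_neq0 i j) (KKV i) (KVK i) (KE i j). Qed.
Lemma KVF i j : KV i * F j = qa i j *: (F j * KV i).
Proof.
by rewrite -[qa i j]invrK; apply: inv_scale_comm (KKV i) (KVK i) (KF i j);
  rewrite invr_eq0 qa_neq0.
Qed.

Definition torus_generator (X : U) : Prop := exists i, X = K i \/ X = KV i.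

Definition torus : U -> Prop := generated_subalgebra torus_generator.

Lemma generated_subalgebra_is_subalgebra (A : algType k) (G : A -> Prop) :
  is_subalgebra (generated_subalgebra G).
Proof.
split; first split.
- by move=> W [[]].
- by move=> c v w hv hw W sW GW; case: (sW) => -[_ h] _ _; apply: h; [apply: hv|apply: hw].
- by move=> W [].
- by move=> a b ha hb W sW GW; case: (sW) => _ _ h; apply: h; [apply: ha|apply: hb].
Qed.

Lemma generated_subalgebra_gen (A : algType k) (G : A -> Prop) a :
  G a -> generated_subalgebra G a.
Proof. by move=> Ga W _; apply. Qed.

Lemma torusK i : torus (K i).
Proof. by apply: generated_subalgebra_gen; exists i; left. Qed.
Lemma torusKV i : torus (KV i).
Proof. by apply: generated_subalgebra_gen; exists i; right. Qed.
Lemma torus1 : torus 1.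
Proof. by case: (generated_subalgebra_is_subalgebra torus_generator). Qed.
Lemma torusM X Y : torus X -> torus Y -> torus (X * Y).
Proof.
by case: (generated_subalgebra_is_subalgebra torus_generator) => _ _; apply.
Qed.
Lemma torusP c X Y : torus X -> torus Y -> torus (c *: X + Y).
Proof.
by case: (generated_subalgebra_is_subalgebra torus_generator) => -[_ h] _ _; apply: h.
Qed.

Lemma torus_comm X Y : torus X -> torus Y -> X * Y = Y * X.
Proof.
have KK i Z : torus Z -> K i * Z = Z * K i.
  move=> tZ; apply: (tZ (fun Z => K i * Z = Z * K i)).
    split; first split.
    - by rewrite mul0r mulr0.
    - by move=> c v w hv hw; rewrite mulrDl mulrDr -scalerAl -scalerAr hv hw.
    - by rewrite mul1r mulr1.
    - by move=> a b ha hb; rewrite mulrA ha -mulrA hb mulrA.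
  move=> _ [j [->|->]]; first exact: rel_KK (uq_rel U) i j.
  have := @inv_scale_comm _ (K j) (KV j) (K i) 1 (oner_neq0 _) (KKV j) (KVK j).
  by rewrite invr1 !scale1r => <- //; rewrite (rel_KK (uq_rel U)).
move=> tX tY; apply: (tX (fun X => X * Y = Y * X)).
  split; first split.
  - by rewrite mul0r mulr0.
  - by move=> c v w hv hw; rewrite mulrDl mulrDr -scalerAl -scalerAr hv hw.
  - by rewrite mul1r mulr1.
  - by move=> a b ha hb; rewrite mulrA -ha -mulrA hb mulrA.
move=> _ [j [->|->]]; first exact: KK.
have := @inv_scale_comm _ (K j) (KV j) Y 1 (oner_neq0 _) (KKV j) (KVK j).
by rewrite invr1 !scale1r => <- //; rewrite KK.
Qed.

Lemma torus_E X i : torus X -> exists2 X', torus X' & E i * X = X' * E i.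
Proof.
move=> tX; apply: (tX (fun X => exists2 X', torus X' & E i * X = X' * E i)).
  split; first split.
  - by exists 0; [move=> W [[]] | rewrite mulr0 mul0r].
  - move=> c v w [v' tv hv] [w' tw hw]; exists (c *: v' + w'); first exact: torusP.
    by rewrite mulrDl mulrDr -scalerAl -scalerAr hv hw.
  - by exists 1; [exact: torus1 | rewrite mul1r mulr1].
  - move=> a b [a' ta ha] [b' tb hb]; exists (a' * b'); first exact: torusM.
    by rewrite mulrA ha -mulrA hb mulrA.
have t0 c Y : torus Y -> torus (c *: Y).
  by move=> tY; rewrite -[_ *: _]addr0; apply: torusP => // W [[]].
move=> _ [j [->|->]].
  exists ((qa j i)^-1 *: K j); first by apply: t0; apply: torusK.
  by rewrite -scalerAl KE scalerA mulVf ?scale1r // qa_neq0.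
exists (qa j i *: KV j); first by apply: t0; apply: torusKV.
by rewrite -scalerAl KVE scalerA mulfV ?scale1r // qa_neq0.
Qed.

Lemma torus_F X i : torus X -> exists2 X', torus X' & X * F i = F i * X'.
Proof.
have t0 c Y : torus Y -> torus (c *: Y).
  by move=> tY; rewrite -[_ *: _]addr0; apply: torusP => // W [[]].
move=> tX; apply: (tX (fun X => exists2 X', torus X' & X * F i = F i * X')).
  split; first split.
  - by exists 0; [move=> W [[]] | rewrite mulr0 mul0r].
  - move=> c v w [v' tv hv] [w' tw hw]; exists (c *: v' + w'); first exact: torusP.
    by rewrite mulrDl mulrDr -scalerAl -scalerAr hv hw.
  - by exists 1; [exact: torus1 | rewrite mul1r mulr1].
  - move=> a b [a' ta ha] [b' tb hb]; exists (a' * b'); first exact: torusM.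
    by rewrite mulrA -ha -!mulrA hb.
move=> _ [j [->|->]].
  by exists ((qa j i)^-1 *: K j); [by apply: t0; apply: torusK | rewrite -scalerAr KF].
by exists (qa j i *: KV j); [by apply: t0; apply: torusKV | rewrite -scalerAr KVF].
Qed.

Definition Ew (w : seq 'I_l) : U := \prod_(i <- w) E i.
Definition Fw (w : seq 'I_l) : U := \prod_(i <- w) F i.

Lemma torus_Fw X w : torus X -> exists2 X', torus X' & X * Fw w = Fw w * X'.
Proof.
rewrite /Fw; elim: w X => [|i w IH] X tX; first by exists X; rewrite ?big_nil ?mulr1 ?mul1r.
have [X' tX' XX'] := torus_F i tX; have [X'' tX'' XX''] := IH _ tX'.
by exists X'' => //; rewrite big_cons mulrA XX' -mulrA XX'' mulrA.
Qed.

(** The spanning half of the triangular decomposition. The span T of the products of an F-word, a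
    torus element and an E-word is stable under left multiplication by every generator, hence by U,
    and it contains 1. *)
Lemma triangular_ind (W : U -> Prop) : is_subspace W ->
  (forall f X e, torus X -> W (Fw f * X * Ew e)) -> forall X, W X.
Proof.
pose T X := forall W : U -> Prop, is_subspace W ->
  (forall f X e, torus X -> W (Fw f * X * Ew e)) -> W X.
have sT : is_subspace T.
  by split=> [W' [] //|c v w hv hw W' sW' hW']; apply: sW'.2; [apply: hv|apply: hw].
have T3 f X e : torus X -> T (Fw f * X * Ew e) by move=> tX W' _; apply.
suff TU : forall X, T X by move=> sW hW X; apply: TU.
pose L X := forall Y, T Y -> T (X * Y).
have LW X : (forall f Z e, torus Z -> T (X * (Fw f * Z * Ew e))) -> L X.
  move=> h Y TY; apply: (TY (fun Y => T (X * Y))) => //.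
  split=> [|c v w hv hw]; first by rewrite mulr0; apply: sT.1.
  by rewrite mulrDr -scalerAr; apply: sT.2.
have LF i : L (F i).
  apply: LW => f Z e tZ; rewrite !mulrA.
  have -> : F i * Fw f = Fw (i :: f) by rewrite /Fw big_cons.
  exact: T3.
have LX Z' : torus Z' -> L Z'.
  move=> tZ'; apply: LW => f Z e tZ; have [Z'' tZ'' e''] := torus_Fw f tZ'.
  by rewrite !mulrA e'' -(mulrA (Fw f)); apply: T3; apply: torusM.
(* Commuting E_i past the leading F_j leaves a multiple of K_i - KV_i in front of a shorter product,
   which stays in T by [LX]. *)
have LE i : L (E i).
  apply: LW => f; elim: f => [|j f IH] Z e tZ.
    rewrite /Fw big_nil mul1r mulrA; have [Z' tZ' ->] := torus_E i tZ.
    have -> : Z' * E i * Ew e = Fw [::] * Z' * Ew (i :: e).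
      by rewrite /Fw /Ew big_nil big_cons mul1r mulrA.
    exact: T3.
  have -> : Fw (j :: f) = F j * Fw f by rewrite /Fw big_cons.
  rewrite !mulrA EF !mulrDl -!mulrA addrC -!scalerAl.
  apply: sT.2; last by apply: LF; have := IH _ e tZ; rewrite !mulrA.
  rewrite -[_ *: _]addr0; apply: sT.2; last exact: sT.1.
  have -> : (K i - KV i) * (Fw f * (Z * Ew e)) =
    (-1) *: (KV i * (Fw f * (Z * Ew e))) + K i * (Fw f * (Z * Ew e)).
    by rewrite mulrBl scaleN1r addrC.
  by apply: sT.2; apply: LX; rewrite ?mulrA; [exact: torusKV|apply: T3|exact: torusK|apply: T3].
move=> X; have : L X.
  apply: (uq_generated (W := L)).
    split; first split.
    - by move=> Y _; rewrite mul0r; apply: sT.1.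
    - by move=> c v w hv hw Y TY; rewrite mulrDl -scalerAl; apply: sT.2; [apply: hv|apply: hw].
    - by move=> Y; rewrite mul1r.
    - by move=> a b ha hb Y TY; rewrite -mulrA; apply: ha; apply: hb.
  by move=> i; split; [apply: LE|apply: LF|apply: LX; apply: torusK|apply: LX; apply: torusKV].
move=> /(_ 1); rewrite mulr1; apply.
have := @T3 [::] 1 [::] torus1; by rewrite /Fw /Ew !big_nil !mulr1.
Qed.

(** F-words on the left kill c and torus elements act by scalars, so only E-words survive in the
    triangular decomposition. Extremal matrix coefficients are compared in this way. *)
Lemma lowest_functional_eq0 (c : U -> k^o) (kap : 'I_l -> k) : linear c ->
  (forall i X, c (F i * X) = 0) -> (forall i X, c (K i * X) = kap i * c X) ->
  (forall e, c (Ew e) = 0) -> forall X, c X = 0.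
Proof.
move=> lc cF cK cE; apply: triangular_ind.
  split=> [|a v w cv cw]; first exact: linear_for0.
  by rewrite lc cv cw scaler0 addr0.
move=> [|i f] X e tX; last by rewrite /Fw big_cons -!mulrA cF.
rewrite /Fw big_nil mul1r.
suff [t ->] : exists t, forall Y, c (X * Y) = t * c Y by rewrite cE mulr0.
apply: (tX (fun X => exists t, forall Y, c (X * Y) = t * c Y)).
  split; first split.
  - by exists 0 => Y; rewrite !mul0r; apply: linear_for0.
  - move=> a v w [t ht] [s hs]; exists (a * t + s) => Y.
    by rewrite mulrDl -scalerAl lc ht hs mulrDl -mulrA.
  - by exists 1 => Y; rewrite !mul1r.
  - by move=> a b [t ht] [s hs]; exists (t * s) => Y; rewrite -!mulrA ht hs.
move=> _ [i [->|->]]; first by exists (kap i).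
exists (kap i)^-1 => Y; have := cK i (KV i * Y); rewrite mulrA KKV mul1r => e1.
(* Since K_i is invertible, c vanishes identically when [kap i] is 0, in agreement with the
   convention that the inverse of 0 is 0. *)
have [k0|k0] := eqVneq (kap i) 0; last by rewrite e1 mulKf.
by have := cK i (KV i * (KV i * Y)); rewrite mulrA KKV mul1r k0 invr0 !mul0r.
Qed.

Lemma highest_functional_eq0 (c : U -> k^o) (kap : 'I_l -> k) : linear c ->
  (forall i X, c (X * E i) = 0) -> (forall i X, c (X * K i) = kap i * c X) ->
  (forall f, c (Fw f) = 0) -> forall X, c X = 0.
Proof.
move=> lc cE cK cF; apply: triangular_ind.
  split=> [|a v w cv cw]; first exact: linear_for0.
  by rewrite lc cv cw scaler0 addr0.
move=> f X e tX; case: (lastP e) => [|{}e i]; last first.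
  by rewrite /Ew -cats1 big_cat big_seq1 !mulrA cE.
rewrite /Ew big_nil mulr1.
suff [t ->] : exists t, forall Y, c (Y * X) = t * c Y by rewrite cF mulr0.
apply: (tX (fun X => exists t, forall Y, c (Y * X) = t * c Y)).
  split; first split.
  - by exists 0 => Y; rewrite mulr0 mul0r; apply: linear_for0.
  - move=> a v w [t ht] [s hs]; exists (a * t + s) => Y.
    by rewrite mulrDr -scalerAr lc ht hs mulrDl -mulrA.
  - by exists 1 => Y; rewrite mulr1 mul1r.
  - by move=> a b [t ht] [s hs]; exists (s * t) => Y; rewrite !mulrA hs ht mulrA.
move=> _ [i [->|->]]; first by exists (kap i).
exists (kap i)^-1 => Y; have := cK i (Y * KV i); rewrite -mulrA KVK mulr1 => e1.
have [k0|k0] := eqVneq (kap i) 0; last by rewrite e1 mulKf.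
by have := cK i (Y * KV i * KV i); rewrite -mulrA KVK mulr1 k0 invr0 !mul0r.
Qed.

(** T is the product of the K_j^(m_j) with m from [cartan_height]. A single torus element thus
    measures the length of F-words, which separates the highest weight from the lower ones. *)
Lemma torus_height : exists (T T' : U) (N : nat), (0 < N)%N /\
  [/\ torus T, T * T' = 1, T' * T = 1 &
      forall i, T * F i = q ^- N *: (F i * T)].
Proof.
have [m [N [N0 hm]]] := cartan_height g.
pose good (c : 'I_l -> k) := exists T T' : U,
  [/\ torus T, torus T', T * T' = 1, T' * T = 1 & forall i, T * F i = c i *: (F i * T)].
suff [T [T' [tT _ TT' T'T TF]]] : good (fun i => q ^- N).
  by exists T, T', N.
have g1 : good (fun=> 1).
  by exists 1, 1; split; rewrite ?mulr1 //;
    [exact: torus1|exact: torus1|move=> i; rewrite scale1r mul1r mulr1].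
have gM c c' : good c -> good c' -> good (fun i => c i * c' i).
  move=> [T [T' [tT tT' TT' T'T TF]]] [S [S' [tS tS' SS' S'S SF]]].
  exists (T * S), (S' * T'); split; [exact: torusM|exact: torusM| | |].
  - by rewrite mulrA -(mulrA T) SS' mulr1.
  - by rewrite mulrA -(mulrA S') T'T mulr1.
  - by move=> i; rewrite -mulrA SF -scalerAr (mulrA T) TF -scalerAl scalerA -(mulrA (F i))
      (mulrC (c i)).
have gX c n : good c -> good (fun i => c i ^+ n).
  move=> gc; elim: n => [|n IH].
    by rewrite (_ : (fun i => _) = fun=> 1) //; apply/funext => i; rewrite expr0.
  rewrite (_ : (fun i => _) = fun i => c i * c i ^+ n); first exact: gM.
  by apply/funext => i; rewrite exprS.
have gj j (n : int) : good (fun i => (q ^ ((half_len g j)%:Z * cartan g j i)) ^ n).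
  have qE i : q ^ ((half_len g j)%:Z * cartan g j i) = qa j i.
    by rewrite -exprz_exp.
  case: n => n; under eq_fun do rewrite qE.
    apply: gX; exists (KV j), (K j).
    by split; [exact: torusKV|exact: torusK|exact: KVK|exact: KKV|move=> i; exact: KVF].
  under eq_fun do rewrite NegzE -exprz_inv.
  apply: gX; exists (K j), (KV j).
  by split; [exact: torusK|exact: torusKV|exact: KKV|exact: KVK|move=> i; exact: KF].
have gp (s : seq 'I_l) :
    good (fun i => \prod_(j <- s) (q ^ ((half_len g j)%:Z * cartan g j i)) ^ (- m j)).
  elim: s => [|j s IH].
    by rewrite (_ : (fun i => _) = fun=> 1) //; apply/funext => i; rewrite big_nil.
  rewrite (_ : (fun i => _) = fun i => (q ^ ((half_len g j)%:Z * cartan g j i)) ^ (- m j) *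
    \prod_(j <- s) (q ^ ((half_len g j)%:Z * cartan g j i)) ^ (- m j)).
    by apply: gM; [exact: gj | exact: IH].
  by apply/funext => i; rewrite big_cons.
suff -> : (fun i : 'I_l => q ^- N) =
  fun i => \prod_j (q ^ ((half_len g j)%:Z * cartan g j i)) ^ (- m j) by exact: gp.
apply/funext => i.
have q_sum (s : seq 'I_l) : \prod_(j <- s) (q ^ ((half_len g j)%:Z * cartan g j i)) ^ (- m j) =
    q ^ (- \sum_(j <- s) m j * ((half_len g j)%:Z * cartan g j i)).
  elim: s => [|j s IH]; first by rewrite !big_nil oppr0 expr0z.
  by rewrite !big_cons IH opprD expfzDr // exprz_exp mulrN (mulrC (m j)).
by rewrite q_sum hm exprnN.
Qed.
End QuantumGroupElements.

(** * The fundamental representation *)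

(** A subspace of maximal dimension inside W contains every vector of W. Irreducibility is stated
    for [vspace], while annihilators arise as predicates. *)
Lemma subspace_vspace (k : fieldType) (V : vectType k) (W : V -> Prop) :
  is_subspace W -> exists S : {vspace V}, forall v, v \in S <-> W v.
Proof.
move=> sW.
pose P n := `[< exists2 S : {vspace V}, (forall v, v \in S -> W v) & \dim S = n >].
have P0 : exists n, P n.
  exists 0%N; apply/asboolP; exists 0%VS; last exact: dimv0.
  by move=> v; rewrite memv0 => /eqP ->; apply: sW.1.
have Pb n : P n -> (n <= \dim (fullv : {vspace V}))%N.
  by move=> /asboolP [S _ <-]; apply: dimvS; apply: subvf.
case: (ex_maxnP P0 Pb) => n /asboolP [S SW dS] maxS.
exists S => v; split; first exact: SW.
move=> Wv; have : P (\dim (S + <[v]>)%VS).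
  apply/asboolP; exists (S + <[v]>)%VS => // w /memv_addP [s Ss [_ /vlineP [c ->] ->]].
  by rewrite addrC; apply: sW.2 => //; apply: SW.
move/maxS; rewrite -dS => le.
have /eqP -> : S == (S + <[v]>)%VS by rewrite eqEdim addvSl.
by apply: (subvP (addvSr S _)); apply: memv_line.
Qed.

Section AntipodeGenerators.
Variables (k : fieldType) (q : k) (l : nat) (g : simple_type l).
Variable U : quantum_group q g.
Local Notation S := (@antipode k U).

Lemma antipode1 (H : hopf k) : antipode (1 : H) = 1.
Proof.
have := antipode_left (1 : H); rewrite comul1 tfold_pure.
  by rewrite mulr1 counit1 scale1r.
by split=> [n|m] c a b; rewrite ?linearP ?mulrDl ?mulrDr -?scalerAl -?scalerAr.
Qed.

Lemma bilinear_antipodel (H : hopf k) :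
  bilinear_map (fun a b : H => antipode a * b).
Proof.
by split=> [n|m] c a b; rewrite ?linearP ?mulrDl ?mulrDr -?scalerAl -?scalerAr.
Qed.

Lemma antipodeK i : S (uK U i) = uKV U i.
Proof.
have := antipode_left (uK U i); rewrite comul_K (tfold_pure (bilinear_antipodel _)).
rewrite counit_K scale1r => e.
by rewrite -[LHS]mulr1 -(KKV U i) mulrA e mul1r.
Qed.

Lemma antipodeKV i : S (uKV U i) = uK U i.
Proof.
have := antipodeM (uK U i) (uKV U i); rewrite KKV antipode1 antipodeK => e.
by rewrite -[LHS]mulr1 -(KVK U i) mulrA -e mul1r.
Qed.

Lemma antipodeE i : S (uE U i) = - (uE U i * uKV U i).
Proof.
have := antipode_left (uE U i); rewrite comul_E (linear_forD (tfold_linear (bilinear_antipodel _))).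
rewrite !(tfold_pure (bilinear_antipodel _)) antipode1 mul1r counit_E scale0r.
move/eqP; rewrite addr_eq0 => /eqP e.
by rewrite -[LHS]mulr1 -(KKV U i) mulrA e mulNr.
Qed.

Lemma antipodeF i : S (uF U i) = - (uK U i * uF U i).
Proof.
have := antipode_left (uF U i); rewrite comul_F (linear_forD (tfold_linear (bilinear_antipodel _))).
rewrite !(tfold_pure (bilinear_antipodel _)) mulr1 antipodeKV counit_F scale0r.
by move/eqP; rewrite addr_eq0 => /eqP.
Qed.

Lemma counit_KV i : counit (uKV U i) = 1.
Proof.
by have := counitM (uK U i) (uKV U i); rewrite KKV counit1 counit_K mul1r.
Qed.

(** On the generators of index i the square of the antipode is conjugation by K_i. *)
Lemma antipode2_gen i :
  [/\ S (S (uE U i)) = uK U i * uE U i * uKV U i, S (S (uF U i)) = uK U i * uF U i * uKV U i,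
      S (S (uK U i)) = uK U i & S (S (uKV U i)) = uKV U i].
Proof.
split; rewrite ?antipodeK ?antipodeKV ?antipodeK //.
  by rewrite antipodeE linearN /= antipodeM antipodeKV antipodeE mulrN opprK mulrA.
by rewrite antipodeF linearN /= antipodeM antipodeK antipodeF mulNr opprK.
Qed.

Lemma antipode2_surjective X : exists Y, S (S Y) = X.
Proof.
apply: (uq_generated (W := fun X => exists Y, S (S Y) = X)).
  split; first split.
  - by exists 0; rewrite !linear0.
  - by move=> c v w [v' <-] [w' <-]; exists (c *: v' + w'); rewrite !linearP.
  - by exists 1; rewrite !antipode1.
  - by move=> a b [a' <-] [b' <-]; exists (a' * b'); rewrite !antipodeM.
move=> i; case: (antipode2_gen i) => hE hF hK hKV; split.
- exists (uKV U i * uE U i * uK U i); rewrite !antipodeM hE hK hKV.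
  by rewrite !mulrA KVK mul1r -mulrA KVK mulr1.
- exists (uKV U i * uF U i * uK U i); rewrite !antipodeM hF hK hKV.
  by rewrite !mulrA KVK mul1r -mulrA KVK mulr1.
- by exists (uK U i).
- by exists (uKV U i).
Qed.
End AntipodeGenerators.

Section FundamentalRepresentation.
Variables (k : fieldType) (q : k) (l : nat) (g : simple_type l) (x : 'I_l).
Hypotheses (q0 : q != 0) (qn1 : forall n, q ^+ n.+1 != 1).
Variables (U : quantum_group q g) (V : fundamental_basis U x).
Local Notation n := (fund_dim V).
Local Notation u := (fund_rep V).
Local Notation E := (uE U).
Local Notation F := (uF U).
Local Notation K := (uK U).
Local Notation KV := (uKV U).
Local Notation S := (@antipode k U).
Local Notation v := (delta_mx ord_max 0 : 'cV[k]_n.+1).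
Local Notation fN := (delta_mx 0 ord_max : 'rV[k]_n.+1).

(** The scalar q^((alpha_i, varpi_x)), equal to q^(d_x) at x and to 1 elsewhere. *)
Definition fund_wt i : k := q ^+ (half_len g i * (i == x)).

Lemma fund_wt_neq0 i : fund_wt i != 0. Proof. by rewrite expf_neq0. Qed.
Lemma fund_wt1 i : i != x -> fund_wt i = 1.
Proof. by move=> /negPf ix; rewrite /fund_wt ix muln0 expr0. Qed.

Lemma fundM X Y : u (X * Y) = u X *m u Y. Proof. exact: rmorphM. Qed.
Lemma fund1 : u 1 = 1%:M. Proof. exact: rmorph1. Qed.
Lemma fund_cyclic w : exists X, w = u X *m v.
Proof. by have [_ h _ _] := fund_is_V V; apply: h. Qed.
Lemma fundEv i : u (E i) *m v = 0. Proof. by have [_ _ h _] := fund_is_V V; apply: h. Qed.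
Lemma fundKv i : u (K i) *m v = fund_wt i *: v.
Proof. by have [_ _ _ h] := fund_is_V V; apply: h. Qed.
Lemma fundKVv i : u (KV i) *m v = (fund_wt i)^-1 *: v.
Proof.
rewrite -[v in LHS](scalerK (fund_wt_neq0 i)) -fundKv -scalemxAr mulmxA -fundM KVK fund1 mul1mx.
by [].
Qed.

Lemma fund_coef X i : (u X *m v) i 0 = u X i ord_max.
Proof. by rewrite -colE mxE. Qed.
Lemma fund_coefN X : (fN *m u X *m v) 0 0 = u X ord_max ord_max.
Proof. by rewrite -mulmxA -rowE mxE fund_coef. Qed.

Lemma fundKf i : fN *m u (K i) = fund_wt i *: fN.
Proof.
have /is_diag_mxP dK := fund_weight V i.
apply/rowP => j; rewrite -rowE !mxE eqxx /=.
have [->|jN] := eqVneq j ord_max; last by rewrite mulr0 dK // eq_sym.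
by rewrite mulr1 -fund_coef fundKv !mxE !eqxx mulr1.
Qed.
Lemma fundKVf i : fN *m u (KV i) = (fund_wt i)^-1 *: fN.
Proof.
rewrite -[fN in LHS](scalerK (fund_wt_neq0 i)) -fundKf -scalemxAl -mulmxA -fundM KKV fund1 mulmx1.
by [].
Qed.

Lemma fund_torus X : torus X -> exists t, u X *m v = t *: v /\ fN *m u X = t *: fN.
Proof.
move=> tX; apply: (tX (fun X => exists t, u X *m v = t *: v /\ fN *m u X = t *: fN)).
  split; first split.
  - by exists 0; rewrite !scale0r linear0 mul0mx mulmx0.
  - move=> c a b [t [h1 h2]] [s [h3 h4]]; exists (c * t + s).
    by rewrite linearP mulmxDl mulmxDr -scalemxAl -scalemxAr h1 h2 h3 h4 !scalerDl !scalerA.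
  - by exists 1; rewrite fund1 mul1mx mulmx1 !scale1r.
  - move=> a b [t [h1 h2]] [s [h3 h4]]; exists (t * s); split.
      by rewrite fundM -mulmxA h3 -scalemxAr h1 scalerA mulrC.
    by rewrite fundM mulmxA h2 -scalemxAl h4 scalerA.
move=> _ [i [->|->]]; first by exists (fund_wt i); rewrite fundKv fundKf.
by exists (fund_wt i)^-1; rewrite fundKVv fundKVf.
Qed.

(** With T from [torus_height] and t its eigenvalue on v, the vector F_w v has eigenvalue q^(- N
    |w|) t, whereas [fN] sees only the eigenvalue t. As q is not a root of unity, these differ for
    nonempty words. *)
Lemma fund_Fw i f : fN *m u (Fw U (i :: f)) *m v = 0.
Proof.
have [T [T' [N [N0 [tT TT' T'T TF]]]]] := torus_height q0 U.
have [t [tv tf]] := fund_torus tT.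
have TFw w : T * Fw U w = q ^- (N * size w) *: (Fw U w * T).
  rewrite /Fw; elim: w => [|j w IH].
    by rewrite big_nil muln0 expr0 invr1 scale1r mul1r mulr1.
  rewrite big_cons (mulrA T) TF -scalerAl -(mulrA (F j) T) IH -scalerAr scalerA mulnS exprD invfM.
  by rewrite mulrA.
have t0 : t != 0.
  apply/eqP => t0; have : u (T' * T) *m v = 0 by rewrite fundM -mulmxA tv t0 scale0r mulmx0.
  rewrite T'T fund1 mul1mx => /colP/(_ ord_max); rewrite !mxE !eqxx => /eqP.
  by rewrite oner_eq0.
set w := i :: f; set y := fN *m u (Fw U w) *m v.
have e1 : t *: y = (q ^- (N * size w) * t) *: y.
  rewrite {1}/y scalemxAl scalemxAl -tf.
  rewrite -(mulmxA fN) -fundM TFw linearZ /= -scalemxAr -scalemxAl fundM -!mulmxA tv.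
  by rewrite -!scalemxAr scalerA /y !mulmxA.
have : (t - q ^- (N * size w) * t) *: y = 0 by rewrite scalerBl -e1 subrr.
move/eqP; rewrite scaler_eq0 => /orP [|/eqP //].
rewrite -{1}[t]mul1r -mulrBl mulf_eq0 (negPf t0) orbF subr_eq0 eq_sym invr_eq1.
by rewrite /= mulnS -(prednK N0) addSn (negPf (qn1 _)).
Qed.

Lemma fund_ext (h : 'rV[k]_n.+1) : (forall X, (h *m u X *m v) 0 0 = 0) -> h = 0.
Proof.
move=> h0; apply/rowP => j; have [X eX] := fund_cyclic (delta_mx j 0).
by have := h0 X; rewrite -mulmxA -eX -colE !mxE.
Qed.

Lemma linear_fund_form (h : 'rV[k]_n.+1) (w : 'cV[k]_n.+1) (Y Z : U) :
  linear (fun X => (h *m u (Y * X * Z) *m w) 0 0 : k^o).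
Proof.
move=> c a b; rewrite mulrDr mulrDl -scalerAr -scalerAl linearP mulmxDr mulmxDl.
by rewrite -scalemxAr -scalemxAl !mxE.
Qed.

(** The functional X |-> fN F_i X v is of highest weight type in X, hence determined by F-words, on
    which it vanishes by [fund_Fw]. *)
Lemma fundFf i : fN *m u (F i) = 0.
Proof.
apply: fund_ext.
apply: (@highest_functional_eq0 _ _ _ _ q0 U _ fund_wt).
- by move=> c a b; have := linear_fund_form fN v (F i) 1 c a b; rewrite !mulr1 !fundM !mulmxA.
- by move=> j X; rewrite fundM -!mulmxA fundEv !mulmx0 mxE.
- by move=> j X; rewrite fundM -!mulmxA fundKv -!scalemxAr !mxE.
- move=> f; rewrite -mulmxA -mulmxA (mulmxA (u _) (u _)) -fundM.
  have -> : F i * Fw U f = Fw U (i :: f) by rewrite /Fw big_cons.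
  by rewrite mulmxA fund_Fw mxE.
Qed.

(** As in [fundFf]; commuting E_j past the first F_i leaves at most a multiple of K_j - KV_j, which
    annihilates [fN] because [fund_wt j] is 1 for j different from x. *)
Lemma fundEf j : j != x -> fN *m u (E j) = 0.
Proof.
move=> jx; apply: fund_ext.
apply: (@highest_functional_eq0 _ _ _ _ q0 U _ fund_wt).
- by move=> c a b; have := linear_fund_form fN v (E j) 1 c a b; rewrite !mulr1 !fundM !mulmxA.
- by move=> i X; rewrite fundM -!mulmxA fundEv !mulmx0 mxE.
- by move=> i X; rewrite fundM -!mulmxA fundKv -!scalemxAr !mxE.
- move=> [|i f]; first by rewrite /Fw big_nil fund1 mulmx1 -mulmxA fundEv mulmx0 mxE.
  have -> : Fw U (i :: f) = F i * Fw U f by rewrite /Fw big_cons.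
  rewrite fundM mulmxA -(mulmxA fN) -fundM.
  suff -> : fN *m u (E j * F i) = 0 by rewrite !mul0mx mxE.
  rewrite EF linearD /= mulmxDr fundM mulmxA fundFf mul0mx add0r.
  case: eqVneq => _; last by rewrite scale0r linear0 mulmx0.
  rewrite scale1r !linearZ /= linearB /= -?scalemxAr ?mulmxBr fundKf fundKVf fund_wt1 //.
  by rewrite invr1 subrr scaler0.
Qed.

(** The common kernel of the functionals [fN *m u Y] is a submodule that does not contain v, hence
    zero by irreducibility. *)
Lemma fund_separated (w : 'cV[k]_n.+1) : (forall Y, (fN *m u Y *m w) 0 0 = 0) -> w = 0.
Proof.
move=> hw.
pose W (w : 'cV[k]_n.+1) := forall Y, (fN *m u Y *m w) 0 0 = 0.
have sW : is_subspace W.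
  split=> [Y|c a b ha hb Y]; first by rewrite mulmx0 mxE.
  by rewrite mulmxDr -scalemxAr mxE [X in X + _]mxE ha hb mulr0 addr0.
have [T hT] := subspace_vspace sW.
have [irr _ _ _] := fund_is_V V.
have : w \in T by apply/hT.
case: (irr T) => [X y /hT Wy|->|TE]; first 1 last.
- by rewrite memv0 => /eqP.
- have /hT /(_ 1) : v \in T by rewrite TE memvf.
  by rewrite fund1 mulmx1 mul_delta_mx mxE !eqxx => /eqP; rewrite oner_eq0.
by apply/hT => Y; rewrite mulmxA -(mulmxA fN) -fundM.
Qed.

Lemma fundFv j : j != x -> u (F j) *m v = 0.
Proof.
move=> jx; apply: fund_separated => Y; rewrite -mulmxA (mulmxA (u Y)) -fundM mulmxA.
apply: (@lowest_functional_eq0 _ _ _ _ q0 U (fun Y => (fN *m u (Y * F j) *m v) 0 0) fund_wt).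
- by move=> c a b; have := linear_fund_form fN v 1 (F j) c a b; rewrite !mul1r.
- by move=> i X; rewrite -mulrA fundM mulmxA fundFf !mul0mx mxE.
- by move=> i X; rewrite -mulrA fundM mulmxA fundKf -!scalemxAl !mxE.
move=> e; case: (lastP e) => [|{}e i].
  by rewrite /Ew big_nil mul1r fundFf mul0mx mxE.
rewrite /Ew -cats1 big_cat big_seq1 /= -mulrA fundM mulmxA -mulmxA.
suff -> : u (E i * F j) *m v = 0 by rewrite mulmx0 mxE.
rewrite EF linearD /= mulmxDl fundM -mulmxA fundEv mulmx0 add0r.
case: eqVneq => [->|_]; last by rewrite scale0r linear0 mul0mx.
rewrite scale1r !linearZ /= linearB /= -scalemxAl mulmxBl fundKv fundKVv fund_wt1 //.
by rewrite invr1 subrr scaler0.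
Qed.

(** Together with [levi_ss_f] this places the z_i and the zbar_j in the algebra of invariants P. *)
Lemma levi_ss_v Y : levi_ss x Y -> u Y *m v = counit Y *: v.
Proof.
move=> lY; apply: (lY (fun Y => u Y *m v = counit Y *: v)).
  split; first split.
  - by rewrite !linear0 scale0r mul0mx.
  - by move=> c a b ha hb; rewrite !linearP mulmxDl -scalemxAl ha hb scalerDl scalerA.
  - by rewrite fund1 counit1 mul1mx scale1r.
  - by move=> a b ha hb; rewrite fundM -mulmxA hb -scalemxAr ha scalerA counitM mulrC.
move=> _ [j jx [->|->|->|->]].
- by rewrite fundKv fund_wt1 // counit_K.
- by rewrite fundKVv fund_wt1 // invr1 counit_KV.
- by rewrite fundEv counit_E scale0r.
- by rewrite fundFv // counit_F scale0r.
Qed.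

Lemma levi_ss_f Y : levi_ss x Y -> fN *m u (S Y) = counit Y *: fN.
Proof.
move=> lY; apply: (lY (fun Y => fN *m u (S Y) = counit Y *: fN)).
  split; first split.
  - by rewrite !linear0 scale0r ?mulmx0.
  - by move=> c a b ha hb; rewrite !linearP /= ?mulmxDr -?scalemxAr ha hb scalerDl scalerA.
  - by rewrite antipode1 fund1 counit1 mulmx1 scale1r.
  - by move=> a b ha hb; rewrite antipodeM fundM mulmxA hb -scalemxAl ha scalerA counitM mulrC.
move=> _ [j jx [->|->|->|->]].
- by rewrite antipodeK fundKVf fund_wt1 // invr1 counit_K.
- by rewrite antipodeKV fundKf fund_wt1 // counit_KV.
- by rewrite antipodeE linearN /= mulmxN fundM mulmxA fundEf // mul0mx oppr0 counit_E scale0r.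
- by rewrite antipodeF linearN /= mulmxN fundM mulmxA fundKf -scalemxAl fundFf scaler0 oppr0
    counit_F scale0r.
Qed.

(** As functionals of X both sides are killed by F_i on the left and scale by [fund_wt] under K_i.
    On E-words both vanish, except at the empty word, where they agree. *)
Lemma fund_antipode2_extremal X : (fN *m u (S (S X)) *m v) 0 0 = (fN *m u X *m v) 0 0.
Proof.
apply/eqP; rewrite -subr_eq0; apply/eqP.
apply: (@lowest_functional_eq0 _ _ _ _ q0 U
  (fun X => (fN *m u (S (S X)) *m v) 0 0 - (fN *m u X *m v) 0 0) fund_wt).
- move=> c a b; have := linear_fund_form fN v 1 1 c a b.
  have := linear_fund_form fN v 1 1 c (S (S a)) (S (S b)).
  by rewrite !mul1r !mulr1 !linearP => -> ->; rewrite scalerBr opprD addrACA.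
- move=> i Z; rewrite !antipodeM; case: (antipode2_gen U i) => _ -> _ _.
  rewrite !fundM !mulmxA fundKf -!scalemxAl fundFf.
  by rewrite !mul0mx scaler0 mxE subrr.
- move=> i Z; rewrite !antipodeM; case: (antipode2_gen U i) => _ _ -> _.
  by rewrite !fundM !mulmxA fundKf -!scalemxAl !mxE mulrBr.
- move=> e; case: (lastP e) => [|{}e i].
    by rewrite /Ew big_nil !antipode1 subrr.
  rewrite /Ew -cats1 big_cat big_seq1 /= !antipodeM; case: (antipode2_gen U i) => -> _ _ _.
  by rewrite !fundM -!mulmxA fundKVv -!scalemxAr fundEv !(mulmx0, scaler0) mxE subrr.
Qed.

(* S^2 fixes the annihilator of the highest weight vector, so it induces a linear
   endomorphism of V. *)
Lemma fund_antipode2 : exists D : 'M[k]_n.+1, forall X, u (S (S X)) *m v = D *m (u X *m v).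
Proof.
have ann X : u X *m v = 0 -> u (S (S X)) *m v = 0.
  move=> hX; apply: fund_separated => Y; have [Z <-] := antipode2_surjective Y.
  rewrite -mulmxA (mulmxA (u _)) -fundM -!antipodeM mulmxA fund_antipode2_extremal.
  by rewrite fundM -!mulmxA hX !mulmx0 mxE.
have /choice [B hB] : forall j, exists X, delta_mx j 0 = u X *m v by move=> j; apply: fund_cyclic.
exists (\matrix_(i, j) (u (S (S (B j))) *m v) i 0) => X.
(* Y is the combination of the chosen [B j] that acts on v as X does, so by [ann] also S^2(X) and
   S^2(Y) agree on v. *)
pose Y := \sum_j (u X *m v) j 0 *: B j.
have hY : u (X - Y) *m v = 0.
  rewrite linearB /= mulmxBl /Y linear_sum /= mulmx_suml.
  rewrite [X in X - _]matrix_sum_delta; apply/eqP; rewrite subr_eq0; apply/eqP.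
  by apply: eq_bigr => j _; rewrite big_ord1 linearZ /= -scalemxAl -hB.
have := ann _ hY; rewrite !linearB /= mulmxBl => /eqP; rewrite subr_eq0 => /eqP ->.
apply/colP => i; rewrite /Y !linear_sum /= mulmx_suml summxE [RHS]mxE.
by apply: eq_bigr => j _; rewrite !linearZ /= -scalemxAl !mxE mulrC.
Qed.
End FundamentalRepresentation.

(** * The coordinate algebra and the sphere *)

Lemma regular_scaleE (k : fieldType) (a : k) (b : k^o) : a *: b = a * b.
Proof. by []. Qed.

Section CoordinateAlgebra.
Variables (k : fieldType) (q : k) (l : nat) (g : simple_type l).
Variables (U : quantum_group q g) (O : coordinate_algebra U).
Implicit Types (a b : O) (X Y : U).

(** Linearity of [ev] in the first argument is given; in the second it is inherited from matrix
    coefficients through [ev_image]. *)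
Lemma ev_linearU a : linear (ev a : U -> k^o).
Proof.
have [n [c [c_ [hc evE]]]] : in_span_of_coefficients (ev a) by apply/ev_image; exists a.
have lc i : linear (c_ i : U -> k^o).
  have [lam [m [r [v [_ [f [w h]]]]]]] := hc i.
  by move=> d X Y; rewrite !h linearP mulmxDr mulmxDl -scalemxAr -scalemxAl !mxE.
move=> d X Y; rewrite !evE scaler_sumr -big_split /=.
by apply: eq_bigr => i _; rewrite lc !regular_scaleE mulrDr mulrCA.
Qed.

Lemma ev_linearO X : linear (fun a : O => ev a X : k^o).
Proof. by move=> c a b; rewrite ev_linear. Qed.

Lemma bilinear_ev2 a b : bilinear_map (fun X Y : U => ev a X * ev b Y : k^o).
Proof.
split=> [Y|X] c X1 X2.
  by rewrite ev_linearU !regular_scaleE mulrDl mulrA.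
by rewrite ev_linearU !regular_scaleE mulrDr mulrCA.
Qed.

Lemma bilinear_ev2O X Y : bilinear_map (fun a b : O => ev a X * ev b Y : k^o).
Proof.
split=> [b|a] c a1 a2; first by rewrite ev_linearO !regular_scaleE mulrDl mulrA.
by rewrite ev_linearO !regular_scaleE mulrDr mulrCA.
Qed.

Lemma ev0 X : ev (0 : O) X = 0. Proof. exact: (linear_for0 (ev_linearO X)). Qed.
Lemma evD a b X : ev (a + b) X = ev a X + ev b X.
Proof. exact: (linear_forD (ev_linearO X)). Qed.
Lemma evB a b X : ev (a - b) X = ev a X - ev b X.
Proof. exact: (linear_forB (ev_linearO X)). Qed.
Lemma evZ c a X : ev (c *: a) X = c * ev a X.
Proof. exact: (linear_forZ (ev_linearO X)). Qed.
Lemma ev_sum (I : Type) (r : seq I) (F : I -> O) X :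
  ev (\sum_(i <- r) F i) X = \sum_(i <- r) ev (F i) X.
Proof. exact: (linear_for_sum (ev_linearO X)). Qed.

Lemma evr0 a : ev a 0 = 0. Proof. exact: (linear_for0 (ev_linearU a)). Qed.
Lemma evrD a X Y : ev a (X + Y) = ev a X + ev a Y.
Proof. exact: (linear_forD (ev_linearU a)). Qed.
Lemma evrZ c a X : ev a (c *: X) = c * ev a X.
Proof. exact: (linear_forZ (ev_linearU a)). Qed.
Lemma ev_mulM a b X Y : ev (a * b) (X * Y) =
  \tsum_(X1, X2 <- comul X) \tsum_(Y1, Y2 <- comul Y) (ev a (X1 * Y1) * ev b (X2 * Y2) : k^o).
Proof. by rewrite ev_mul (comul_sweedlerM _ _ (bilinear_ev2 a b)). Qed.

Lemma ev_left_action X a Y : ev (left_action X a) Y = ev a (Y * X).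
Proof.
rewrite ev_comul /left_action !tfoldE ev_sum; apply: eq_bigr => x _.
by rewrite evZ mulrC.
Qed.

Lemma left_action_linear X : linear (left_action (O := O) X).
Proof.
move=> c a b; apply: ev_inj => Y.
by rewrite evD evZ !ev_left_action evD evZ.
Qed.

Lemma left_action_linearU a : linear (fun X => left_action X a).
Proof.
move=> c X Y; apply: ev_inj => Z.
by rewrite evD evZ !ev_left_action mulrDr evrD -scalerAr evrZ.
Qed.

Lemma left_action1 a : left_action 1 a = a.
Proof. by apply: ev_inj => Y; rewrite ev_left_action mulr1. Qed.

Lemma left_actionA X Y a : left_action X (left_action Y a) = left_action (X * Y) a.
Proof. by apply: ev_inj => Z; rewrite !ev_left_action mulrA. Qed.

Lemma left_actionM X a b : left_action X (a * b) =
  \tsum_(X1, X2 <- comul X) (left_action X1 a * left_action X2 b).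
Proof.
apply: ev_inj => Y; rewrite ev_left_action ev_mulM !tfoldE ev_sum exchange_big /=.
apply: eq_bigr => x _; rewrite ev_mul tfoldE; apply: eq_bigr => y _.
by rewrite !ev_left_action.
Qed.

Lemma bilinear_left_action a b :
  bilinear_map (fun X Y => left_action X a * left_action Y b).
Proof.
split=> [Y|X] c X1 X2; first by rewrite left_action_linearU mulrDl -scalerAl.
by rewrite left_action_linearU mulrDr -scalerAr.
Qed.

Lemma left_actionK i a b : left_action (uK U i) (a * b) =
  left_action (uK U i) a * left_action (uK U i) b.
Proof. by rewrite left_actionM comul_K (tfold_pure (bilinear_left_action a b)). Qed.

Lemma left_actionE i a b : left_action (uE U i) (a * b) =
  left_action (uE U i) a * left_action (uK U i) b + a * left_action (uE U i) b.
Proof.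
rewrite left_actionM comul_E (linear_forD (tfold_linear (bilinear_left_action a b))).
by rewrite !(tfold_pure (bilinear_left_action a b)) left_action1.
Qed.

Section LeftCoideal.
Variable B : left_coideal_subalgebra O.
Implicit Types p : B.

Lemma ev_lcoact p X Y :
  \tsum_(a, p' <- lcoact p) (ev a X * ev (incl p') Y : k^o) = ev (incl p) (X * Y).
Proof.
rewrite ev_comul -lcoactE [X in _ = tfold X _]tfoldE.
by rewrite (tfold_sum_pure (bilinear_ev2O X Y)).
Qed.

Lemma ev_right_action p X Y : ev (incl (right_action p X)) Y = ev (incl p) (X * Y).
Proof.
rewrite -ev_lcoact /right_action !tfoldE linear_sum ev_sum.
by apply: eq_bigr => x _; rewrite linearZ /= evZ.
Qed.

End LeftCoideal.
End CoordinateAlgebra.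

(** * The generators of the sphere *)

Section SphereGenerators.
Variables (k : fieldType) (q : k) (l : nat) (g : simple_type l) (x : 'I_l).
Hypotheses (q0 : q != 0) (qn1 : forall n, q ^+ n.+1 != 1).
Variables (U : quantum_group q g) (O : coordinate_algebra U).
Variables (P : sphere_algebra O x) (V : fundamental_basis U x).
Local Notation n := (fund_dim V).
Local Notation u := (fund_rep V).
Local Notation S := (@antipode k U).

Lemma fund_coefficient (w : 'cV[k]_n.+1) (f : 'rV[k]_n.+1) :
  exists a : O, forall X, ev a X = (f *m u X *m w) 0 0.
Proof.
apply/ev_image; exists 1%N, (fun=> 1), (fun=> fun X => (f *m u X *m w) 0 0).
split=> [_|X]; last by rewrite big_ord1 mul1r.
exists (fundamental_weight x), n, u, (delta_mx ord_max 0); split; first exact: fund_is_V.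
by exists f, w.
Qed.

Lemma z_exists i : exists p : P, is_z (V := V) i p.
Proof.
have [a ha] := fund_coefficient (delta_mx ord_max 0) (delta_mx 0 i).
have [p hp] : exists p : P, incl p = a.
  apply/inv_algP => X lX; apply: ev_inj => Y.
  by rewrite ev_left_action evZ !ha fundM -!mulmxA levi_ss_v // -!scalemxAr mxE.
by exists p => X; rewrite hp ha -mulmxA -rowE mxE fund_coef.
Qed.

Lemma zbar_exists j : exists p : P, is_zbar (V := V) j p.
Proof.
have [a ha] := fund_coefficient (delta_mx j 0) (delta_mx 0 ord_max).
have haS X : ev (antipode a) X =
    (delta_mx 0 ord_max *m u (S X) *m delta_mx j 0 : 'M_1) 0 0.
  by rewrite ev_antipode ha.
have [p hp] : exists p : P, incl p = antipode a.
  apply/inv_algP => X lX; apply: ev_inj => Y.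
  rewrite ev_left_action evZ !haS antipodeM fundM mulmxA levi_ss_f //.
  by rewrite -!scalemxAl mxE.
by exists p => X; rewrite hp haS -mulmxA -rowE -colE !mxE.
Qed.

(** Both relations are the antipode axiom read at the (N, N) entry: S(X1) X2 gives the first, and
    its image S(X2) S^2(X1) under S gives the second. Hence z'_i(X) is the coefficient f_i(S^2(X)
    v_N), which lies in the span of the z_j by [fund_antipode2]. *)
Lemma sphere_generators :
  exists z zb z' : 'I_n.+1 -> P,
  [/\ forall i, is_z (V := V) i (z i), forall i, is_zbar (V := V) i (zb i),
      exists D : 'M[k]_n.+1, forall i, z' i = \sum_j D i j *: z j,
      \sum_i zb i * z i = 1 & \sum_i z' i * zb i = 1].
Proof.
have /choice [z hz] := z_exists; have /choice [zb hzb] := zbar_exists.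
have [D hD] := fund_antipode2 q0 qn1 V.
exists z, zb, (fun i => \sum_j D i j *: z j); split=> //; first by exists D.
  apply: (@incl_inj _ _ P); apply: ev_inj => X; rewrite rmorph1 ev_one.
  rewrite linear_sum ev_sum; under eq_bigr do rewrite rmorphM ev_mul tfoldE.
  rewrite exchange_big /=.
  have := congr1 (fun Y => (u Y) ord_max ord_max) (antipode_left X).
  rewrite /= linearZ /= fund1 !mxE eqxx mulr1 => <-; rewrite tfoldE linear_sum summxE.
  by apply: eq_bigr => y _; rewrite /= fundM mxE; apply: eq_bigr => i _; rewrite hz hzb.
have hz' i X : ev (incl (\sum_j D i j *: z j)) X = u (S (S X)) i ord_max.
  rewrite -fund_coef hD mxE linear_sum ev_sum.
  by apply: eq_bigr => j _; rewrite linearZ /= evZ hz fund_coef.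
apply: (@incl_inj _ _ P); apply: ev_inj => X; rewrite rmorph1 ev_one.
rewrite linear_sum ev_sum; under eq_bigr do rewrite rmorphM ev_mul tfoldE.
rewrite exchange_big /=.
have := congr1 (fun Y => (u (S Y)) ord_max ord_max) (antipode_left X).
rewrite /= linearZ /= antipode1 linearZ /= fund1 !mxE eqxx mulr1 => <-.
rewrite tfoldE !linear_sum summxE.
apply: eq_bigr => y _; rewrite /= antipodeM fundM mxE.
by apply: eq_bigr => i _; rewrite hz' hzb mulrC.
Qed.
End SphereGenerators.

Section GeneratorActions.
Variables (k : fieldType) (q : k) (l : nat) (g : simple_type l) (x : 'I_l).
Hypotheses (q0 : q != 0).
Variables (U : quantum_group q g) (O : coordinate_algebra U).
Variables (P : sphere_algebra O x) (V : fundamental_basis U x).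
Local Notation u := (fund_rep V).
Local Notation "X ▷ a" := (left_action X a) (at level 45, right associativity).
Local Notation wt := (fund_wt q g x).

Lemma z_K i (p : P) j : is_z (V := V) i p -> uK U j ▷ incl p = wt j *: incl p.
Proof.
move=> hp; apply: ev_inj => X.
by rewrite ev_left_action evZ !hp -!fund_coef fundM -mulmxA fundKv -scalemxAr mxE.
Qed.

Lemma z_E i (p : P) j : is_z (V := V) i p -> uE U j ▷ incl p = 0.
Proof.
move=> hp; apply: ev_inj => X.
by rewrite ev_left_action ev0 !hp -!fund_coef fundM -mulmxA fundEv mulmx0 mxE.
Qed.

Lemma zbar_K i (p : P) j : is_zbar (V := V) i p -> uK U j ▷ incl p = (wt j)^-1 *: incl p.
Proof.
have e M : (M : 'M[k]_((fund_dim V).+1)) ord_max i = (delta_mx 0 ord_max *m M : 'rV_ _) 0 i.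
  by rewrite -rowE mxE.
move=> hp; apply: ev_inj => X; rewrite ev_left_action evZ !hp !e antipodeM antipodeK fundM.
by rewrite mulmxA fundKVf // -scalemxAl mxE.
Qed.

Section HighestWeight.
Variables (p : P) (hp : is_z (V := V) ord_max p).

Lemma zN_ev X : ev (incl p) X = (delta_mx 0 ord_max *m u X *m delta_mx ord_max 0 : 'M_1) 0 0.
Proof. by rewrite hp fund_coefN. Qed.

Lemma zN_F (qn1 : forall n, q ^+ n.+1 != 1) i X : ev (incl p) (uF U i * X) = 0.
Proof. by rewrite zN_ev fundM mulmxA fundFf // !mul0mx mxE. Qed.
Lemma zN_Kl i X : ev (incl p) (uK U i * X) = wt i * ev (incl p) X.
Proof. by rewrite !zN_ev fundM mulmxA fundKf -!scalemxAl mxE. Qed.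
Lemma zN_1 : ev (incl p) 1 = 1.
Proof. by rewrite zN_ev fund1 mulmx1 mul_delta_mx mxE !eqxx. Qed.
End HighestWeight.
End GeneratorActions.

Lemma is_subspace_sum (k : fieldType) (M : lmodType k) (W : M -> Prop) (I : Type)
    (r : seq I) (F : I -> M) :
  is_subspace W -> (forall i, W (F i)) -> W (\sum_(i <- r) F i).
Proof.
move=> sW WF; elim: r => [|i r IH]; first by rewrite big_nil; apply: sW.1.
by rewrite big_cons -[F i]scale1r; apply: sW.2.
Qed.

Lemma is_subspaceZ (k : fieldType) (M : lmodType k) (W : M -> Prop) c w :
  is_subspace W -> W w -> W (c *: w).
Proof. by move=> sW Ww; rewrite -[_ *: _]addr0; apply: sW.2 => //; apply: sW.1. Qed.

Lemma is_subspaceD (k : fieldType) (M : lmodType k) (W : M -> Prop) v w :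
  is_subspace W -> W v -> W w -> W (v + w).
Proof. by move=> sW Wv Ww; rewrite -[v]scale1r; apply: sW.2. Qed.

(** * The grading as eigenspaces of K_x *)

Section Grading.
Variables (k : fieldType) (q : k) (l : nat) (g : simple_type l) (x : 'I_l).
Hypotheses (q0 : q != 0) (qn1 : forall n, q ^+ n.+1 != 1).
Variables (U : quantum_group q g) (O : coordinate_algebra U).
Variables (P : sphere_algebra O x) (B : flag_algebra O x) (V : fundamental_basis U x).
Variables (gr : int -> P -> Prop) (hgr : sphere_grading V B gr).
Local Notation u := (fund_rep V).
Local Notation "X ▷ a" := (left_action X a) (at level 45, right associativity).
Local Notation wt := (fund_wt q g x).
Local Notation I := 'I_((fund_dim V).+1).
Variables (z zb z' : I -> P) (D : 'M[k]_((fund_dim V).+1)).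
Hypotheses (hz : forall i, is_z i (z i)) (hzb : forall i, is_zbar i (zb i)).
Hypothesis hz' : forall i, z' i = \sum_j D i j *: z j.
Hypotheses (zbz : \sum_i zb i * z i = 1) (z'zb : \sum_i z' i * zb i = 1).

Let G := sg_grading hgr.

Lemma gr_z i : gr 1 (z i). Proof. apply: (sg_z hgr); exact: hz. Qed.
Lemma gr_zb i : gr (-1) (zb i). Proof. apply: (sg_zbar hgr); exact: hzb. Qed.
Lemma gr_z' i : gr 1 (z' i).
Proof.
rewrite hz'; apply: is_subspace_sum; first exact: gr_subspace G 1.
by move=> j; apply: is_subspaceZ; [exact: gr_subspace G 1 | exact: gr_z].
Qed.

Lemma z'_K i j : uK U j ▷ incl (z' i) = wt j *: incl (z' i).
Proof.
rewrite hz' !linear_sum (linear_for_sum (left_action_linear _)) /= ?scaler_sumr.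
apply: eq_bigr => m _; rewrite linearZ /= (linear_forZ (left_action_linear _)).
by rewrite (z_K _ (hz m)) !scalerA mulrC.
Qed.

Lemma z'_E i j : uE U j ▷ incl (z' i) = 0.
Proof.
rewrite hz' !linear_sum (linear_for_sum (left_action_linear _)) /=.
apply: big1 => m _; rewrite linearZ /= (linear_forZ (left_action_linear _)).
by rewrite (z_E _ (hz m)) scaler0.
Qed.

Lemma levi_ss_in_P Y (p : P) : levi_ss x Y -> Y ▷ incl p = counit Y *: incl p.
Proof.
by have [h _] := inv_algP P (incl p); apply: h; exists p.
Qed.

Lemma gr0_K (p : P) : gr 0 p -> uK U x ▷ incl p = incl p.
Proof.
move=> /(sg_zero hgr) [b <-]; have [h _] := inv_algP B (incl b).
rewrite (h (ex_intro _ b erefl)) ?counit_K ?scale1r //.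
by apply: generated_subalgebra_gen; left; exists x; left.
Qed.

(** Elements of P are invariant under [levi_ss]; K_x and its inverse are the only further generators
    of [levi]. *)
Lemma gr0P (p : P) : uK U x ▷ incl p = incl p -> gr 0 p.
Proof.
move=> Kp; apply/(sg_zero hgr); apply/inv_algP => Y lY.
apply: (lY (fun Y => Y ▷ incl p = counit Y *: incl p)).
  split; first split.
  - by rewrite linear0 scale0r (linear_for0 (left_action_linearU _)).
  - by move=> c a b ha hb; rewrite left_action_linearU linearP ha hb scalerDl scalerA.
  - by rewrite left_action1 counit1 scale1r.
  - move=> a b ha hb; rewrite -left_actionA hb (linear_forZ (left_action_linear _)) ha.
    by rewrite scalerA counitM mulrC.
have ss j Y' : j != x -> [\/ Y' = uK U j, Y' = uKV U j, Y' = uE U j | Y' = uF U j] ->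
    Y' ▷ incl p = counit Y' *: incl p.
  by move=> jx hY; apply: levi_ss_in_P; apply: generated_subalgebra_gen; exists j.
move=> Y' [[j hY]|[j jx hY]]; last first.
  by apply: (ss j) => //; case: hY => ->; [apply: Or43|apply: Or44].
have [jx|jx] := eqVneq j x; last first.
  by apply: (ss j) => //; case: hY => ->; [apply: Or41|apply: Or42].
case: hY => ->; rewrite jx; first by rewrite counit_K scale1r.
by rewrite -{1}Kp left_actionA KVK left_action1 counit_KV scale1r.
Qed.

Lemma wtx_neq0 : wt x != 0. Proof. exact: fund_wt_neq0. Qed.

Lemma mul_frame (a b : I -> P) (p : P) : \sum_i b i * a i = 1 -> \sum_i (p * b i) * a i = p.
Proof. by move=> ba; under eq_bigr do rewrite -mulrA; rewrite -mulr_sumr ba mulr1. Qed.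

(** The expansion p = sum_i (p b_i) a_i passes between degrees n + e and n, so a description of the
    part of degree n by K_x transfers to degree n + e. *)
Lemma gr_Kx_step (a b : I -> P) n e :
  (forall i, gr e (a i)) -> (forall i, gr (- e) (b i)) ->
  (forall i, uK U x ▷ incl (a i) = wt x ^ e *: incl (a i)) ->
  (forall i, uK U x ▷ incl (b i) = wt x ^ (- e) *: incl (b i)) ->
  \sum_i b i * a i = 1 ->
  (forall p, gr n p <-> uK U x ▷ incl p = wt x ^ n *: incl p) ->
  forall p, gr (n + e) p <-> uK U x ▷ incl p = wt x ^ (n + e) *: incl p.
Proof.
move=> ga gb Ka Kb ba IH p; have wt0 := wtx_neq0; split=> hp.
  rewrite -(mul_frame p ba) !linear_sum (linear_for_sum (left_action_linear _)).
  rewrite ?scaler_sumr; apply: eq_bigr => i _; rewrite /= rmorphM left_actionK Ka.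
  rewrite (IH (p * b i)).1; first by rewrite -scalerAl -scalerAr scalerA expfzDr.
  have := gr_mul G hp (gb i); by rewrite addrK.
rewrite -(mul_frame p ba); apply: is_subspace_sum; first exact: gr_subspace G _.
move=> i; apply: (gr_mul G _ (ga i)); apply/IH.
rewrite rmorphM left_actionK Kb hp -scalerAl -scalerAr scalerA -expfzDr //.
by rewrite addrK.
Qed.

(** The grading is pinned down only on generators and in degree 0, where it amounts to invariance
    under K_x; the frames zbar, z and z', zbar reach the other degrees. *)
Lemma gr_Kx n p : gr n p <-> uK U x ▷ incl p = wt x ^ n *: incl p.
Proof.
have h0 p' : gr 0 p' <-> uK U x ▷ incl p' = wt x ^ 0 *: incl p'.
  by rewrite expr0z scale1r; split; [apply: gr0_K|apply: gr0P].
case: n => m; rewrite ?NegzE.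
  elim: m p => [|m IH] p //.
  rewrite -addn1 PoszD; apply: (@gr_Kx_step z zb) => // i; [exact: gr_z|exact: gr_zb| |].
    by rewrite expr1z; apply: z_K.
  by rewrite exprN1; apply: zbar_K.
elim: {m}m.+1 p => [|m IH] p; first by rewrite oppr0.
rewrite -addn1 PoszD opprD; apply: (@gr_Kx_step zb z') => // i; [exact: gr_zb| | |].
- by rewrite opprK; apply: gr_z'.
- by rewrite exprN1; apply: zbar_K.
- by rewrite opprK expr1z; apply: z'_K.
Qed.

Lemma gr_K n p j : gr n p -> uK U j ▷ incl p = wt j ^ n *: incl p.
Proof.
move=> gp; have [->|jx] := eqVneq j x; first exact/gr_Kx.
rewrite fund_wt1 // exp1rz scale1r levi_ss_in_P ?counit_K ?scale1r //.
by apply: generated_subalgebra_gen; exists j => //; apply: Or41.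
Qed.

(** Degree is an eigenvalue condition for the left action, which commutes with the right action. *)
Lemma gr_right_action n p X : gr n p -> gr n (right_action p X).
Proof.
move=> /gr_Kx Kp; apply/gr_Kx; apply: ev_inj => Y.
rewrite ev_left_action ev_right_action mulrA -ev_left_action Kp.
by rewrite !evZ ev_right_action.
Qed.
End Grading.

(** * The calculus over the flag manifold *)

Section Separation.
Variables (k : fieldType) (q : k) (l : nat) (g : simple_type l).
Variables (U : quantum_group q g) (O : coordinate_algebra U) (M L : lmodType k).
Variables (T : O -> M -> L) (Th : (M -> k^o) -> Prop).
Hypotheses (bT : bilinear_map T) (linTh : forall th, Th th -> linear th).
Hypothesis null : forall a b, (forall th, Th th -> th b = 0) -> T a b = 0.

(** Eliminates the term of index i0 by moving the coefficients of a linear dependence to the second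
    factors. *)
Lemma bilinear_relation (N : lmodType k) (f : O -> M -> N) n (i0 : 'I_n.+1)
    (d : 'I_n -> k) (a : 'I_n.+1 -> O) (b : 'I_n.+1 -> M) :
  bilinear_map f -> a i0 = \sum_i d i *: a (lift i0 i) ->
  \sum_i f (a i) (b i) = \sum_i f (a (lift i0 i)) (d i *: b i0 + b (lift i0 i)).
Proof.
move=> bf ai0; rewrite (bigD1_ord i0) //= ai0 (bilinear_suml bf) -big_split /=.
by apply: eq_bigr => i _; rewrite bf.2 (linear_forZ (bf.1 _)).
Qed.

(* By induction on the number of terms we may assume the a i linearly independent. *)
Lemma separated_sum n (a : 'I_n -> O) (b : 'I_n -> M) :
  (forall th X, Th th -> \sum_i ev (a i) X * th (b i) = 0) ->
  \sum_i T (a i) (b i) = 0.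
Proof.
elim: n a b => [|n IH] a b h0; first by rewrite big_ord0.
have [[c c0 [i0 ci0]]|indep] := pselect
    (exists2 c : 'I_n.+1 -> k, \sum_i c i *: a i = 0 & exists i0, c i0 != 0).
  pose d i := - (c (lift i0 i) / c i0).
  have ai0 : a i0 = \sum_i d i *: a (lift i0 i).
    move: c0; rewrite (bigD1_ord i0) //= => /eqP; rewrite addr_eq0 => /eqP e.
    rewrite -[a i0](scalerK ci0) e scalerN scaler_sumr -sumrN.
    by apply: eq_bigr => i _; rewrite scalerA mulrC -scaleNr.
  rewrite (bilinear_relation b bT ai0); apply: IH => th X hth.
  rewrite -[RHS](h0 th X hth); symmetry.
  apply: (@bilinear_relation k^o (fun a b => ev a X * th b) n i0 d a b) => //.
  split=> [m|a'] e u v.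
    by rewrite ev_linearO !regular_scaleE mulrDl mulrA.
  by rewrite (linTh hth) !regular_scaleE mulrDr mulrCA.
(* For independent a_i every test functional satisfies sum_i th(b_i) a_i = 0 in O, so all th(b_i)
   vanish and [null] applies to each term. *)
apply: big1 => i _; apply: null => th hth; apply/eqP/negPn/negP => ti.
apply: indep; exists (fun i => th (b i)); last by exists i.
apply: ev_inj => X; rewrite ev_sum ev0 -[RHS](h0 th X hth).
by apply: eq_bigr => j _; rewrite evZ mulrC.
Qed.

Lemma separated_sum_seq (s : seq (O * M)) :
  (forall th X, Th th -> \sum_(y <- s) ev y.1 X * th y.2 = 0) ->
  \sum_(y <- s) T y.1 y.2 = 0.
Proof.
move=> h; rewrite (big_nth (0, 0)) big_mkord.
apply: (@separated_sum _ (fun i => (nth (0, 0) s i).1) (fun i => (nth (0, 0) s i).2)).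
by move=> th X hth; rewrite -[RHS](h th X hth) [RHS](big_nth (0, 0)) big_mkord.
Qed.
End Separation.

Section FlagCalculus.
Variables (k : fieldType) (q : k) (l : nat) (g : simple_type l) (x : 'I_l).
Variables (U : quantum_group q g) (O : coordinate_algebra U).
Variables (P : sphere_algebra O x) (B : flag_algebra O x) (W : fodc P).
Hypothesis hW : restricts_to_flag_calculus B W.
Local Notation "X ▷ a" := (left_action X a) (at level 45, right associativity).
Local Notation "a ⊠ b" := (tens (@flag_relation _ _ _ _ _ O x B) a b) (at level 40).
Local Notation E := (uE U x).

Lemma flag_invariant (b : B) Y : levi x Y -> Y ▷ incl b = counit Y *: incl b.
Proof. by have [h _] := inv_algP B (incl b); apply: h; exists b. Qed.

Lemma left_actionF (a b : O) i : uF U i ▷ (a * b) =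
  (uF U i ▷ a) * b + (uKV U i ▷ a) * (uF U i ▷ b).
Proof.
rewrite left_actionM comul_F (linear_forD (tfold_linear (bilinear_left_action a b))).
by rewrite !(tfold_pure (bilinear_left_action a b)) left_action1.
Qed.

Lemma flag_mul_left_action (b : B) (a : O) Y : levi x Y ->
  incl b * (Y ▷ a) = Y ▷ (incl b * a).
Proof.
move=> lY; move: a; apply: (lY (fun Y => forall a, incl b * (Y ▷ a) = Y ▷ (incl b * a))).
  split; first split.
  - by move=> a; rewrite !(linear_for0 (left_action_linearU _)) mulr0.
  - by move=> c Y1 Y2 h1 h2 a; rewrite !left_action_linearU mulrDr -scalerAr h1 h2.
  - by move=> a; rewrite !left_action1.
  - by move=> Y1 Y2 h1 h2 a; rewrite -left_actionA h1 h2 left_actionA.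
have lK i : levi x (uK U i) by apply: generated_subalgebra_gen; left; exists i; left.
have lKV i : levi x (uKV U i) by apply: generated_subalgebra_gen; left; exists i; right.
have hK i a : incl b * (uK U i ▷ a) = uK U i ▷ (incl b * a).
  by rewrite left_actionK flag_invariant // counit_K scale1r.
move=> _ [[i [->|->]]|[j jx [->|->]]] a //.
- by rewrite -{2}[a]left_action1 -(KKV U i) -left_actionA hK left_actionA KVK left_action1.
- rewrite left_actionE (@flag_invariant b (uE U j)) ?counit_E ?scale0r ?mul0r ?add0r //.
  by apply: generated_subalgebra_gen; right; exists j => //; left.
- rewrite left_actionF (@flag_invariant b (uF U j)) ?counit_F ?scale0r ?mul0r ?add0r //.
    by rewrite flag_invariant // counit_KV scale1r.
  by apply: generated_subalgebra_gen; right; exists j => //; right.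
Qed.

Lemma bilinear_flag_lact (b : B) : bilinear_map (fun a b' => (incl b * a) ⊠ b').
Proof.
split=> [b'|a] c u v; last by rewrite (tens_bilinear _).2.
by rewrite mulrDr -scalerAr (tens_bilinear _).1.
Qed.

Lemma respects_flag_lact (b : B) :
  respects (@flag_relation _ _ _ _ _ O x B) (fun a b' => (incl b * a) ⊠ b').
Proof.
move=> y z [yz hyz]; rewrite yz.
by apply: (@tens_respects _ _ _ (@flag_relation _ _ _ _ _ O x B) (_, y.2) (_, z.2)).
Qed.

(** The pairs whose sum in O ⊠ B is y.1 times the differential of y.2; as a list they can be tested
    termwise by functionals. *)
Definition flag_terms (y : B * B) : seq (O * B) :=
  [seq (incl y.1 * c.1, c.2 - counit (incl c.2) *: 1) | c : O * B <- repr (lcoact y.2)].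

Lemma flag_lact_dbar (y : B * B) :
  flag_lact y.1 (flag_dbar y.2) = \sum_(c <- flag_terms y) c.1 ⊠ c.2.
Proof.
have lf := tfold_is_linear (bilinear_flag_lact y.1) (@respects_flag_lact y.1).
rewrite /flag_lact /flag_dbar [X in tfold X]tfoldE (linear_for_sum lf) big_map.
apply: eq_bigr => c _; apply: tfold_tens; [exact: bilinear_flag_lact|exact: respects_flag_lact].
Qed.

Lemma flag_terms_ev (y : B * B) X Z : counit Z = 0 ->
  \sum_(c <- flag_terms y) ev c.1 X * ev (incl c.2) Z = ev (incl y.1 * (Z ▷ incl y.2)) X.
Proof.
move=> Z0; rewrite big_map /left_action -lcoactE [X in _ * tfold X _]tfoldE.
rewrite (tfold_sum_pure (f := fun a1 a2 => ev a2 Z *: a1)); last first.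
  split=> [n|m] c u v; first by rewrite scalerDr !scalerA mulrC.
  by rewrite ev_linear scalerDl scalerA.
rewrite mulr_sumr ev_sum; apply: eq_bigr => c _ /=.
rewrite -scalerAr evZ mulrC; congr (_ * _).
by rewrite linearB linearZ /= rmorph1 evB evZ ev_one Z0 mulr0 subr0.
Qed.

Lemma counit_levi_E Y : counit (Y * E) = 0 :> k.
Proof. by rewrite counitM counit_E mulr0. Qed.

Variable j : B -> P.
Hypothesis hj : forall b, incl (j b) = incl b.

(** Pairing with E_x respects [flag_ideal], which gives one direction. For the other, the
    functionals of T^(0,1) are Y E_x with Y in the Levi part, and Y can be pulled in front of the
    sum because left multiplication by elements of B commutes with its action. *)
Lemma flag_calculusP (s : seq (B * B)) :
  \sum_(y <- s) lact (j y.1) (diff W (j y.2)) = 0 <->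
  \sum_(y <- s) incl y.1 * (E ▷ incl y.2) = 0.
Proof.
have [phi [phiL phiI _ phiM phiD]] := hW.
have rest (s' : seq (B * B)) : restricted_form B (\sum_(y <- s') lact (j y.1) (diff W (j y.2))).
  exists [seq (j y.1, j y.2) | y <- s'] => [y|]; last by rewrite big_map.
  by case/mapP => y' _ ->; rewrite /= !hj; split; [exists y'.1|exists y'.2].
have rest0 : restricted_form B (0 : W) by have := rest [::]; rewrite big_nil.
have phi0 : phi 0 = 0.
  by have := phiL 1 _ _ rest0 rest0; rewrite !scale1r addr0 -{1}[phi 0]addr0 => /addrI.
have phi1 y : phi (lact (j y.1) (diff W (j y.2))) = flag_lact y.1 (flag_dbar y.2).
  have r1 : restricted_form B (diff W (j y.2)).
    have := rest [:: (1, y.2)]; rewrite big_seq1 /=.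
    suff -> : j 1 = 1 by rewrite lact1.
    by apply: (@incl_inj _ _ P); rewrite hj !rmorph1.
  by rewrite (phiM _ _ _ (esym (hj y.1)) r1).1 (phiD _ _ (esym (hj y.2))).
have phis : phi (\sum_(y <- s) lact (j y.1) (diff W (j y.2))) =
    \sum_(c <- flatten (map flag_terms s)) c.1 ⊠ c.2.
  elim: s => [|y s IH]; first by rewrite !big_nil.
  rewrite big_cons /= big_cat /= -IH -flag_lact_dbar -phi1.
  have := phiL 1 _ _ (rest [:: y]) (rest s); rewrite !scale1r big_seq1.
  by [].
have evs X Z : counit Z = 0 ->
    \sum_(c <- flatten (map flag_terms s)) ev c.1 X * ev (incl c.2) Z =
    ev (\sum_(y <- s) incl y.1 * (Z ▷ incl y.2)) X.
  move=> Z0; elim: s {phis} => [|y s IH]; first by rewrite !big_nil ev0.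
  by rewrite big_cat /= IH !big_cons evD flag_terms_ev.
split=> h.
  apply: ev_inj => X; rewrite ev0 -evs ?counit_E //.
  have bf : bilinear_map (fun (a : O) (b : B) => ev a X * ev (incl b) E : k^o).
    split=> [b|a] c u v.
      by rewrite ev_linearO !regular_scaleE mulrDl mulrA.
    by rewrite linearP ev_linear !regular_scaleE mulrDr mulrCA.
  have rf : respects (@flag_relation _ _ _ _ _ O x B)
      (fun (a : O) (b : B) => ev a X * ev (incl b) E : k^o).
    move=> y z [-> [_ /(_ 1)]]; rewrite mul1r => h1.
    have /h1 : levi x (1 : U) by move=> W' [].
    by rewrite linearB /= evB => /eqP; rewrite subr_eq0 => /eqP ->.
  have := congr1 (fun t => tfold t (fun (a : O) (b : B) => ev a X * ev (incl b) E : k^o)) phis.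
  rewrite /= h phi0 (linear_for0 (tfold_is_linear bf rf)) (linear_for_sum (tfold_is_linear bf rf)).
  by move=> e; rewrite [RHS]e; apply: eq_bigr => c _; rewrite tfold_tens.
apply: phiI => //; rewrite phi0 phis.
(* The common kernel of these functionals, the counit included, is [flag_ideal]. *)
pose Th (th : B -> k^o) := th = (fun b => counit (incl b)) \/
  exists2 Y, levi x Y & th = fun b => ev (incl b) (Y * E).
apply: (@separated_sum_seq _ _ _ _ _ O B _ _ Th).
- exact: tens_bilinear.
- move=> th [->|[Y _ ->]] c u v; first by rewrite !linearP.
  by rewrite linearP ev_linear.
- move=> a b hb.
  suff h2 : flag_relation (x := x) (a, b) (a, 0 : B).
    by rewrite (tens_respects h2) /= (linear_for0 ((tens_bilinear _).2 _)).
  split=> //=; rewrite subr0; split.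
    by apply: (hb (fun b => counit (incl b))); left.
  by move=> Y lY; apply: (hb (fun b => ev (incl b) (Y * E))); right; exists Y.
move=> th X [->|[Y lY ->]].
  apply: big1_seq => c /andP [_ /flattenP [_ /mapP [y _ ->] /mapP [c' _ ->]]] /=.
  by rewrite !linearB !linearZ /= rmorph1 counit1 ?scalerN !regular_scaleE mulr1 subrr mulr0.
rewrite evs ?counit_levi_E //.
suff -> : \sum_(y <- s) incl y.1 * (Y * E ▷ incl y.2) = 0 by rewrite ev0.
under eq_bigr do rewrite -left_actionA flag_mul_left_action //.
by rewrite -(linear_for_sum (left_action_linear _)) h (linear_for0 (left_action_linear _)).
Qed.
End FlagCalculus.

(** * Homogeneous forms *)

Section Bimodule.
Variables (k : fieldType) (A : algType k) (M : bimodule A).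
Implicit Types (a b : A) (w : M).

Lemma lactDr a w w' : lact a (w + w') = lact a w + lact a w'.
Proof. exact: (linear_forD ((lact_bilinear M).2 a)). Qed.
Lemma lactZl c a w : lact (c *: a) w = c *: lact a w.
Proof. exact: (linear_forZ ((lact_bilinear M).1 w)). Qed.
Lemma lact0r a : lact a (0 : M) = 0.
Proof. exact: (linear_for0 ((lact_bilinear M).2 a)). Qed.
Lemma lact_suml (I : Type) (r : seq I) (F : I -> A) w :
  lact (\sum_(i <- r) F i) w = \sum_(i <- r) lact (F i) w.
Proof. exact: (bilinear_suml (lact_bilinear M)). Qed.
Lemma lact_sumr (I : Type) (r : seq I) (F : I -> M) a :
  lact a (\sum_(i <- r) F i) = \sum_(i <- r) lact a (F i).
Proof. exact: (bilinear_sumr (lact_bilinear M)). Qed.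
Lemma ractDl a w w' : ract (w + w') a = ract w a + ract w' a.
Proof. exact: (linear_forD ((ract_bilinear M).1 a)). Qed.
Lemma ract0l a : ract (0 : M) a = 0.
Proof. exact: (linear_for0 ((ract_bilinear M).1 a)). Qed.
End Bimodule.

Section HomogeneousForms.
Variables (k : fieldType) (q : k) (l : nat) (g : simple_type l) (x : 'I_l).
Hypotheses (q0 : q != 0).
Variables (U : quantum_group q g) (O : coordinate_algebra U).
Variables (P : sphere_algebra O x) (B : flag_algebra O x) (V : fundamental_basis U x).
Variables (gr : int -> P -> Prop) (hgr : sphere_grading V B gr).
Local Notation u := (fund_rep V).
Local Notation "X ▷ a" := (left_action X a) (at level 45, right associativity).
Local Notation wt := (fund_wt q g x).
Local Notation I := 'I_((fund_dim V).+1).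
Variables (z zb z' : I -> P) (D : 'M[k]_((fund_dim V).+1)).
Hypotheses (hz : forall i, is_z i (z i)) (hzb : forall i, is_zbar i (zb i)).
Hypothesis hz' : forall i, z' i = \sum_j D i j *: z j.
Hypotheses (zbz : \sum_i zb i * z i = 1) (z'zb : \sum_i z' i * zb i = 1).
Variables (W : fodc P) (hW : HK_calculus V B W).
Local Notation d := (diff W).
Local Notation E := (uE U x).
Local Notation del p := (E ▷ incl p).

Let G := sg_grading hgr.
Let grz := gr_z hgr hz.
Let grzb := gr_zb hgr hzb.
Let grz' := gr_z' hgr hz hz'.

Lemma d_z i : d (z i) = 0.
Proof.
have [_ h _] := hW; apply: h; apply: generated_subalgebra_gen; exists i; exact: hz.
Qed.
Lemma d_z' i : d (z' i) = 0.
Proof. by rewrite hz' linear_sum big1 // => j _; rewrite linearZ /= d_z scaler0. Qed.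
Lemma d_mul_closed (a p : P) : d a = 0 -> d (a * p) = lact a (d p).
Proof. by move=> da; rewrite diffM da ract0l add0r. Qed.
Lemma d_mul_closedr (p a : P) : d a = 0 -> d (p * a) = ract (d p) a.
Proof. by move=> da; rewrite diffM da lact0r addr0. Qed.

Lemma del_mul_closed (a p : P) : del a = 0 -> del (a * p) = incl a * del p.
Proof. by move=> da; rewrite rmorphM left_actionE da mul0r add0r. Qed.

Lemma del_linear : linear (fun p : P => del p).
Proof. by move=> c p p'; rewrite linearP left_action_linear. Qed.

(* rep n w a says that the form w of degree n has image a under p dp' |-> p (E_x |> p'); that
   a depends on w only is rep_eq0. *)
Inductive rep (n : int) : W -> O -> Prop :=
| Rep0 : rep n 0 0
| RepD m m' (p p' : P) w a : gr m p -> gr m' p' -> m + m' = n -> rep n w a ->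
    rep n (lact p (d p') + w) (incl p * del p' + a).

Lemma rep_pure m m' n (p p' : P) : gr m p -> gr m' p' -> m + m' = n ->
  rep n (lact p (d p')) (incl p * del p').
Proof.
by move=> h h' e; have := RepD h h' e (Rep0 n); rewrite !addr0.
Qed.

Lemma rep_add n w a w' a' : rep n w a -> rep n w' a' -> rep n (w + w') (a + a').
Proof.
move=> r r'; elim: r => [|m m' p p' w1 a1 h h' e _ IH]; first by rewrite !add0r.
by rewrite -!addrA; apply: RepD h h' e IH.
Qed.

Lemma rep_sum n (J : Type) (r : seq J) (w : J -> W) (a : J -> O) :
  (forall i, rep n (w i) (a i)) -> rep n (\sum_(i <- r) w i) (\sum_(i <- r) a i).
Proof.
move=> h; elim: r => [|i r IH]; first by rewrite !big_nil; apply: Rep0.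
by rewrite !big_cons; apply: rep_add.
Qed.

Lemma rep_lact n e (p : P) w a : gr e p -> rep n w a -> rep (e + n) (lact p w) (incl p * a).
Proof.
move=> gp; elim=> [|m m' p1 p' w1 a1 h h' <- _ IH].
  by rewrite lact0r mulr0; apply: Rep0.
rewrite lactDr mulrDr -lactM mulrA -rmorphM; apply: RepD (gr_mul G gp h) h' _ IH.
by rewrite addrA.
Qed.

Lemma rep_scale n c w a : rep n w a -> rep n (c *: w) (c *: a).
Proof.
elim=> [|m m' p p' w1 a1 h h' e _ IH]; first by rewrite !scaler0; apply: Rep0.
rewrite !scalerDr -lactZl scalerAl -linearZ.
by apply: RepD h' e IH; apply: is_subspaceZ (gr_subspace G _) h.
Qed.

(** The factor z_i is absorbed into the differential since dz_i = 0. In E_x |> (p' z_i) the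
    coproduct of E_x leaves K_x on z_i, whence [wt x]. *)
Lemma rep_ract_z n i w a : rep n w a ->
  rep (n + 1) (ract w (z i)) (wt x *: (a * incl (z i))).
Proof.
elim=> [|m m' p p' w1 a1 h h' <- _ IH].
  by rewrite ract0l mul0r scaler0; apply: Rep0.
rewrite ractDl lract -d_mul_closedr ?d_z // mulrDl scalerDr -mulrA scalerAr.
suff -> : wt x *: (del p' * incl (z i)) = del (p' * z i).
  by apply: RepD h (gr_mul G h' (grz i)) _ IH; rewrite addrA.
by rewrite rmorphM left_actionE (z_K x (hz i)) (z_E x (hz i)) mulr0 addr0 -scalerAr.
Qed.

(** The image of a form of degree n has left weight alpha_x + n varpi_x; through this scalar the
    degree is remembered in O. *)
Lemma rep_K n w a j : rep n w a ->
  uK U j ▷ a = (q_ q g j ^ cartan g j x * wt j ^ n) *: a.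
Proof.
have wt0 := fund_wt_neq0 g x q0 j.
elim=> [|m m' p p' w1 a1 h h' <- _ IH].
  by rewrite scaler0 (linear_for0 (left_action_linear _)).
rewrite (linear_forD (left_action_linear _)) IH scalerDr; congr (_ + _).
have grK := gr_K q0 hgr hz hzb hz' zbz z'zb.
rewrite left_actionK (grK _ _ _ h) left_actionA KE.
rewrite (linear_forZ (left_action_linearU _)) -left_actionA.
rewrite (grK _ _ _ h') (linear_forZ (left_action_linear _)).
by rewrite -scalerAl -!scalerAr !scalerA expfzDr //; congr (_ *: _); ring.
Qed.

Lemma flag_to_sphere (b : B) : exists p : P, incl p = incl b.
Proof.
apply/inv_algP => Y lY; apply: flag_invariant.
apply: lY; first exact: generated_subalgebra_is_subalgebra.
move=> Z [j jx h]; apply: generated_subalgebra_gen.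
by case: h => ->; [left; exists j; left|left; exists j; right|
  right; exists j => //; left|right; exists j => //; right].
Qed.

Section Restriction.
Variables (j : B -> P) (hj : forall b, incl (j b) = incl b).

Definition flag_rep (w : W) (a : O) : Prop := exists s : seq (B * B),
  w = \sum_(y <- s) lact (j y.1) (d (j y.2)) /\ a = \sum_(y <- s) incl y.1 * (E ▷ incl y.2).

Lemma flag_rep_sum (J : Type) (r : seq J) (w : J -> W) (a : J -> O) :
  (forall i, flag_rep (w i) (a i)) -> flag_rep (\sum_(i <- r) w i) (\sum_(i <- r) a i).
Proof.
move=> h; elim: r => [|i r [s [hw ha]]]; first by exists [::]; rewrite !big_nil.
have [s' [hw' ha']] := h i; exists (s' ++ s).
by rewrite !big_cons hw ha hw' ha' !big_cat.
Qed.

Lemma gr0_flag p : gr 0 p -> exists b, j b = p.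
Proof.
move=> /(sg_zero hgr) [b hb]; exists b; apply: (@incl_inj _ _ P).
by rewrite hj.
Qed.

(** A positive degree of p' is lowered by inserting sum_i z'_i zbar_i = 1 inside the differential
    and pulling the closed z'_i out to the left. A negative one is raised by inserting sum_i zbar_i
    z_i = 1 before the differential and moving the closed z_i into it. The image in O follows the
    same steps, as E_x kills z_i and z'_i. *)
Lemma flag_rep_pure m (p p' : P) : gr (- m) p -> gr m p' ->
  flag_rep (lact p (d p')) (incl p * del p').
Proof.
have h0 (p1 p2 : P) : gr 0 p1 -> gr 0 p2 -> flag_rep (lact p1 (d p2)) (incl p1 * del p2).
  move=> /gr0_flag [b1 <-] /gr0_flag [b2 <-]; exists [:: (b1, b2)].
  by rewrite !big_seq1 /= !hj.
case: m => m; rewrite ?NegzE.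
  elim: m p p' => [|m IH] p p'; first by rewrite oppr0; apply: h0.
  move=> gp gp'.
  have -> : lact p (d p') = \sum_i lact (p * z' i) (d (zb i * p')).
    under eq_bigr do rewrite lactM -(d_mul_closed _ (d_z' _)).
    rewrite -lact_sumr -linear_sum /=; under eq_bigr do rewrite mulrA.
    by rewrite -mulr_suml z'zb mul1r.
  have -> : incl p * del p' = \sum_i incl (p * z' i) * del (zb i * p').
    under eq_bigr do rewrite rmorphM -mulrA -(del_mul_closed _ (z'_E hz hz' _ _)).
    rewrite -mulr_sumr -(linear_for_sum del_linear); under eq_bigr do rewrite mulrA.
    by rewrite -mulr_suml z'zb mul1r.
  apply: flag_rep_sum => i; apply: IH.
    have := gr_mul G gp (grz' i); rewrite -addn1 PoszD opprD addrNK; apply.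
  have := gr_mul G (grzb i) gp'; by rewrite -addn1 PoszD addrCA addNr addr0.
elim: {m}m.+1 p p' => [|m IH] p p'; first by rewrite oppr0; apply: h0.
move=> gp gp'.
have -> : lact p (d p') = \sum_i lact (p * zb i) (d (z i * p')).
  under eq_bigr do rewrite d_mul_closed ?d_z // -lactM -mulrA.
  by rewrite -lact_suml -mulr_sumr zbz mulr1.
have -> : incl p * del p' = \sum_i incl (p * zb i) * del (z i * p').
  under eq_bigr do rewrite del_mul_closed ?(z_E x (hz _)) // mulrA -rmorphM -mulrA.
  by rewrite -mulr_suml -linear_sum -mulr_sumr zbz mulr1.
apply: flag_rep_sum => i; apply: IH.
  have := gr_mul G gp (grzb i); by rewrite -addn1 PoszD !opprK addrK.
have := gr_mul G (grz i) gp'; by rewrite -addn1 PoszD opprD addrCA subrr addr0.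
Qed.

Lemma rep_flag w a : rep 0 w a -> flag_rep w a.
Proof.
elim=> [|m m' p p' w1 a1 h h' e _ [s [hw ha]]]; first by exists [::]; rewrite !big_nil.
have [|s' [hw' ha']] := @flag_rep_pure m' p p' _ h'.
  by have -> : - m' = m by apply/eqP; rewrite eq_sym -addr_eq0 e.
by exists (s' ++ s); rewrite !big_cat hw ha hw' ha'.
Qed.
End Restriction.

Lemma rep0_eq0 w a : rep 0 w a -> (w = 0 <-> a = 0).
Proof.
have /choice [j hj] := flag_to_sphere.
move=> /(rep_flag hj) [s [-> ->]].
by have [_ _ hres] := hW; apply: flag_calculusP.
Qed.

(** Left multiplication by the b_i takes w and its image to degree n, and left multiplication by the
    a_i recovers both. *)
Lemma rep_eq0_step (a b : I -> P) n e : (forall i, gr (- e) (b i)) ->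
  \sum_i a i * b i = 1 ->
  (forall w c, rep n w c -> (w = 0 <-> c = 0)) ->
  forall w c, rep (n + e) w c -> (w = 0 <-> c = 0).
Proof.
move=> gb ab IH w c r.
have rb i : rep n (lact (b i) w) (incl (b i) * c).
  by have := rep_lact (gb i) r; rewrite addrCA addNr addr0.
split=> h.
  have bc i : incl (b i) * c = 0 by apply: (IH _ _ (rb i)).1; rewrite h lact0r.
  have <- : incl (\sum_i a i * b i) * c = c by rewrite ab rmorph1 mul1r.
  rewrite linear_sum mulr_suml big1 // => i _.
  by rewrite /= rmorphM -mulrA bc mulr0.
have bw i : lact (b i) w = 0 by apply: (IH _ _ (rb i)).2; rewrite h mulr0.
rewrite -[w]lact1 -ab lact_suml big1 // => i _.
by rewrite lactM bw lact0r.
Qed.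

Lemma rep_eq0 n w a : rep n w a -> (w = 0 <-> a = 0).
Proof.
case: n => m; rewrite ?NegzE.
  elim: m w a => [|m IH] w a; first exact: rep0_eq0.
  rewrite -addn1 PoszD; apply: (rep_eq0_step (a := z') (b := zb)) => //.
elim: {m}m.+1 w a => [|m IH] w a; first exact: rep0_eq0.
rewrite -addn1 PoszD opprD; apply: (rep_eq0_step (a := zb) (b := z)) => //.
Qed.

(* The right U-action on forms given by left covariance. *)
Lemma rep_right_action X : exists R : W -> W, linear R /\
  forall n w a, rep n w a -> exists2 a', rep n (R w) a' & forall Y, ev a' Y = ev a (X * Y).
Proof.
have [[Dl hD] _ _] := hW.
(* Left covariance provides a map [Dl] into O ⊗ W; evaluating its first leg at X yields the
   action. *)
pose f (a : O) (w : W) := ev a X *: w.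
have bf : bilinear_map f.
  split=> [w|a] c v v'; rewrite /f; first by rewrite ev_linear scalerDl scalerA.
  by rewrite scalerDr !scalerA mulrC.
exists (fun w => tfold (Dl w) f); split.
  by move=> c w w'; rewrite linearP (tfold_linear bf).
move=> n w a; elim=> [|m m' p p' w1 a1 h h' e _ [a' r' ha']].
  exists 0; first by rewrite linear0 (linear_for0 (tfold_linear bf)); apply: Rep0.
  by move=> Y; rewrite !ev0.
have -> : tfold (Dl (lact p (d p') + w1)) f =
    \sum_(t <- repr (comul X)) lact (right_action p t.1) (d (right_action p' t.2)) +
    tfold (Dl w1) f.
  rewrite linearD (linear_forD (tfold_linear bf)) hD; congr (_ + _).
  rewrite [X in tfold X]tfoldE (tfold_sum bf).
  under eq_bigr do rewrite [X in tfold X]tfoldE (tfold_sum_pure bf).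
  rewrite /f; under eq_bigr do under eq_bigr do rewrite ev_mul tfoldE scaler_suml.
  under eq_bigr do rewrite exchange_big /=.
  rewrite exchange_big /=; apply: eq_bigr => t _.
  rewrite /right_action tfoldE lact_suml; apply: eq_bigr => c _.
  rewrite tfoldE linear_sum lact_sumr; apply: eq_bigr => c' _.
  by rewrite linearZ /= (linear_forZ ((lact_bilinear W).2 _)) lactZl scalerA mulrC.
exists (\sum_(t <- repr (comul X)) incl (right_action p t.1) * del (right_action p' t.2) + a').
  have grR := gr_right_action q0 hgr hz hzb hz' zbz z'zb.
  apply: rep_add r'; apply: rep_sum => t.
  by apply: rep_pure e; apply: grR.
move=> Y; rewrite !evD ha'; congr (_ + _).
rewrite ev_mulM tfoldE ev_sum; apply: eq_bigr => t _.
rewrite ev_mul !tfoldE; apply: eq_bigr => y _.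
by rewrite ev_right_action !ev_left_action ev_right_action mulrA.
Qed.
End HomogeneousForms.

(** * Relations between homogeneous forms *)

Section Eigenvectors.
Variables (k : fieldType) (A : algType k).
Hypothesis kcl : forall p : {poly k}, size p != 1%N -> exists a, root p a.
Variable J : A -> Prop.
Hypotheses (sJ : is_subspace J) (JM : forall X Y, J X -> J (X * Y)).

Lemma horner_alg_comm (S T : A) (p : {poly k}) :
  S * T = T * S -> S * horner_alg T p = horner_alg T p * S.
Proof.
move=> ST; elim/poly_ind: p => [|p c IH]; first by rewrite rmorph0 mulr0 mul0r.
rewrite rmorphD rmorphM /= horner_algX horner_algC mulrDr mulrDl mulrA IH.
by rewrite -(mulrA _ S T) ST mulrA -scalerAr -scalerAl mulr1 mul1r.
Qed.

(** Linear factors of p are split off one at a time until the remaining cofactor g has X g(T)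
    outside J; the factor removed last gives the eigenvalue. As the vector found is X times a
    polynomial in T, eigenvector conditions for operators commuting with T survive. *)
Lemma eigenvector_mod (X T : A) (p : {poly k}) : ~ J X -> p != 0 -> J (X * horner_alg T p) ->
  exists g kap, ~ J (X * horner_alg T g) /\
    J (X * horner_alg T g * T - kap *: (X * horner_alg T g)).
Proof.
move=> JX; have [n] := ubnP (size p); elim: n p => // n IH p /ltnSE le p0 Jp.
have sp1 : size p != 1%N.
  apply/negP => /size_poly1P [c c0 pc]; apply: JX.
  rewrite -[X](scalerK c0); apply: is_subspaceZ => //.
  by move: Jp; rewrite pc horner_algC -scalerAr mulr1.
have [kap /factor_theorem [p' pE]] := kcl sp1.
have p'0 : p' != 0 by apply: contraNneq p0 => p'0; rewrite pE p'0 mul0r.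
have [Jp'|Jp'] := pselect (J (X * horner_alg T p')).
  apply: (IH p' _ p'0 Jp'); apply: leq_trans le; rewrite pE size_Mmonic ?monicXsubC //.
  by rewrite size_XsubC addn2.
exists p', kap; split=> //; move: Jp; rewrite pE rmorphM rmorphB /= horner_algX horner_algC.
by rewrite mulrBr mulrBr mulrA -!scalerAr mulr1.
Qed.

Lemma joint_eigenvector_mod (X : A) (ops : seq A) : ~ J X ->
  (forall S T, S \in ops -> T \in ops -> S * T = T * S) ->
  (forall T, T \in ops -> exists2 p : {poly k}, p != 0 & forall Y, J (Y * horner_alg T p)) ->
  exists2 Y, ~ J Y & forall T, T \in ops -> exists kap, J (Y * T - kap *: Y).
Proof.
move=> JX; elim: ops => [|T ops IH] comm fin; first by exists X.
have [||Y JY hY] := IH.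
- by move=> S S' hS hS'; apply: comm; rewrite inE ?hS ?hS' orbT.
- by move=> T' hT; apply: fin; rewrite inE hT orbT.
have [p p0 Jp] := fin T (mem_head _ _).
have [g [kap [Jg eg]]] := eigenvector_mod JY p0 (Jp Y).
exists (Y * horner_alg T g) => // S; rewrite inE => /orP [/eqP ->|hS]; first by exists kap.
have [mu hmu] := hY S hS; exists mu.
have ST : S * T = T * S by apply: comm; rewrite inE ?eqxx ?hS ?orbT.
have -> : Y * horner_alg T g * S - mu *: (Y * horner_alg T g) =
    (Y * S - mu *: Y) * horner_alg T g.
  by rewrite mulrBl -scalerAl -!mulrA (horner_alg_comm _ ST).
exact: JM.
Qed.

(** Modulo J, p(T) acts on the eigenvector X as the scalar p(c), and X is not in J. *)
Lemma eigenvalue_root (X T : A) (p : {poly k}) c : ~ J X ->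
  J (X * horner_alg T p) -> J (X * T - c *: X) -> root p c.
Proof.
move=> JX Jp JT.
have /factor_theorem [p' e] : root (p - p.[c]%:P) c by rewrite /root !hornerE subrr.
apply/rootP/eqP/negPn/negP => pc0; apply: JX.
rewrite -[X](scalerK pc0); apply: is_subspaceZ => //.
have -> : p.[c] *: X = (-1) *: ((X * T - c *: X) * horner_alg T p') + X * horner_alg T p.
  have -> : p = p' * ('X - c%:P) + p.[c]%:P by rewrite -e subrK.
  rewrite !rmorphD rmorphM rmorphB /= horner_algX !horner_algC.
  rewrite !hornerE subrr mulr0 add0r.
  rewrite mulrDr -!scalerAr mulr1 scaleN1r.
  have -> : X * (horner_alg T p' * (T - c *: 1)) = (X * T - c *: X) * horner_alg T p'.
    rewrite mulrA mulrBr -scalerAr mulr1 mulrBl -scalerAl -[X * T * _]mulrA.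
    by rewrite (horner_alg_comm _ (erefl (T * T))) mulrA.
  by rewrite addrA addNr add0r.
by apply: sJ.2 => //; apply: JM.
Qed.
End Eigenvectors.

(** * Extremal vectors in locally finite modules *)

Section Extremal.
Variables (k : fieldType) (q : k) (l : nat) (g : simple_type l).
Hypotheses (q0 : q != 0) (qn1 : forall n, q ^+ n.+1 != 1).
Hypothesis kcl : forall p : {poly k}, size p != 1%N -> exists a, root p a.
Variable U : quantum_group q g.

Lemma q_expz_inj : injective (fun n : int => q ^ n).
Proof.
have h (n : int) : q ^ n = 1 -> n = 0.
  case: n => [[|n]|n] // /eqP; first by rewrite -exprnP (negPf (qn1 n)).
  by rewrite NegzE -exprnN invr_eq1 (negPf (qn1 n)).
move=> m n /= e; apply/eqP; rewrite -subr_eq0; apply/eqP/h.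
by rewrite expfzDr // e -expfzDr // subrr.
Qed.

Variable J : U -> Prop.
Hypotheses (sJ : is_subspace J) (JM : forall X Y, J X -> J (X * Y)) (J1 : ~ J 1).
Hypothesis Jfin : forall T : U, exists2 p : {poly k}, p != 0 & forall Y, J (Y * horner_alg T p).

(** U / J is a cyclic right module on which every element satisfies a polynomial equation. If no
    common eigenvector of the K_j were killed by all F_i, multiplying again and again by a suitable
    F_i would give the height element more eigenvalues, in geometric progression, than p has
    roots. *)
Lemma extremal_mod : exists (X : U) (kap : 'I_l -> k), [/\ ~ J X,
  forall i, J (X * uF U i) & forall j, J (X * uK U j - kap j *: X)].
Proof.
have [T [T' [N [N0 [tT TT' T'T TF]]]]] := torus_height q0 U.
have [p p0 Jp] := Jfin T.
pose good (X : U) c := [/\ ~ J X, exists kap : 'I_l -> k, forall j, J (X * uK U j - kap j *: X)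
  & J (X * T - c *: X)].
have [X0 [c0 good0]] : exists X c, good X c.
  have [| |X JX hX] := @joint_eigenvector_mod _ _ kcl J sJ JM 1 (T :: [seq uK U j | j : 'I_l]) J1.
  - have tor S : S \in T :: [seq uK U j | j : 'I_l] -> torus S.
      by rewrite inE => /orP [/eqP -> //|/mapP [j _ ->]]; apply: torusK.
    by move=> S S' /tor tS /tor tS'; apply: torus_comm.
  - by move=> S _; apply: Jfin.
  have [c hc] := hX T (mem_head _ _); exists X, c; split=> //.
  have /choice [kap hkap] : forall j, exists kap, J (X * uK U j - kap *: X).
    by move=> j; apply: hX; rewrite inE; apply/orP; right; apply: map_f; rewrite mem_enum.
  by exists kap.
have [//|none] := pselect (exists (X : U) (kap : 'I_l -> k), [/\ ~ J X,
  forall i, J (X * uF U i) & forall j, J (X * uK U j - kap j *: X)]).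
(* Multiplication by F_i scales the eigenvalue of T by q^N, the inverse of [th], so the eigenvalues
   passed before c are the c th^m. *)
pose th := q ^- N.
have chain n : exists X c, good X c /\ forall m, (m <= n)%N -> root p (c * th ^+ m).
  elim: n => [|n [X [c [[JX [kap hkap] hc] hr]]]].
    exists X0, c0; split=> // m; rewrite leqn0 => /eqP ->; rewrite expr0 mulr1.
    by case: good0 => JX _ hc; apply: eigenvalue_root (Jp X0) hc.
  have [i Ji] : exists i, ~ J (X * uF U i).
    apply: contrapT => hN; apply: none; exists X, kap; split=> // i.
    by apply: contrapT => h; apply: hN; exists i.
  have th0 : th != 0 by rewrite invr_eq0 expf_neq0.
  have JXF c' (S : U) e : e != 0 -> S * uF U i = e *: (uF U i * S) -> J (X * S - c' *: X) ->
      J (X * uF U i * S - (e^-1 * c') *: (X * uF U i)).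
    move=> e0 SF hS.
    have -> : X * uF U i * S - (e^-1 * c') *: (X * uF U i) =
        e^-1 *: ((X * S - c' *: X) * uF U i).
      rewrite mulrBl -mulrA -(mulrA X S) SF -scalerAr scalerBr scalerA mulVf // scale1r.
      by rewrite -scalerAl scalerA.
    by apply: is_subspaceZ => //; apply: JM.
  exists (X * uF U i), (th^-1 * c); split.
    split=> //; last by apply: JXF.
    exists (fun j => (q_ q g j ^ cartan g j i)^-1^-1 * kap j) => j.
    by apply: JXF (KF _ _ _) _ => //; rewrite invr_eq0 qa_neq0.
  move=> [|m] lm.
    rewrite expr0 mulr1; apply: (eigenvalue_root sJ JM Ji (Jp _)).
    exact: JXF.
  by rewrite exprS mulrA -(mulrA th^-1) (mulrC c) mulrA mulVf // mul1r; apply: hr.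
have [X [c [[JX _ hc] hr]]] := chain (size p).
(* T is invertible, so an eigenvector outside J cannot have eigenvalue 0. *)
have c_neq0 : c != 0.
  apply/eqP => c_0; apply: JX; move: hc; rewrite c_0 scale0r subr0 => /(JM T').
  by rewrite -mulrA TT' mulr1.
(* These are [(size p).+1] distinct roots, as q is not a root of unity. *)
pose rs := [seq c * th ^+ m | m <- iota 0 (size p).+1].
have : (size rs < size p)%N.
  apply: max_poly_roots => //.
    by apply/allP => r /mapP [m]; rewrite mem_iota add0n ltnS => /andP [_ lm] ->; apply: hr.
  rewrite map_inj_uniq ?iota_uniq // => m m' /(mulfI c_neq0).
  rewrite /th !exprVn => /invr_inj; rewrite -!exprM !exprnP => /q_expz_inj [] /eqP.
  by rewrite eqn_pmul2l // => /eqP.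
by rewrite size_map size_iota ltnNge leqnSn.
Qed.
End Extremal.

Section FiniteCodimension.
Variables (k : fieldType) (q : k) (l : nat) (g : simple_type l).
Variables (U : quantum_group q g) (O : coordinate_algebra U).

Lemma horner_alg_morph (A B : algType k) (f : {lrmorphism A -> B}) (T : A) (p : {poly k}) :
  f (horner_alg T p) = horner_alg (f T) p.
Proof.
elim/poly_ind: p => [|p c IH]; first by rewrite !rmorph0.
by rewrite !rmorphD !rmorphM /= !horner_algX !horner_algC IH linearZ /= rmorph1.
Qed.

Lemma horner_alg_mx n (T : 'M[k]_n.+1) (p : {poly k}) : horner_alg T p = horner_mx T p.
Proof.
elim/poly_ind: p => [|p c IH]; first by rewrite !rmorph0.
rewrite !rmorphD !rmorphM /= horner_algX horner_algC horner_mx_X horner_mx_C IH.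
by rewrite scalemx1.
Qed.

(** Local finiteness enters in this form. By Cayley-Hamilton a matrix coefficient is annihilated by
    the characteristic polynomial of its representation at T; the product of these polynomials
    serves for the finite sum a. *)
Lemma ev_annihilated (a : O) (T : U) : exists2 p : {poly k}, p != 0 &
  forall X Y, ev a (X * horner_alg T p * Y) = 0.
Proof.
have [n [c [c_ [hc evE]]]] : in_span_of_coefficients (ev a) by apply/ev_image; exists a.
have /choice [p hp] : forall i, exists p : {poly k}, p != 0 /\
    forall X Y, c_ i (X * horner_alg T p * Y) = 0.
  move=> i; have [lam [m [r [v [_ [f [w h]]]]]]] := hc i.
  exists (char_poly (r T)); split; first by rewrite monic_neq0 // char_poly_monic.
  move=> X Y; rewrite h !rmorphM /= horner_alg_morph.
  have -> : horner_alg (r T) (char_poly (r T)) = 0 by rewrite horner_alg_mx Cayley_Hamilton.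
  by rewrite mulr0 mul0r mulmx0 mul0mx mxE.
exists (\prod_i p i); first by apply/prodf_neq0 => i _; case: (hp i).
move=> X Y; rewrite evE big1 // => i _.
have -> : \prod_j p j = (\prod_(j | j != i) p j) * p i by rewrite (bigD1 i) //= mulrC.
rewrite rmorphM /= mulrA.
by case: (hp i) => _ ->; rewrite mulr0.
Qed.

Lemma ev_annihilated_seq (J : eqType) (s : seq J) (a : J -> O) (T : U) :
  exists2 p : {poly k}, p != 0 &
    forall j X Y, j \in s -> ev (a j) (X * horner_alg T p * Y) = 0.
Proof.
elim: s => [|j s [p p0 hp]]; first by exists 1; rewrite ?oner_neq0.
have [p' p'0 hp'] := ev_annihilated (a j) T.
exists (p * p') => [|i X Y]; first by rewrite mulf_neq0.
rewrite inE rmorphM /= => /orP [/eqP ->|hi].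
  by rewrite mulrA hp'.
by rewrite mulrA -mulrA hp.
Qed.
End FiniteCodimension.

(** * Commutation with the highest weight coefficient *)

Section ExtremalCommutation.
Variables (k : fieldType) (q : k) (l : nat) (g : simple_type l) (x : 'I_l).
Hypotheses (q0 : q != 0) (qn1 : forall n, q ^+ n.+1 != 1).
Variables (U : quantum_group q g) (O : coordinate_algebra U).
Local Notation "X ▷ a" := (left_action X a) (at level 45, right associativity).
Local Notation wt := (fund_wt q g x).
Local Notation E := (uE U).
Local Notation F := (uF U).
Local Notation K := (uK U).
Local Notation qa i j := (q_ q g i ^ cartan g i j).
Variable zN : O.
Hypotheses (zE : forall i, E i ▷ zN = 0) (zK : forall i, K i ▷ zN = wt i *: zN).
Hypothesis z1 : ev zN 1 = 1.

Section Element.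
Variables (a : O) (kap : 'I_l -> k).
Hypotheses (aF : forall i X, ev a (F i * X) = 0) (aK : forall i X, ev a (K i * X) = kap i * ev a X).

Lemma extremal_eq0 (b : O) (mu : 'I_l -> k) : (forall i X, ev b (F i * X) = 0) ->
  (forall i X, ev b (K i * X) = mu i * ev b X) ->
  (forall e, ev b (Ew U e) = 0) -> b = 0.
Proof.
move=> bF bK bE; apply: ev_inj => X; rewrite ev0.
exact: (@lowest_functional_eq0 _ _ _ _ q0 U (ev b) mu (ev_linearU b)).
Qed.

Lemma ev_mul1 (b c : O) : ev (b * c) 1 = ev b 1 * ev c 1.
Proof. by rewrite ev_mul comul1 (tfold_pure (bilinear_ev2 b c)). Qed.

Lemma ev_Ew_rcons (b : O) e i : ev b (Ew U (rcons e i)) = ev (E i ▷ b) (Ew U e).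
Proof. by rewrite ev_left_action /Ew -cats1 big_cat big_seq1. Qed.

(** As E_i has coproduct E_i ⊗ K_i + 1 ⊗ E_i and kills [zN], each letter of the word falls on b and
    leaves K_i on [zN]. In the opposite order, in [ev_zN_mul], the letters fall on b and no scalar
    appears. *)
Lemma ev_mul_zN (b : O) e :
  ev (b * zN) (Ew U e) = (\prod_(i <- e) wt i) * ev b (Ew U e).
Proof.
elim/last_ind: e b => [|e i IH] b.
  by rewrite /Ew !big_nil ev_mul1 z1 mulr1 mul1r.
rewrite !ev_Ew_rcons left_actionE zE mulr0 addr0 zK -scalerAr evZ IH.
by rewrite -cats1 big_cat big_seq1 /= mulrA (mulrC (wt i)).
Qed.

Lemma ev_zN_mul (b : O) e : ev (zN * b) (Ew U e) = ev b (Ew U e).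
Proof.
elim/last_ind: e b => [|e i IH] b.
  by rewrite /Ew !big_nil ev_mul1 z1 mul1r.
by rewrite !ev_Ew_rcons left_actionE zE mul0r add0r IH.
Qed.

Lemma ev_mul_F (b c : O) i X : (forall i X, ev b (F i * X) = 0) ->
  (forall i X, ev c (F i * X) = 0) -> ev (b * c) (F i * X) = 0.
Proof.
move=> bF cF; rewrite ev_mulM comul_F.
have bl : bilinear_map (fun X1 X2 : U =>
    \tsum_(Y1, Y2 <- comul X) (ev b (X1 * Y1) * ev c (X2 * Y2) : k^o)).
  split=> [n|m] d X1 X2; rewrite !tfoldE scaler_sumr -big_split /=; apply: eq_bigr => y _.
    by rewrite mulrDl -scalerAl ev_linearU !regular_scaleE mulrDl mulrA.
  by rewrite mulrDl -scalerAl ev_linearU !regular_scaleE mulrDr mulrCA.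
rewrite (linear_forD (tfold_linear bl)) !(tfold_pure bl) !tfoldE.
by rewrite !big1 ?addr0 // => y _; rewrite ?bF ?cF ?mul0r ?mulr0.
Qed.

Lemma ev_mul_K (b c : O) i X mb mc : (forall X, ev b (K i * X) = mb * ev b X) ->
  (forall X, ev c (K i * X) = mc * ev c X) -> ev (b * c) (K i * X) = (mb * mc) * ev (b * c) X.
Proof.
move=> bK cK; rewrite ev_mulM comul_K.
have bl : bilinear_map (fun X1 X2 : U =>
    \tsum_(Y1, Y2 <- comul X) (ev b (X1 * Y1) * ev c (X2 * Y2) : k^o)).
  split=> [n|m] d X1 X2; rewrite !tfoldE scaler_sumr -big_split /=; apply: eq_bigr => y _.
    by rewrite mulrDl -scalerAl ev_linearU !regular_scaleE mulrDl mulrA.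
  by rewrite mulrDl -scalerAl ev_linearU !regular_scaleE mulrDr mulrCA.
rewrite (tfold_pure bl) ev_mul !tfoldE mulr_sumr; apply: eq_bigr => y _.
by rewrite bK cK mulrACA.
Qed.

(** Left multiplication by [zN] does not change the values on E-words, and these determine an
    extremal element. *)
Lemma zN_mul_eq0 : zN * a = 0 -> a = 0.
Proof.
move=> za; apply: (extremal_eq0 aF aK) => e.
by rewrite -ev_zN_mul za ev0.
Qed.

Variable n : int.
Hypothesis aKr : forall j, K j ▷ a = (qa j x * wt j ^ n) *: a.

(** This is (alpha_j, beta + alpha_x + m varpi_x), where beta is the sum of the alpha_i over the
    letters of e: the left weight attached to degree m, raised by the content of e. *)
Definition wt_exponent (m : int) (e : seq 'I_l) (j : 'I_l) : int :=
  \sum_(i <- e) (half_len g j)%:Z * cartan g j i +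
  ((half_len g j)%:Z * cartan g j x + (half_len g j)%:Z * (j == x) * m).

Lemma K_Ew j e : K j * Ew U e =
  q ^ (\sum_(i <- e) (half_len g j)%:Z * cartan g j i) *: (Ew U e * K j).
Proof.
rewrite /Ew; elim: e => [|i e IH]; first by rewrite !big_nil expr0z scale1r mul1r mulr1.
rewrite !big_cons mulrA KE -scalerAl -(mulrA (E i) (K j)) IH -scalerAr scalerA mulrA expfzDr //.
by rewrite -exprz_exp.
Qed.

(** The value of a at K_j times the word e is computed from the right weight [kap] and, with K_j
    moved behind the word, from the left weight given by n. *)
Lemma extremal_exponent e j : ev a (Ew U e) != 0 -> kap j = q ^ wt_exponent n e j.
Proof.
move=> ae; apply: (mulIf ae); rewrite -aK K_Ew evrZ -ev_left_action aKr evZ mulrA.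
congr (_ * _); rewrite /wt_exponent !expfzDr //; congr (_ * _).
congr (_ * _); first by rewrite -exprz_exp.
by rewrite -exprz_exp /fund_wt exprnP PoszM.
Qed.

End Element.
End ExtremalCommutation.

(** * Reading the degree off the weight *)

Section ExponentInjectivity.
Variables (l : nat) (g : simple_type l) (x : 'I_l).

Lemma sum_count (R : nmodType) (e : seq 'I_l) (f : 'I_l -> R) :
  \sum_(i <- e) f i = \sum_i f i *+ count_mem i e.
Proof.
elim: e => [|i e IH]; first by rewrite big_nil big1.
rewrite big_cons IH /=; under [RHS]eq_bigr do rewrite mulrnDr.
rewrite big_split /=; congr (_ + _).
rewrite (bigD1 i) //= eqxx mulr1n big1 ?addr0 // => j ji.
by rewrite eq_sym (negPf ji).
Qed.

(* As the Cartan form is positive definite, the difference v of the contents of e and e',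
   for which (A v)_j = - d_x (m - m') delta_jx, vanishes as soon as v_x = 0 or m = m'. *)
Lemma wt_exponent_inj m m' e e' : (forall j, wt_exponent g x m e j = wt_exponent g x m' e' j) ->
  (m == m') = (count_mem x e == count_mem x e').
Proof.
move=> h.
pose v (i : 'I_l) : rat := (count_mem i e)%:R - (count_mem i e')%:R.
have Avz j : \sum_i (half_len g j)%:Z * cartan g j i * ((count_mem i e)%:Z - (count_mem i e')%:Z) =
    - ((half_len g j)%:Z * (j == x)%:Z * (m - m')).
  have cnt (e0 : seq 'I_l) : \sum_i (half_len g j)%:Z * cartan g j i * (count_mem i e0)%:Z =
      \sum_(i <- e0) (half_len g j)%:Z * cartan g j i.
    by rewrite [RHS]sum_count; apply: eq_bigr => i _; rewrite -mulr_natr natz.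
  under eq_bigr do rewrite mulrBr.
  rewrite sumrB !cnt; apply/eqP; rewrite -subr_eq0 opprK; apply/eqP.
  have := h j; rewrite /wt_exponent => /eqP; rewrite -subr_eq0 => /eqP h'.
  by rewrite -[RHS]h'; ring.
have castS (f : 'I_l -> int) : (\sum_i f i)%:~R = \sum_i (f i)%:~R :> rat.
  exact: (big_morph (fun n : int => n%:~R : rat) (intrD _) (mulr0z 1)).
have Av j : \sum_i (half_len g j)%:R * (cartan g j i)%:~R * v i =
    - ((half_len g j)%:R * (j == x)%:R * (m - m')%:~R).
  have := congr1 (fun n : int => n%:~R : rat) (Avz j).
  rewrite /= castS mulrNz !intrM => <-; apply: eq_bigr => i _.
  by rewrite !intrM intrB.
have form : \sum_i \sum_j (half_len g i)%:R * (cartan g i j)%:~R * v i * v j =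
    - ((half_len g x)%:R * (m - m')%:~R * v x).
  transitivity (\sum_i v i * - ((half_len g i)%:R * (i == x)%:R * (m - m')%:~R)).
    apply: eq_bigr => i _; rewrite -Av mulr_sumr; apply: eq_bigr => j _; ring.
  rewrite (bigD1 x) //= eqxx mulr1 big1 ?addr0; last first.
    by move=> i /negPf ->; rewrite mulr0 mul0r oppr0 mulr0.
  ring.
have vx : (v x == 0) = (count_mem x e == count_mem x e').
  by rewrite subr_eq0 eqr_nat.
rewrite -vx; apply/eqP/eqP => h0.
  by apply: (@cartan_form_eq0 _ g v); rewrite form h0 subrr mulr0 mul0r oppr0.
have v0 : forall i, v i = 0.
  by apply: (@cartan_form_eq0 _ g v); rewrite form h0 mulr0 oppr0.
have := Av x; rewrite big1; last by move=> i _; rewrite v0 mulr0.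
move/eqP; rewrite eq_sym oppr_eq0 !mulf_eq0 eqxx oner_eq0 orbF pnatr_eq0.
by rewrite eqn0Ngt half_len_gt0 /= intr_eq0 subr_eq0 => /eqP.
Qed.
End ExponentInjectivity.

(** * Independence of forms of different degrees *)

Section Directness.
Variables (k : fieldType) (q : k) (l : nat) (g : simple_type l) (x : 'I_l).
Hypotheses (q0 : q != 0) (qn1 : forall n, q ^+ n.+1 != 1).
Hypothesis kcl : forall p : {poly k}, size p != 1%N -> exists a, root p a.
Variables (U : quantum_group q g) (O : coordinate_algebra U).
Variables (P : sphere_algebra O x) (B : flag_algebra O x) (V : fundamental_basis U x).
Variables (gr : int -> P -> Prop) (hgr : sphere_grading V B gr).
Local Notation wt := (fund_wt q g x).
Local Notation I := 'I_((fund_dim V).+1).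
Variables (z zb z' : I -> P) (D : 'M[k]_((fund_dim V).+1)).
Hypotheses (hz : forall i, is_z i (z i)) (hzb : forall i, is_zbar i (zb i)).
Hypothesis hz' : forall i, z' i = \sum_j D i j *: z j.
Hypotheses (zbz : \sum_i zb i * z i = 1) (z'zb : \sum_i z' i * zb i = 1).
Variables (W : fodc P) (hW : HK_calculus V B W).
Local Notation repW := (rep gr (W := W)).

Let zN := z ord_max.
Let c := incl zN.

(** Words on which a does not vanish have equal exponents, hence by [wt_exponent_inj] equally many
    letters x; this number is t. The difference of the two sides is again extremal, and it vanishes
    on all E-words. *)
Lemma extremal_mul_zN n w (a : O) (kap : 'I_l -> k) : repW n w a ->
  (forall i X, ev a (uF U i * X) = 0) -> (forall i X, ev a (uK U i * X) = kap i * ev a X) ->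
  exists t : nat, a * c = wt x ^+ t *: (c * a) /\
    (a != 0 -> exists2 e, t = count_mem x e & forall j, kap j = q ^ wt_exponent g x n e j).
Proof.
move=> r aF aK.
have cF i X : ev c (uF U i * X) = 0 by apply: zN_F => //; apply: hz.
have cK i X : ev c (uK U i * X) = wt i * ev c X by apply: zN_Kl; apply: hz.
have cE i : left_action (uE U i) c = 0 by apply: (z_E _ (hz _)).
have cKr i : left_action (uK U i) c = wt i *: c by apply: (z_K _ (hz _)).
have c1 : ev c 1 = 1 by apply: zN_1; apply: hz.
have aKr j := rep_K q0 hgr hz hzb hz' zbz z'zb j r.
have [a0|a0] := eqVneq a 0.
  by exists 0%N; rewrite a0 mul0r mulr0 scaler0; split.
have [e ae] : exists e, ev a (Ew U e) != 0.
  apply: contrapT => hN; move/eqP: a0; apply; apply: (extremal_eq0 q0 aF aK) => e.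
  by apply/eqP/negPn/negP => he; apply: hN; exists e.
exists (count_mem x e); split; last first.
  by move=> _; exists e => // j; apply: (extremal_exponent q0 aK aKr).
apply/eqP; rewrite -subr_eq0; apply/eqP.
apply: (@extremal_eq0 _ _ _ _ q0 U O _ (fun j => kap j * wt j)).
- by move=> i X; rewrite evB evZ !ev_mul_F // mulr0 subrr.
- move=> i X; rewrite evB evZ (ev_mul_K X (aK i) (cK i)) (ev_mul_K X (cK i) (aK i)).
  by rewrite (mulrC (wt i)) evB evZ mulrBr mulrCA.
move=> e'; rewrite evB evZ (ev_mul_zN cE cKr c1) (ev_zN_mul cE c1).
have [->|ae'] := eqVneq (ev a (Ew U e')) 0; first by rewrite !mulr0 subrr.
have kk j : wt_exponent g x n e j = wt_exponent g x n e' j.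
  apply: (q_expz_inj q0 qn1).
  by rewrite /= -(extremal_exponent q0 aK aKr j ae) -(extremal_exponent q0 aK aKr j ae').
have := wt_exponent_inj kk; rewrite eqxx => /esym /eqP ->.
suff -> : \prod_(i <- e') wt i = wt x ^+ count_mem x e' by rewrite subrr.
elim: e' {ae' kk} => [|i e' IH]; first by rewrite big_nil.
rewrite big_cons IH /= exprD; congr (_ * _).
by have [->|ix] := eqVneq i x; rewrite ?expr1 // expr0 fund_wt1.
Qed.

Lemma wtx_exp_inj m n : wt x ^+ m = wt x ^+ n -> m = n.
Proof.
rewrite /fund_wt eqxx muln1 -!exprM !exprnP => /(q_expz_inj q0 qn1) [] /eqP.
by rewrite eqn_pmul2l ?half_len_gt0 // => /eqP.
Qed.

(** A nontrivial relation is turned into one with extremal images, the [w']. The induction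
    hypothesis for a combination without the term of degree n0 forces all other [w'] to vanish; the
    relation then forces the last one to vanish as well, against the choice of n0. *)
Lemma rep_direct (s : seq int) (w : int -> W) (a : int -> O) : uniq s ->
  (forall n, repW n (w n) (a n)) -> \sum_(n <- s) w n = 0 -> forall n, n \in s -> w n = 0.
Proof.
have rep0 := rep_eq0 hgr hz hzb hz' zbz z'zb hW.
have [m] := ubnP (size s); elim: m s w a => // m IH s w a /ltnSE le us r sw n ns.
apply: contrapT => wn.
(* The right ideal of the X annihilating all a_i simultaneously, i in s; a single X0 thus makes all
   images extremal with one common right weight. *)
pose J X := forall i Y, i \in s -> ev (a i) (X * Y) = 0.
have sJ : is_subspace J.
  split=> [i Y _|d X1 X2 h1 h2 i Y hi]; first by rewrite mul0r evr0.
  by rewrite mulrDl -scalerAl evrD evrZ h1 // h2 // mulr0 addr0.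
have JM X Y : J X -> J (X * Y) by move=> h i Z hi; rewrite -mulrA h.
have J1 : ~ J 1.
  move=> h; apply: wn; apply/(rep0 _ _ _ (r n)); apply: ev_inj => Y.
  by rewrite ev0 -(h n Y ns) mul1r.
have Jfin (T : U) : exists2 p : {poly k}, p != 0 & forall Y, J (Y * horner_alg T p).
  have [p p0 hp] := ev_annihilated_seq s a T; exists p => // Y i Z hi.
  exact: hp.
have [X0 [kap [JX JF JK]]] := extremal_mod q0 qn1 kcl sJ JM J1 Jfin.
have [Rt [lR hR]] := rep_right_action q0 hgr hz hzb hz' zbz z'zb hW X0.
have /choice [a' ha'] : forall i, exists a', repW i (Rt (w i)) a' /\
    forall Y, ev a' Y = ev (a i) (X0 * Y).
  by move=> i; have [a' h1 h2] := hR _ _ _ (r i); exists a'.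
pose w' i := Rt (w i).
have r' i : repW i (w' i) (a' i) by case: (ha' i).
have sw' : \sum_(i <- s) w' i = 0.
  by rewrite -(linear_for_sum lR) sw (linear_for0 lR).
have aF i j X : i \in s -> ev (a' i) (uF U j * X) = 0.
  by move=> hi; case: (ha' i) => _ ->; rewrite mulrA; apply: JF.
have aK i j X : i \in s -> ev (a' i) (uK U j * X) = kap j * ev (a' i) X.
  move=> hi; case: (ha' i) => _ h; rewrite !h mulrA; apply/eqP; rewrite -subr_eq0.
  have := JK j i X hi; rewrite mulrBl -scalerAl => e.
  by rewrite -evrZ -(linear_forB (ev_linearU (a i))) e.
have [n0 n0s an0] : exists2 n0, n0 \in s & a' n0 != 0.
  apply: contrapT => hN; apply: JX => i Y hi; case: (ha' i) => _ <-.
  suff -> : a' i = 0 by rewrite ev0.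
  by apply/eqP/negPn/negP => h; apply: hN; exists i.
have [t0 [comm0 exp0]] := extremal_mul_zN (r' n0) (fun j X => aF n0 j X n0s)
  (fun j X => aK n0 j X n0s).
have [e0 t0E kap0] := exp0 an0.
(* One factor is the twist in [rep_ract_z], the other the commutation factor of the image in degree
   n0; with this scalar the term coming from n0 cancels. *)
pose mu := wt x * wt x ^+ t0.
(* Both products with z_N raise the degree by one, so [w2] is indexed by the new degree. *)
pose w2 (i : int) := ract (w' (i - 1)) zN + (- mu) *: lact zN (w' (i - 1)).
pose a2 (i : int) := wt x *: (a' (i - 1) * c) + (- mu) *: (c * a' (i - 1)).
have r2 i : repW i (w2 i) (a2 i).
  have ri := r' (i - 1).
  apply: rep_add.
    by have := rep_ract_z hgr hz hW ord_max ri; rewrite subrK.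
  apply: (rep_scale hgr).
  have := rep_lact hgr (gr_z hgr hz ord_max) ri.
  by rewrite addrC subrK.
have w2n0 : w2 (n0 + 1) = 0.
  apply/(rep0 _ _ _ (r2 _)); rewrite /a2 addrK comm0 scalerA -/mu -scalerDl subrr.
  by rewrite scale0r.
have sw2 : \sum_(i <- [seq i + 1 | i <- rem n0 s]) w2 i = 0.
  rewrite big_map.
  have : \sum_(i <- s) w2 (i + 1) = 0.
    rewrite /w2; under eq_bigr do rewrite addrK.
    rewrite big_split /= -scaler_sumr -(linear_for_sum ((ract_bilinear W).1 zN)).
    by rewrite -lact_sumr sw' ract0l lact0r scaler0 addr0.
  by rewrite (perm_big _ (perm_to_rem n0s)) big_cons w2n0 /= add0r.
have us' : uniq (rem n0 s) by apply: rem_uniq.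
have w20 i : i \in rem n0 s -> w2 (i + 1) = 0.
  move=> hi; apply: (IH [seq i + 1 | i <- rem n0 s] w2 a2) => //.
  - rewrite size_map size_rem // (leq_trans _ le) // prednK //.
    by case: (s) n0s.
  - by rewrite map_inj_uniq //; apply: addIr.
  - exact: map_f.
have a'0 i : i \in rem n0 s -> a' i = 0.
  rewrite mem_rem_uniq // !inE => /andP [in0 his].
  have [t [commi expi]] := extremal_mul_zN (r' i) (fun j X => aF i j X his)
    (fun j X => aK i j X his).
  apply/eqP/negPn/negP => ai0; have [e tE kapi] := expi ai0.
  have ti : t != t0.
    rewrite tE t0E -(wt_exponent_inj (g := g) (m := i) (m' := n0)) // => j.
    by apply: (q_expz_inj q0 qn1); rewrite /= -kapi -kap0.
  have : a2 (i + 1) = 0.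
    by apply/(rep0 _ _ _ (r2 _)); apply: w20; rewrite mem_rem_uniq // !inE in0.
  (* The image is [wt x] times ([wt x ^+ t] - [wt x ^+ t0]) times c a'_i. Since t differs from t0,
     only c a'_i can vanish, and c cancels from extremal elements. *)
  rewrite /a2 addrK commi scalerA -scalerDl /mu -mulrBr => /eqP.
  rewrite scaler_eq0 mulf_eq0 (negPf (fund_wt_neq0 g x q0 x)) /= subr_eq0 => /orP [/eqP|/eqP ca].
    by move/wtx_exp_inj/eqP; apply/negP.
  move/eqP: ai0; apply.
  apply: (zN_mul_eq0 q0 (zN := c)) ca.
  - by move=> j; apply: (z_E _ (hz _)).
  - by apply: zN_1; apply: hz.
  - by move=> j X; apply: aF.
  - by move=> j X; apply: aK.
have w'0 i : i \in rem n0 s -> w' i = 0 by move=> hi; apply/(rep0 _ _ _ (r' i)); apply: a'0.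
move/eqP: an0; apply; apply/(rep0 _ _ _ (r' n0)).
move: sw'; rewrite (perm_big _ (perm_to_rem n0s)) big_cons => <-.
by rewrite big_seq big1 /= ?addr0 // => i; apply: w'0.
Qed.
End Directness.

(** * Bundles from strong gradings *)

Lemma big_group (V : nmodType) (J : Type) (I : eqType) (T : seq J) (S : seq I) (deg : J -> I)
    (F : J -> V) : uniq S -> all (fun x => deg x \in S) T ->
  \sum_(x <- T) F x = \sum_(n <- S) \sum_(x <- T | deg x == n) F x.
Proof.
move=> uS; elim: T => [|x T IH] /=.
  by rewrite big_nil big1 // => n _; rewrite big_nil.
case/andP => xS TS; rewrite big_cons (IH TS).
under [RHS]eq_bigr do rewrite big_cons.
rewrite (bigD1_seq _ xS uS) /= [RHS](bigD1_seq _ xS uS) /= eqxx addrA; congr (_ + _).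
by apply: eq_bigr => n nx; rewrite eq_sym (negPf nx).
Qed.

(** * The Hopf algebra of Laurent polynomials *)

Section LaurentHopf.
Variables (k : fieldType) (H : laurent_hopf k).
Local Notation t := (lt H).
Local Notation tV := (ltV H).
Local Notation gl := (lt_pow H).

Lemma lt_pow_lt n : gl (n + 1) = gl n * t.
Proof.
case: n => n; first by rewrite -PoszD addn1 /= exprSr.
rewrite NegzE -addn1 PoszD opprD addrNK.
have -> : gl (- (n%:Z) - 1) = tV ^+ n.+1 by rewrite -opprD -PoszD addn1 -NegzE.
rewrite exprSr -mulrA ltV_lt mulr1.
by case: n => [|n]; rewrite ?oppr0 // -NegzE.
Qed.

Lemma lt_pow_ltV n : gl (n - 1) = gl n * tV.
Proof. by rewrite -{2}[n](subrK 1) lt_pow_lt -mulrA lt_ltV mulr1. Qed.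

Lemma lt_pow0 : gl 0 = 1. Proof. by []. Qed.

Lemma lt_powD m n : gl (m + n) = gl m * gl n.
Proof.
elim/int_rec: n => [|n IH|n IH]; first by rewrite addr0 lt_pow0 mulr1.
  by rewrite -addn1 PoszD addrA !lt_pow_lt IH mulrA.
by rewrite -addn1 PoszD opprD addrA !lt_pow_ltV IH mulrA.
Qed.

Lemma bilinear_tensor_mulr (A B : algType k) (a : A) (b : B) :
  bilinear_map (fun a' b' => (a' * a) ⊗ (b' * b)).
Proof.
by split=> [n|m] c u v; rewrite mulrDl -scalerAl ?(tens_bilinear _).1 ?(tens_bilinear _).2.
Qed.

Lemma bilinear_tensor_mull (A B : algType k) (a : A) (b : B) :
  bilinear_map (fun a' b' => (a * a') ⊗ (b * b')).
Proof.
by split=> [n|m] c u v; rewrite mulrDr -scalerAr ?(tens_bilinear _).1 ?(tens_bilinear _).2.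
Qed.

Lemma tensor_mul_purer (A B : algType k) (s : A ⊗ B) a b :
  tensor_mul s (a ⊗ b) = \tsum_(a', b' <- s) ((a' * a) ⊗ (b' * b)).
Proof.
rewrite /tensor_mul !tfoldE; apply: eq_bigr => x _.
by rewrite (tfold_pure (bilinear_tensor_mull _ _)).
Qed.

Lemma tensor_mul_pure (A B : algType k) (a a' : A) (b b' : B) :
  tensor_mul (a ⊗ b) (a' ⊗ b') = (a * a') ⊗ (b * b').
Proof. by rewrite tensor_mul_purer (tfold_pure (bilinear_tensor_mulr _ _)). Qed.

Lemma comul_ltV : comul tV = tV ⊗ tV.
Proof.
have := comulM tV t; rewrite ltV_lt comul1 lt_comul tensor_mul_purer => e.
have := congr1 (fun s => tfold s (fun a b => (a * tV) ⊗ (b * tV))) e.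
rewrite /= (tfold_pure (bilinear_tensor_mulr _ _)) !mul1r => ->.
rewrite [X in tfold X]tfoldE (tfold_sum_pure (bilinear_tensor_mulr _ _)).
by rewrite [LHS]tensor_repr; apply: eq_bigr => x _; rewrite -!mulrA lt_ltV !mulr1.
Qed.

Lemma comul_lt_pow n : comul (gl n) = gl n ⊗ gl n.
Proof.
elim/int_rec: n => [|n IH|n IH]; first by rewrite lt_pow0 comul1.
  by rewrite -addn1 PoszD !lt_pow_lt comulM IH lt_comul tensor_mul_pure.
by rewrite -addn1 PoszD opprD !lt_pow_ltV comulM IH comul_ltV tensor_mul_pure.
Qed.

Lemma counit_lt_pow n : counit (gl n) = 1.
Proof.
have eV : counit tV = 1.
  by have := counitM t tV; rewrite lt_ltV counit1 lt_counit mul1r.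
elim/int_rec: n => [|n IH|n IH]; first by rewrite lt_pow0 counit1.
  by rewrite -addn1 PoszD !lt_pow_lt counitM IH lt_counit mulr1.
by rewrite -addn1 PoszD opprD !lt_pow_ltV counitM IH eV mulr1.
Qed.

Lemma antipode_lt_pow n : antipode (gl n) * gl n = 1.
Proof.
have := antipode_left (gl n); rewrite comul_lt_pow (tfold_pure (bilinear_antipodel _)).
by rewrite counit_lt_pow scale1r.
Qed.

(** Freeness is given only for finite lists of exponents. The relation [R h c], saying that c is the
    finitely supported coefficient family of h, is shown to be functional, linear and total, which
    yields the coordinate functionals. *)
Lemma laurent_coefficient : exists co : int -> H -> k^o,
  (forall n, linear (co n)) /\ forall m n, co n (gl m) = (m == n)%:R.
Proof.
pose R (h : H) (c : int -> k) := exists s : seq int, [/\ uniq s,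
  forall n, n \notin s -> c n = 0 & h = \sum_(n <- s) c n *: gl n].
have enlarge (s s' : seq int) (c : int -> k) : uniq s -> uniq s' -> {subset s <= s'} ->
    (forall n, n \notin s -> c n = 0) ->
    \sum_(n <- s) c n *: gl n = \sum_(n <- s') c n *: gl n.
  move=> us us' ss cs; rewrite [RHS](bigID (mem s)) /= [X in _ + X]big1 ?addr0; last first.
    by move=> n /cs ->; rewrite scale0r.
  rewrite -[RHS]big_filter; apply: perm_big; apply: uniq_perm => //; first exact: filter_uniq.
  move=> n; rewrite mem_filter /=; case: (boolP (n \in s)) => [/ss ->//|//].
have Runiq h c c' : R h c -> R h c' -> c = c'.
  move=> [s [us cs hs]] [s' [us' cs' hs']]; apply/funext => n.
  pose S := undup (n :: s ++ s').
  have uS : uniq S by apply: undup_uniq.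
  have sub1 : {subset s <= S} by move=> i hi; rewrite mem_undup inE mem_cat hi orbT.
  have sub2 : {subset s' <= S} by move=> i hi; rewrite mem_undup inE mem_cat hi !orbT.
  apply/eqP; rewrite -subr_eq0; apply/eqP.
  apply: (@lt_free _ H S (fun n => c n - c' n) uS); last by rewrite mem_undup mem_head.
  under eq_bigr do rewrite scalerBl.
  by rewrite sumrB -(enlarge s S c) // -(enlarge s' S c') // -hs -hs' subrr.
have Rlin a h h' c c' : R h c -> R h' c' -> R (a *: h + h') (fun n => a * c n + c' n).
  move=> [s [us cs hs]] [s' [us' cs' hs']].
  pose S := undup (s ++ s').
  have uS : uniq S by apply: undup_uniq.
  have sub1 : {subset s <= S} by move=> i hi; rewrite mem_undup mem_cat hi.
  have sub2 : {subset s' <= S} by move=> i hi; rewrite mem_undup mem_cat hi orbT.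
  exists S; split=> // [n|].
    by rewrite mem_undup mem_cat negb_or => /andP [/cs -> /cs' ->]; rewrite mulr0 addr0.
  rewrite hs hs' (enlarge s S c) // (enlarge s' S c') // scaler_sumr -big_split /=.
  by apply: eq_bigr => n _; rewrite scalerDl scalerA.
have Rgl m : R (gl m) (fun n => (m == n)%:R).
  exists [:: m]; split=> //; last by rewrite big_seq1 eqxx scale1r.
  by move=> n; rewrite inE eq_sym => /negPf ->.
have Rex h : exists c, R h c.
  have [s ->] := lt_span h; elim: s => [|y s [c hc]].
    by exists (fun=> 0); exists [::]; rewrite !big_nil.
  by exists (fun n => y.1 * (y.2 == n)%:R + c n); rewrite big_cons; apply: Rlin.
have /choice [co hco] := Rex.
exists (fun n h => co h n); split=> [n a h h'|m n].
  by rewrite (Runiq _ _ _ (hco _) (Rlin a _ _ _ _ (hco h) (hco h'))).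
by rewrite (Runiq _ _ _ (hco _) (Rgl m)).
Qed.

Lemma laurent_ind (Q : H -> Prop) : is_subspace Q -> (forall n, Q (gl n)) -> forall h, Q h.
Proof.
move=> sQ Qg h; have [s ->] := lt_span h.
by apply: is_subspace_sum => // y; apply: is_subspaceZ.
Qed.
End LaurentHopf.

Section GradedBundle.
Variables (k : fieldType) (P : algType k) (gr : int -> P -> Prop) (G : Z_grading gr).
Variables (H : laurent_hopf k) (rho : P -> P ⊗ H).
Hypotheses (rho_lin : linear rho) (rho_gr : forall n p, gr n p -> rho p = p ⊗ lt_pow H n).
Variable W : fodc P.
Local Notation d := (diff W).
Local Notation gl := (lt_pow H).

(* The grading is strong; in positive degrees this is witnessed by closed elements. *)
Hypothesis strong : forall n : int, exists s : seq (P * P),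
  [/\ forall y, y \in s -> gr (- n) y.1 /\ gr n y.2,
      (0 <= n) -> forall y, y \in s -> d y.2 = 0 &
      \sum_(y <- s) y.1 * y.2 = 1].

Variable Wn : int -> W -> Prop.
Hypothesis Wn_sub : forall n, is_subspace (Wn n).
Hypothesis Wn_gr : forall m n p p', gr m p -> gr n p' -> Wn (m + n) (lact p (d p')).
Hypothesis Wn_direct : forall (S : seq int) (w : int -> W), uniq S -> (forall n, Wn n (w n)) ->
  \sum_(n <- S) w n = 0 -> forall n, n \in S -> w n = 0.

Lemma gr_ind (Q : P -> Prop) : is_subspace Q -> (forall n p, gr n p -> Q p) -> forall p, Q p.
Proof.
move=> sQ Qg p; have [s [f [hf ->]]] := gr_sum G p.
by apply: is_subspace_sum => // n; apply: Qg (hf n).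
Qed.

Lemma equalizer_subspace (M L : lmodType k) (f h : M -> L) : linear f -> linear h ->
  is_subspace (fun v => f v = h v).
Proof.
move=> lf lh; split=> [|c v w e1 e2]; first by rewrite !linear_for0.
by rewrite lf lh e1 e2.
Qed.

Lemma linear_tfold_rho (L : lmodType k) (f : P -> H -> L) : bilinear_map f ->
  linear (fun p => tfold (rho p) f).
Proof. by move=> bf c p p'; rewrite rho_lin (tfold_linear bf). Qed.

Lemma rho_pure (L : lmodType k) (f : P -> H -> L) n p : bilinear_map f -> gr n p ->
  tfold (rho p) f = f p (gl n).
Proof. by move=> bf gp; rewrite (rho_gr gp) (tfold_pure bf). Qed.

Lemma bilinear_tfold2 (M N M' N' L : lmodType k) (f : M -> N -> M' -> N' -> L) (t : M' ⊗ N') :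
  (forall a b, bilinear_map (fun m n => f m n a b)) ->
  bilinear_map (fun m n => tfold t (f m n)).
Proof.
move=> bf; split=> [n|m].
  by apply: (@linear_tfold_param k M' N' _ L M t (fun m => f m n)) => a b; apply: (bf a b).1.
by apply: (@linear_tfold_param k M' N' _ L N t (f m)) => a b; apply: (bf a b).2.
Qed.

Lemma rho_comodule_algebra : right_comodule_algebra rho.
Proof.
have b1 h : bilinear_map (fun p00 p01 => p00 ⊗ (p01 ⊗ h) : (P ⊗ (H ⊗ H)%type)%type).
  split=> [n|m] c u v; first by rewrite (tens_bilinear _).1.
  by rewrite (tens_bilinear _).1 (tens_bilinear _).2.
have b2 : bilinear_map (fun p0 h =>
    \tsum_(p00, p01 <- rho p0) (p00 ⊗ (p01 ⊗ h) : (P ⊗ (H ⊗ H)%type)%type)).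
  split=> [h|p]; first exact: linear_tfold_rho.
  apply: linear_tfold_param => m n c u v.
  by rewrite (tens_bilinear _).2 (tens_bilinear _).2.
have b3 : bilinear_map (fun p0 h => p0 ⊗ comul h : (P ⊗ (H ⊗ H)%type)%type).
  split=> [n|m] c u v; first by rewrite (tens_bilinear _).1.
  by rewrite linearP (tens_bilinear _).2.
have b4 : bilinear_map (fun (p0 : P) (h : H) => counit h *: p0).
  split=> [n|m] c u v; first by rewrite scalerDr !scalerA mulrC.
  by rewrite linearP scalerDl scalerA.
split=> //.
- apply: gr_ind; first by apply: equalizer_subspace; apply: linear_tfold_rho.
  by move=> n p gp; rewrite !(rho_pure _ gp) // comul_lt_pow.
- apply: gr_ind; first by apply: equalizer_subspace => //; apply: linear_tfold_rho.
  by move=> n p gp; rewrite !(rho_pure _ gp) // counit_lt_pow scale1r.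
- exact: rho_gr (gr_one G).
have bm (s : (P ⊗ H)%type) : bilinear_map (fun (a : P) (b : H) =>
    \tsum_(a', b' <- s) ((a * a') ⊗ (b * b'))).
  apply: (@bilinear_tfold2 P H P H _ (fun a b a' b' => (a * a') ⊗ (b * b'))) => a b.
  exact: bilinear_tensor_mulr.
move=> p p'; move: p; apply: gr_ind.
  apply: equalizer_subspace => c u v; first by rewrite mulrDl -scalerAl rho_lin.
  by rewrite /tensor_mul rho_lin (tfold_linear (bm _)).
move=> n p gp; move: p'; apply: gr_ind.
  apply: equalizer_subspace => c u v; first by rewrite mulrDr -scalerAr rho_lin.
  rewrite (rho_gr gp) /tensor_mul !(tfold_pure (bm _)) rho_lin.
  by rewrite (tfold_linear (bilinear_tensor_mull _ _)).
move=> n' p' gp'.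
by rewrite (rho_gr gp) (rho_gr gp') (rho_gr (gr_mul G gp gp')) tensor_mul_pure lt_powD.
Qed.

Definition rho_form (p p' : P) : (W ⊗ H)%type :=
  \tsum_(p0, p1 <- rho p) \tsum_(p0', p1' <- rho p') (lact p0 (d p0') ⊗ (p1 * p1')).

Lemma rho_form_bilinear : bilinear_map rho_form /\
  forall m n p p', gr m p -> gr n p' -> rho_form p p' = lact p (d p') ⊗ gl (m + n).
Proof.
have bi (p0 : P) (p1 : H) : bilinear_map (fun p0' p1' =>
    lact p0 (d p0') ⊗ (p1 * p1') : (W ⊗ H)%type).
  split=> [h|p] c u v; last by rewrite mulrDr -scalerAr (tens_bilinear _).2.
  by rewrite linearP (lact_bilinear W).2 (tens_bilinear _).1.
have bo p' : bilinear_map (fun p0 p1 =>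
    \tsum_(p0', p1' <- rho p') (lact p0 (d p0') ⊗ (p1 * p1')) : (W ⊗ H)%type).
  apply: (@bilinear_tfold2 P H P H _ (fun p0 p1 p0' p1' => lact p0 (d p0') ⊗ (p1 * p1'))) => a b.
  split=> [h|p] c u v.
    by rewrite (lact_bilinear W).1 (tens_bilinear _).1.
  by rewrite mulrDl -scalerAl (tens_bilinear _).2.
split; first split=> [p'|p].
- exact: linear_tfold_rho.
- by apply: linear_tfold_param => m n; apply: linear_tfold_rho.
by move=> m n p p' gp gp'; rewrite /rho_form !(rho_pure _ gp) // !(rho_pure _ gp') // lt_powD.
Qed.

(** The sum is sorted by degree: by [Wn_direct] each homogeneous part of a vanishing form vanishes,
    and the coaction merely tensors that part with a power of t. *)
Lemma rho_form_well_defined (s : seq (P * P)) :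
  \sum_(y <- s) lact y.1 (d y.2) = 0 -> \sum_(y <- s) rho_form y.1 y.2 = 0.
Proof.
have [bf fgr] := rho_form_bilinear.
(* A decomposition T of w into homogeneous forms, with t the same sum in which each term carries its
   degree. *)
pose Q (w : W) (t : (W ⊗ H)%type) := exists T : seq (int * W),
  [/\ forall y, y \in T -> Wn y.1 y.2, w = \sum_(y <- T) y.2 & t = \sum_(y <- T) (y.2 ⊗ gl y.1)].
have Q0 : Q 0 0 by exists [::]; rewrite !big_nil.
have Qlin c w w' t t' : Q w t -> Q w' t' -> Q (c *: w + w') (c *: t + t').
  move=> [T [hT -> ->]] [T' [hT' -> ->]]; exists ([seq (y.1, c *: y.2) | y <- T] ++ T').
  split.
  - move=> y; rewrite mem_cat => /orP [/mapP [y' hy' ->]|]; last exact: hT'.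
    by rewrite /=; apply: is_subspaceZ => //; apply: hT.
  - by rewrite big_cat big_map scaler_sumr.
  - rewrite big_cat big_map scaler_sumr; congr (_ + _).
    by apply: eq_bigr => y _; rewrite tensZl.
have Qp p p' : Q (lact p (d p')) (rho_form p p').
  move: p; apply: gr_ind.
    split=> [|c u v hu hv].
      by rewrite (linear_for0 ((lact_bilinear W).1 _)) (linear_for0 (bf.1 _)).
    by rewrite (lact_bilinear W).1 bf.1; apply: Qlin.
  move=> m p gp; move: p'; apply: gr_ind.
    split=> [|c u v hu hv].
      by rewrite linear0 lact0r (linear_for0 (bf.2 _)).
    by rewrite linearP (lact_bilinear W).2 bf.2; apply: Qlin.
  move=> n p' gp'; exists [:: (m + n, lact p (d p'))]; split.
  - by move=> y; rewrite inE => /eqP ->; apply: Wn_gr.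
  - by rewrite big_seq1.
  - by rewrite big_seq1 /=; apply: fgr.
have [T [hT -> ->]] : Q (\sum_(y <- s) lact y.1 (d y.2)) (\sum_(y <- s) rho_form y.1 y.2).
  elim: s => [|y s IH]; first by rewrite !big_nil.
  rewrite !big_cons -[lact _ _]scale1r -[rho_form _ _]scale1r.
  exact: Qlin (Qp _ _) IH.
pose S := undup [seq y.1 | y <- T].
have uS : uniq S by apply: undup_uniq.
have TS : all (fun y => y.1 \in S) T.
  by apply/allP => y hy; rewrite mem_undup map_f.
pose w n := \sum_(y <- T | y.1 == n) y.2.
have hw n : Wn n (w n).
  rewrite /w big_seq_cond; apply: big_ind => [|u v hu hv|y /andP [hy /eqP <-]].
  - exact: (Wn_sub n).1.
  - exact: is_subspaceD.
  - exact: hT.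
rewrite (big_group _ uS TS) => /(Wn_direct uS hw) w0.
rewrite (big_group _ uS TS) big_seq big1 // => n hn.
transitivity (w n ⊗ gl n); last by rewrite w0 // (linear_for0 ((tens_bilinear _).1 _)).
by rewrite tens_suml; apply: eq_bigr => y /eqP ->.
Qed.

(** The coaction is defined through a chosen presentation of each form by [forms_gen]; [DE] shows
    that any presentation gives the same value, from which linearity follows. *)
Lemma W_right_covariant : right_covariant rho W.
Proof.
have [bf fgr] := rho_form_bilinear.
have /choice [s hs] := forms_gen (f := W).
pose D w := \sum_(y <- s w) rho_form y.1 y.2.
have DE w (t : seq (P * P)) : w = \sum_(y <- t) lact y.1 (d y.2) ->
    D w = \sum_(y <- t) rho_form y.1 y.2.
  move=> hw; apply/eqP; rewrite -subr_eq0; apply/eqP.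
  have neg (f : P -> P -> (W ⊗ H)%type) : (forall b, linear (f^~ b)) ->
      \sum_(y <- s w) f y.1 y.2 - \sum_(y <- t) f y.1 y.2 =
      \sum_(y <- s w ++ [seq (- y.1, y.2) | y <- t]) f y.1 y.2.
    move=> lf; rewrite big_cat big_map /=; congr (_ + _); rewrite -sumrN.
    by apply: eq_bigr => y _; rewrite (linear_forN (lf _)).
  rewrite (neg rho_form); last by move=> b; apply: bf.1.
  apply: rho_form_well_defined; rewrite big_cat big_map /= -(hs w) {1}hw -big_split /= big1 //.
  by move=> y _; rewrite (linear_forN ((lact_bilinear W).1 _)) subrr.
have Dlin : linear D.
  move=> c w w'; rewrite (DE _ ([seq (c *: y.1, y.2) | y <- s w] ++ s w')).
    rewrite big_cat big_map /= scaler_sumr; congr (_ + _).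
    by apply: eq_bigr => y _; rewrite (linear_forZ (bf.1 _)).
  rewrite big_cat big_map /= -(hs w') {1}(hs w) scaler_sumr; congr (_ + _).
  by apply: eq_bigr => y _; rewrite lactZl.
pose DL := GRing.isLinear.Build k W (W ⊗ H)%type *:%R D Dlin.
pose Dl : {linear W -> (W ⊗ H)%type} := HB.pack D DL.
exists Dl => p p'; rewrite /= (DE _ [:: (p, p')]); first by rewrite big_seq1.
by rewrite big_seq1.
Qed.

Local Notation balance := (coinvariant_balance rho).
Definition can_pair (p p' : P) : P ⊗ H := \tsum_(p0, p1 <- rho p') ((p * p0) ⊗ p1).

Lemma can_pair_bilinear : bilinear_map can_pair.
Proof.
have b p : bilinear_map (fun (p0 : P) (p1 : H) => (p * p0) ⊗ p1).
  split=> [h|p'] c u v; last by rewrite (tens_bilinear _).2.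
  by rewrite mulrDr -scalerAr (tens_bilinear _).1.
split=> [p'|p]; last exact: linear_tfold_rho.
apply: linear_tfold_param => m n c u v.
by rewrite mulrDl -scalerAl (tens_bilinear _).1.
Qed.

Lemma can_pair_gr n p p' : gr n p' -> can_pair p p' = (p * p') ⊗ gl n.
Proof.
move=> gp; rewrite /can_pair (rho_pure _ gp) //.
split=> [h|p0] c u v; last by rewrite (tens_bilinear _).2.
by rewrite mulrDr -scalerAr (tens_bilinear _).1.
Qed.

Lemma can_pair_respects : respects balance can_pair.
Proof.
move=> _ _ [p [b [p' [cb -> ->]]]] /=; rewrite /can_pair.
have [_ _ _ _ ->] := rho_comodule_algebra.
rewrite (cb : rho b = b ⊗ 1).
have bm (s : (P ⊗ H)%type) : bilinear_map (fun (a : P) (b : H) =>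
    \tsum_(a', b' <- s) ((a * a') ⊗ (b * b'))).
  apply: (@bilinear_tfold2 P H P H _ (fun a b a' b' => (a * a') ⊗ (b * b'))) => a c.
  exact: bilinear_tensor_mulr.
rewrite /tensor_mul (tfold_pure (bm _)) [X in _ = tfold X _]tfoldE tfold_sum_pure.
  by rewrite tfoldE; apply: eq_bigr => x _; rewrite mul1r mulrA.
split=> [h|p0] c u v; last by rewrite (tens_bilinear _).2.
by rewrite mulrDr -scalerAr (tens_bilinear _).1.
Qed.

Lemma can_linear : linear (can (rho := rho)).
Proof. exact: tfold_is_linear can_pair_bilinear can_pair_respects. Qed.

Lemma can_tens p p' : can (tens balance p p') = can_pair p p'.
Proof. exact: tfold_tens can_pair_bilinear can_pair_respects. Qed.

Lemma coinvariant_gr0 b : gr 0 b -> coinvariant rho b.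
Proof. by move=> gb; rewrite /coinvariant (rho_gr gb). Qed.

Lemma tens_balance p b p' : gr 0 b -> tens balance (p * b) p' = tens balance p (b * p').
Proof.
move=> gb; apply: (@tens_respects _ _ _ balance (p * b, p') (p, b * p')).
by exists p, b, p'; split=> //; apply: coinvariant_gr0.
Qed.

(** Strong grading gives an inverse: p ⊗ t^n goes to [zeta p n], the sum of p y.1 ⊗ y.2 over a
    partition of 1 in degrees -n and n. *)
Lemma can_bijective : bijective (can (rho := rho)).
Proof.
have bt := tens_bilinear balance.
have /choice [Z hZ] := strong.
pose zeta (p : P) n : tensor_over_coinv rho := \sum_(y <- Z n) tens balance (p * y.1) y.2.
have zl n : linear (zeta ^~ n).
  move=> c u v; rewrite /zeta scaler_sumr -big_split /=; apply: eq_bigr => y _.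
  by rewrite mulrDl -scalerAl bt.1.
have can_zeta p n : can (zeta p n) = p ⊗ gl n.
  rewrite /zeta (linear_for_sum can_linear).
  have [hg _ h1] := hZ n; rewrite -[p in RHS]mulr1 -h1 mulr_sumr tens_suml.
  rewrite big_seq [RHS]big_seq; apply: eq_bigr => y /hg [_ gy].
  by rewrite can_tens (can_pair_gr _ gy) mulrA.
(* For p' of degree n the factors p' y.1 have degree 0 and pass over the balanced tensor sign, so p
   ⊗ p' equals [zeta (p * p') n]. *)
have nf t : exists T : seq (P * int), t = \sum_(x <- T) zeta x.1 x.2.
  pose Q (t : tensor_over_coinv rho) := exists T : seq (P * int), t = \sum_(x <- T) zeta x.1 x.2.
  have sQ : is_subspace Q.
    split=> [|c u v [T ->] [T' ->]]; first by exists [::]; rewrite big_nil.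
    exists ([seq (c *: x.1, x.2) | x <- T] ++ T').
    rewrite big_cat big_map /= scaler_sumr; congr (_ + _).
    by apply: eq_bigr => x _; rewrite (linear_forZ (zl _)).
  have Qt p p' : Q (tens balance p p').
    move: p'; apply: gr_ind.
      split=> [|c u v hu hv]; first by rewrite (linear_for0 (bt.2 _)); apply: sQ.1.
      by rewrite bt.2; apply: sQ.2.
    move=> n p' gp'; exists [:: (p * p', n)]; rewrite big_seq1 /=.
    have [hg _ h1] := hZ n; rewrite -[p' in LHS]mulr1 -h1 mulr_sumr (bilinear_sumr bt).
    rewrite /zeta big_seq [RHS]big_seq; apply: eq_bigr => y /hg [gy1 gy2].
    rewrite mulrA -tens_balance; first by rewrite mulrA.
    by have := gr_mul G gp' gy1; rewrite subrr.
  change (Q t); rewrite [t]gtensor_sum; apply: is_subspace_sum => //.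
have [co [lco hco]] := laurent_coefficient H.
have bco n : bilinear_map (fun (p : P) (h : H) => co n h *: p).
  split=> [h|p] c u v; first by rewrite scalerDr !scalerA mulrC.
  by rewrite lco scalerDl scalerA.
have ker0 (t : tensor_over_coinv rho) : can t = 0 -> t = 0.
  have [T ->] := nf t; rewrite (linear_for_sum can_linear).
  under eq_bigr do rewrite can_zeta.
  move=> e.
  have Tn n : \sum_(x <- T | x.2 == n) x.1 = 0.
    have := congr1 (fun s => tfold s (fun (p : P) (h : H) => co n h *: p)) e.
    rewrite /= (tfold_sum_pure (bco n)) (linear_for0 (tfold_linear (bco n))) => h; rewrite -[RHS]h.
    rewrite big_mkcond /=; apply: eq_bigr => x _; rewrite hco.
    by case: eqP; rewrite ?scale1r ?scale0r.
  pose S := undup [seq x.2 | x <- T].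
  rewrite (@big_group _ _ _ T S snd) ?undup_uniq //; last first.
    by apply/allP => y hy; rewrite mem_undup map_f.
  rewrite big1 // => n _.
  transitivity (\sum_(x <- T | x.2 == n) zeta x.1 n).
    by apply: eq_bigr => x /eqP ->.
  by rewrite -(linear_for_sum (zl n)) Tn (linear_for0 (zl n)).
have can_inj : injective (can (rho := rho)).
  move=> t t' e; apply/eqP; rewrite -subr_eq0; apply/eqP/ker0.
  by rewrite (linear_forB can_linear) e subrr.
have can_surj w : exists t, can (rho := rho) t = w.
  pose Im w := exists t, can (rho := rho) t = w.
  have sS : is_subspace Im.
    split=> [|c u v [t <-] [t' <-]]; first by exists 0; rewrite (linear_for0 can_linear).
    by exists (c *: t + t'); rewrite can_linear.
  change (Im w); rewrite [w]tensor_repr; apply: is_subspace_sum => // -[p h] /=.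
  move: h; apply: laurent_ind.
    split=> [|c u v hu hv].
      by rewrite (linear_for0 ((tens_bilinear _).2 _)); apply: sS.1.
    by rewrite (tens_bilinear _).2; apply: sS.2.
  by move=> n; exists (zeta p n).
have /choice [f hf] := can_surj.
by exists f => // t; apply: can_inj; rewrite hf.
Qed.

Lemma ver_linear : linear (ver rho).
Proof.
have bt : bilinear_map (fun p p' => tens balance p p') by exact: tens_bilinear.
by move=> c u v; rewrite /ver /to_tensor_over_coinv (tfold_linear bt) can_linear.
Qed.

Lemma ver_pure p p' : ver rho (p ⊗ p') = can_pair p p'.
Proof.
have bt : bilinear_map (fun p p' => tens balance p p') by exact: tens_bilinear.
by rewrite /ver /to_tensor_over_coinv (tfold_pure bt) can_tens.
Qed.

Lemma Ad_laurent (h : H) : Ad h = h ⊗ 1.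
Proof.
have b1 h1 : bilinear_map (fun h2 h3 : H => h2 ⊗ (antipode h1 * h3)).
  split=> [h3|h2] c u v; first by rewrite (tens_bilinear _).1.
  by rewrite mulrDr -scalerAr (tens_bilinear _).2.
have b2 : bilinear_map (fun h1 h' : H =>
    \tsum_(h2, h3 <- comul h') (h2 ⊗ (antipode h1 * h3) : (H ⊗ H)%type)).
  split=> [h'|h1] c u v; last by rewrite linearP (tfold_linear (b1 _)).
  apply: (@linear_tfold_param _ _ _ _ _ _ _ 
    (fun h1 h2 h3 => h2 ⊗ (antipode h1 * h3))) => m n e u' v'.
  by rewrite linearP mulrDl -scalerAl (tens_bilinear _).2.
move: h; apply: laurent_ind.
  apply: equalizer_subspace => c u v; last by rewrite (tens_bilinear _).1.
  by rewrite /Ad linearP (tfold_linear b2).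
move=> n; rewrite /Ad comul_lt_pow (tfold_pure b2) comul_lt_pow (tfold_pure (b1 _)).
by rewrite antipode_lt_pow.
Qed.

(** Applying the counit to the second leg of [ver] recovers multiplication in P, which vanishes on
    the kernel. *)
Lemma ver_kernel_counit t : fodc_kernel W t ->
  tensor_subspace (fun h : H => counit h = 0) (ver rho t).
Proof.
move=> [mt _]; set w := ver rho t.
have bE : bilinear_map (fun (p : P) (h : H) => counit h *: p).
  split=> [h|p] c u v; first by rewrite scalerDr !scalerA mulrC.
  by rewrite linearP scalerDl scalerA.
have Ew : \tsum_(p, h <- w) (counit h *: p) = 0.
  rewrite -mt /w [in ver _ _](tensor_repr t) (linear_for_sum ver_linear) (tfold_sum bE).
  rewrite tfoldE; apply: eq_bigr => x _; rewrite ver_pure /can_pair.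
  rewrite [X in tfold X]tfoldE (tfold_sum_pure bE).
  have [_ _ hc _ _] := rho_comodule_algebra.
  rewrite -[x.2 in RHS]hc tfoldE mulr_sumr.
  by apply: eq_bigr => y _; rewrite -scalerAr.
(* Each second leg is projected to the kernel of the counit; the total correction is zero by
   [Ew]. *)
exists [seq (y.1, y.2 - counit y.2 *: 1) | y : P * H <- repr w].
  move=> y /mapP [y' _ ->] /=.
  by rewrite linearB linearZ /= counit1 [_ *: _]mulr1 subrr.
rewrite big_map /= {1}[w]tensor_repr.
have -> : \sum_(y <- repr w) (y.1 ⊗ (y.2 - counit y.2 *: 1)) =
    \sum_(y <- repr w) (y.1 ⊗ y.2) - (\sum_(y <- repr w) (counit y.2 : k) *: y.1) ⊗ 1.
  rewrite tens_suml -sumrB; apply: eq_bigr => y _.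
  rewrite (linear_forB ((tens_bilinear _).2 _)) tensZl.
  by rewrite (linear_forZ ((tens_bilinear _).2 _)).
by rewrite [X in _ - X ⊗ _]Ew (linear_for0 ((tens_bilinear _).1 _)) subr0.
Qed.

(** It suffices to reach p ⊗ t^n - p ⊗ 1. For n >= 0 the partition of 1 has closed second entries,
    so sum_y p y.1 ⊗ y.2 - p ⊗ 1 already lies in the kernel of the calculus. *)
Lemma ver_kernel_surjective w : tensor_subspace (fun h : H => counit h = 0) w ->
  exists2 t, fodc_kernel W t & ver rho t = w.
Proof.
have /choice [Z hZ] := strong.
have bm : bilinear_map (fun a b : P => a * b).
  by split=> [b|a] c u v; rewrite ?mulrDl ?mulrDr -?scalerAl -?scalerAr.
have bd : bilinear_map (fun a b : P => lact a (d b)).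
  split=> [b|a] c u v; first by rewrite (lact_bilinear W).1.
  by rewrite linearP (lact_bilinear W).2.
pose Q w := exists2 t, fodc_kernel W t & ver rho t = w.
have sQ : is_subspace Q.
  split=> [|c u v [t [h1 h2] <-] [t' [h1' h2'] <-]].
    exists 0; last by rewrite (linear_for0 ver_linear).
    by split; [rewrite (linear_for0 (tfold_linear bm)) | rewrite (linear_for0 (tfold_linear bd))].
  exists (c *: t + t'); last by rewrite ver_linear.
  by split; [rewrite (tfold_linear bm) h1 h1' | rewrite (tfold_linear bd) h2 h2'];
    rewrite scaler0 addr0.
have kerP (s : seq (P * P)) : \sum_(y <- s) y.1 * y.2 = 0 ->
    \sum_(y <- s) lact y.1 (d y.2) = 0 -> Q (\sum_(y <- s) can_pair y.1 y.2).
  move=> h1 h2; exists (\sum_(y <- s) (y.1 ⊗ y.2)).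
    by split; rewrite tfold_sum_pure.
  by rewrite (linear_for_sum ver_linear); apply: eq_bigr => y _; rewrite ver_pure.
have d1 : d 1 = 0.
  have := diffM W 1 1; rewrite mulr1 lact1 ract1 -{1}[d 1]addr0 => /addrI.
  by move=> <-.
have sumZ n : \sum_(y <- Z n) y.1 * y.2 = 1 by case: (hZ n).
have canZ p n e m : (forall y, y \in Z n -> gr m (y.2 * e)) ->
    \sum_(y <- Z n) can_pair (p * y.1) (y.2 * e) = (p * e) ⊗ gl m.
  move=> he; rewrite -[X in X * e]mulr1 -(sumZ n) mulr_sumr mulr_suml tens_suml.
  rewrite big_seq [RHS]big_seq; apply: eq_bigr => y /he gy.
  by rewrite (can_pair_gr _ gy) !mulrA.
have canZ1 p n : \sum_(y <- Z n) can_pair (p * y.1) y.2 = p ⊗ gl n.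
  transitivity (\sum_(y <- Z n) can_pair (p * y.1) (y.2 * 1)).
    by apply: eq_bigr => y _; rewrite mulr1.
  rewrite (canZ _ _ _ n) ?mulr1 // => y; have [hg _ _] := hZ n.
  by rewrite mulr1 => /hg [].
have Qpos p m : Q (p ⊗ gl (Posz m) - p ⊗ 1).
  have [hg hd _] := hZ m.
  have := kerP ((- p, 1) :: [seq (p * y.1, y.2) | y <- Z m]).
  rewrite !big_cons !big_map /= => h.
  have -> : p ⊗ gl (Posz m) - p ⊗ 1 = can_pair (- p) 1 +
      \sum_(y <- Z m) can_pair (p * y.1) y.2.
    rewrite canZ1 (can_pair_gr _ (gr_one G)) mulr1 addrC.
    by rewrite (linear_forN ((tens_bilinear _).1 _)).
  apply: h.
    under eq_bigr do rewrite -mulrA.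
    by rewrite -mulr_sumr sumZ !mulr1 addNr.
  rewrite d1 lact0r add0r big_seq big1 // => y hy.
  by rewrite hd // lact0r.
have Qneg p m : Q (p ⊗ gl (- Posz m) - p ⊗ 1).
  have [hg hd _] := hZ m; have [hg' _ _] := hZ (- Posz m).
  (* In negative degree the entries e.2 need not be closed. Each term p e.1 ⊗ e.2 is corrected by
     the p e.1 y.1 ⊗ y.2 e.2 with closed y.2: these have the same form, since sum_y y.1 d(y.2 e.2) =
     d(e.2), while y.2 e.2 has degree 0. *)
  have -> : p ⊗ gl (- Posz m) - p ⊗ 1 = \sum_(e <- Z (- Posz m))
      (can_pair (p * e.1) e.2 + \sum_(y <- Z m) can_pair (- (p * e.1) * y.1) (y.2 * e.2)).
    rewrite big_split /= canZ1; congr (_ + _).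
    rewrite -[p in LHS]mulr1 -(sumZ (- Posz m)) mulr_sumr tens_suml -sumrN.
    rewrite big_seq [RHS]big_seq; apply: eq_bigr => e he.
    rewrite (canZ _ _ _ 0).
      by rewrite mulNr (linear_forN ((tens_bilinear _).1 _)) mulrA.
    move=> y /hg [_ gy]; have [_ ge] := hg' _ he.
    by have := gr_mul G gy ge; rewrite subrr.
  apply: is_subspace_sum => // e.
  have := kerP ((p * e.1, e.2) :: [seq (- (p * e.1) * y.1, y.2 * e.2) | y <- Z m]).
  rewrite !big_cons !big_map /=; apply.
    under eq_bigr do rewrite mulrA -(mulrA (- _)).
    by rewrite -mulr_suml -mulr_sumr sumZ mulr1 mulNr subrr.
  have -> : \sum_(y <- Z m) lact (- (p * e.1) * y.1) (d (y.2 * e.2)) =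
      \sum_(y <- Z m) lact (- (p * e.1) * (y.1 * y.2)) (d e.2).
    rewrite big_seq [RHS]big_seq; apply: eq_bigr => y hy.
    by rewrite diffM hd // ract0l add0r -lactM mulrA.
  rewrite -lact_suml -mulr_sumr sumZ mulr1.
  by rewrite (linear_forN ((lact_bilinear W).1 _)) subrr.
change (tensor_subspace (fun h : H => counit h = 0) w -> Q w).
move=> [s hs ->]; elim: s hs => [|[p h] s IH] hs; first by rewrite big_nil; apply: sQ.1.
rewrite big_cons /=; apply: is_subspaceD => //; last first.
  by apply: IH => y hy; apply: hs; rewrite inE hy orbT.
have /= h0 := hs _ (mem_head _ _).
have -> : p ⊗ h = p ⊗ h - p ⊗ (counit h *: 1).
  by rewrite h0 scale0r (linear_for0 ((tens_bilinear _).2 _)) subr0.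
move: h {hs h0}; apply: laurent_ind.
  split=> [|c u v hu hv].
    by rewrite linear0 scale0r subrr; apply: sQ.1.
  have -> : p ⊗ (c *: u + v) - p ⊗ (counit (c *: u + v) *: 1) =
    c *: (p ⊗ u - p ⊗ (counit u *: 1)) + (p ⊗ v - p ⊗ (counit v *: 1)).
    rewrite linearP (tens_bilinear _).2 !(linear_forZ ((tens_bilinear _).2 _)).
    by rewrite scalerDl scalerBr opprD addrACA scalerA.
  exact: sQ.2.
move=> [m|m]; rewrite counit_lt_pow scale1r; first exact: Qpos.
by rewrite NegzE; apply: Qneg.
Qed.

Theorem graded_principal_bundle : quantum_principal_bundle rho W.
Proof.
split; [exact: rho_comodule_algebra|exact: W_right_covariant|exact: can_bijective|].
exists (fun h => counit h = 0); split=> //.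
- split; last by move=> h h' h0; rewrite counitM h0 mul0r.
  by split=> [|c u v hu hv]; rewrite ?linear0 // linearP /= hu hv scaler0 addr0.
- move=> h h0; exists [:: (h, 1)]; last by rewrite big_seq1 Ad_laurent.
  by move=> y; rewrite inE => /eqP ->.
move=> w; split=> [[t kt <-]|]; first exact: ver_kernel_counit.
exact: ver_kernel_surjective.
Qed.
End GradedBundle.

(** * The bundle of the Heckenberger-Kolb calculus *)

Section HeckenbergerKolbBundle.
Variables (k : fieldType) (q : k) (l : nat) (g : simple_type l) (x : 'I_l).
Hypotheses (q0 : q != 0) (qn1 : forall n, q ^+ n.+1 != 1).
Hypothesis kcl : forall p : {poly k}, size p != 1%N -> exists a, root p a.
Variables (U : quantum_group q g) (O : coordinate_algebra U).
Variables (B : flag_algebra O x) (P : sphere_algebra O x) (V : fundamental_basis U x).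
Variables (gr : int -> P -> Prop) (hgr : sphere_grading V B gr).

(** Nesting the relation for zbar and z gives the partitions of 1 for n >= 0, whose second entries
    are products of the closed z_i. Nesting the one for z' and zbar gives those for negative n. *)
Lemma sphere_strong_grading (W : fodc P) : HK_calculus V B W -> forall n : int,
  exists s : seq (P * P), [/\ forall y, y \in s -> gr (- n) y.1 /\ gr n y.2,
    0 <= n -> forall y, y \in s -> diff W y.2 = 0 & \sum_(y <- s) y.1 * y.2 = 1].
Proof.
move=> hW; have G := sg_grading hgr.
have [z [zb [z' [hz hzb [D hz'] zbz z'zb]]]] := sphere_generators q0 qn1 P V.
have grz := gr_z hgr hz; have grzb := gr_zb hgr hzb; have grz' := gr_z' hgr hz hz'.
have step (s : seq (P * P)) (a b : 'I_((fund_dim V).+1) -> P) n e :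
    (forall i, gr (- e) (b i)) -> (forall i, gr e (a i)) -> \sum_i b i * a i = 1 ->
    (forall y, y \in s -> gr (- n) y.1 /\ gr n y.2) -> \sum_(y <- s) y.1 * y.2 = 1 ->
    let s' := [seq (y.1 * b i, a i * y.2) | y <- s, i <- enum 'I_((fund_dim V).+1)] in
    (forall y, y \in s' -> gr (- (n + e)) y.1 /\ gr (n + e) y.2) /\
    \sum_(y <- s') y.1 * y.2 = 1.
  move=> gb ga ba gs ss; split=> [y /allpairsP [[y' i] /= [/gs [g1 g2] _ ->]] /=|].
    by split; [rewrite opprD; exact: (gr_mul G g1 (gb i)) |
      rewrite addrC; exact: (gr_mul G (ga i) g2)].
  rewrite big_allpairs_dep /= -[RHS]ss; apply: eq_bigr => y _.
  rewrite big_enum /=; under eq_bigr do rewrite mulrA -(mulrA y.1).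
  by rewrite -mulr_suml -mulr_sumr ba mulr1.
case=> m; rewrite ?NegzE.
  elim: m => [|m [s [gs ds ss]]].
    exists [:: (1, 1)]; rewrite big_seq1 mulr1 oppr0; split=> // [y|_ y]; rewrite inE => /eqP -> /=.
      by split; apply: gr_one G.
    have := diffM W 1 1; rewrite mulr1 lact1 ract1 -{1}[diff W 1]addr0 => /addrI.
    by move=> <-.
  have [gs' ss'] := step s z zb m 1 grzb grz zbz gs ss.
  rewrite -addn1 PoszD.
  exists [seq (y.1 * zb i, z i * y.2) | y <- s, i <- enum 'I_((fund_dim V).+1)].
  split=> // _ y /allpairsP [[y' i] /= [hy _ ->]] /=.
  by rewrite diffM (d_z hz hW) ract0l add0r ds // lact0r.
suff [s [gs ss]] : exists s : seq (P * P),
    (forall y, y \in s -> gr (- - Posz m.+1) y.1 /\ gr (- Posz m.+1) y.2) /\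
    \sum_(y <- s) y.1 * y.2 = 1.
  (* The closedness clause is vacuous in negative degree. *)
  by exists s; split.
elim: {m}m.+1 => [|m [s [gs ss]]].
  exists [:: (1, 1)]; rewrite big_seq1 mulr1 !oppr0; split=> // y; rewrite inE => /eqP -> /=.
  by split; apply: gr_one G.
have := step s zb z' (- Posz m) (-1) _ grzb z'zb gs ss.
have -> : - Posz m.+1 = - Posz m - 1 by rewrite -opprD -PoszD addn1.
rewrite opprK => /(_ grz') h.
by exists [seq (y.1 * z' i, zb i * y.2) | y <- s, i <- enum 'I_((fund_dim V).+1)].
Qed.

Variables (H : laurent_hopf k) (rho : P -> P ⊗ H) (hrho : grading_coaction gr rho).
Variables (W : fodc P) (hW : HK_calculus V B W).

Theorem HK_principal_bundle : quantum_principal_bundle rho W.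
Proof.
have [z [zb [z' [hz hzb [D hz'] zbz z'zb]]]] := sphere_generators q0 qn1 P V.
have [rl rg] := hrho; have G := sg_grading hgr.
pose Wn n (w : W) := exists a, rep gr n w a.
apply: (graded_principal_bundle (Wn := Wn) G rl rg (sphere_strong_grading hW)).
- move=> n; split=> [|c v w [a ha] [b hb]]; first by exists 0; apply: Rep0.
  by exists (c *: a + b); apply: rep_add => //; apply: (rep_scale hgr).
- move=> m n p p' gp gp'; exists (incl p * left_action (uE U x) (incl p')).
  exact: rep_pure gp gp' erefl.
move=> S w uS /choice [a ha].
exact: (rep_direct q0 qn1 kcl hgr hz hzb hz' zbz z'zb hW uS ha).
Qed.
End HeckenbergerKolbBundle.

Local Open Scope complex_scope.

(** A real root of unity has absolute value 1, so it is 1 or -1. *)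
Lemma real_not_root_of_unity (R : realType) (q : R) n : q != -1 -> q != 1 -> q%:C ^+ n.+1 != 1.
Proof.
move=> qN1 q1; rewrite -rmorphXn -(rmorph1 (real_complex R)) (inj_eq (@complexI R)).
apply/eqP => qn; have : `|q| ^+ n.+1 == 1 by rewrite -normrX qn normr1.
by rewrite pexpr_eq1 // eqr_norml ler01 andbT (negPf q1) (negPf qN1).
Qed.

Theorem proposition5p6 (R : realType) (q : R)
    (hq : [/\ q != -1, q != 0 & q != 1])
    (l : nat) (g : simple_type l) (x : 'I_l) (hx : irreducible_node g x)
    (U : quantum_group q%:C g) (O : coordinate_algebra U)
    (B : flag_algebra O x) (P : sphere_algebra O x)
    (V : fundamental_basis U x)
    (gr : int -> P -> Prop) (hgr : sphere_grading V B gr)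
    (H : laurent_hopf R[i]) (rho : P -> (P ⊗ H)%type)
    (hrho : grading_coaction gr rho)
    (Omega : fodc P) (hOmega : HK_calculus V B Omega) :
  quantum_principal_bundle rho Omega.
Proof.
have [qN1 q0 q1] := hq.
apply: (HK_principal_bundle _ _ _ hgr hrho hOmega).
- by rewrite -(rmorph0 (real_complex R)) (inj_eq (@complexI R)).
- by move=> n; apply: real_not_root_of_unity.
- move=> p; exact: (closed_rootP (p : {poly R[i]})).
Qed.
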